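(* Let $\nu$ be a measure on $\mathbb{R}^n$ satisfying $d\nu=e^f d\gamma$ for a twice-differentiable function $f$, and for $x\in\mathbb{R}^n$ let $\nu_x$ be the measure $d\nu_x(y)=\frac{\exp(\langle x,y\rangle)\,d\nu(y)}{\int\exp(\langle x,z\rangle)\,d\nu(z)}$. Then for every $r>0$ there exists a point $x_0\in\mathbb{R}^n$ with $|x_0|\le r$ such that $$\mathrm{W}_2(\nu_{x_0},\gamma_u)^2\le 2\frac{\sqrt n}{r}\mathcal{D}(f)-\inf_{y\in\mathbb{R}^n}\Delta f(y),$$ where $\gamma_u$ is the Gaussian measure with identity covariance whose centroid $u$ equals the centroid of $\nu_{x_0}$.
   Context: $\gamma$ is the standard Gaussian measure on $\mathbb{R}^n$. $\mathcal{D}(f)=\mathbf{GW}(\{\nabla f(x):x\in\mathbb{R}^n\})$, where $\mathbf{GW}(K)=\mathbb{E}\sup_{x\in K}\langle x,\Gamma\rangle$, $\Gamma\sim N(0,\mathrm{Id}_n)$. $\mathrm{W}_2$ is the quadratic Wasserstein distance with respect to Euclidean distance. *)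

(* Defs.v *)
From HB Require Import structures.
From mathcomp Require Import all_boot all_order all_algebra.
From mathcomp Require Import all_classical all_reals all_analysis.
Set Implicit Arguments. Unset Strict Implicit. Unset Printing Implicit Defensive.
Import Order.TTheory GRing.Theory Num.Theory.
Import numFieldNormedType.Exports.
Local Open Scope classical_set_scope.
Local Open Scope ring_scope.

(* ---------- The Borel (= product) sigma-algebra on R^n = 'rV[R]_n ---------- *)
Definition rV_display : measure_display -> measure_display.
Proof. exact. Qed.

Section measurable_rV.
Context {R : realType} (n : nat).
Definition rV_coord (i : 'I_n) (v : 'rV[R]_n) : R := v ord0 i.

Let rV_set0 : g_sigma_preimage rV_coord set0.
Proof. exact: sigma_algebra0. Qed.
Let rV_setC A : g_sigma_preimage rV_coord A -> g_sigma_preimage rV_coord (~` A).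
Proof. exact: sigma_algebraC. Qed.
Let rV_bigcup (F : _^nat) : (forall i, g_sigma_preimage rV_coord (F i)) ->
  g_sigma_preimage rV_coord (\bigcup_i (F i)).
Proof. exact: sigma_algebra_bigcup. Qed.

HB.instance Definition _ := @isMeasurable.Build (rV_display default_measure_display)
  'rV[R]_n (g_sigma_preimage rV_coord) rV_set0 rV_setC rV_bigcup.
End measurable_rV.

Section defs.
Context {R : realType} {n : nat}.
Local Notation V := 'rV[R]_n.

Definition dotv (x y : V) : R := \sum_(i < n) x ord0 i * y ord0 i.
Definition enorm (x : V) : R := Num.sqrt (dotv x x).

Definition evec (i : 'I_n) : V := \row_(j < n) (if j == i then 1 else 0).

Definition partial (i : 'I_n) (f : V -> R) (x : V) : R := 'D_(evec i) f x.
Definition grad (f : V -> R) (x : V) : V := \row_(i < n) partial i f x.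
Definition laplacian (f : V -> R) (x : V) : R :=
  \sum_(i < n) partial i (partial i f) x.

Definition twice_differentiable (f : V -> R) : Prop :=
  (forall x, differentiable f x) /\ (forall x, differentiable (grad f) x).

Definition std_gaussian (gamma : probability V R) : Prop :=
  forall A : 'I_n -> set R, (forall i, measurable (A i)) ->
    gamma [set v : V | forall i, A i (v ord0 i)] =
    (\prod_(i < n) normal_prob 0 1 (A i))%E.

Definition GW (gamma : probability V R) (K : set V) : \bar R :=
  (\int[gamma]_g ereal_sup [set (dotv x g)%:E | x in K])%E.

Definition Dcal (gamma : probability V R) (f : V -> R) : \bar R :=
  GW gamma [set grad f x | x in [set: V]].

Definition tilt (nu : set V -> \bar R) (x : V) : set V -> \bar R :=
  fun A => ((\int[nu]_(y in A) (expR (dotv x y))%:E) /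
            (\int[nu]_z (expR (dotv x z))%:E))%E.

Definition centroid (mu : set V -> \bar R) : V :=
  \row_(i < n) fine (\int[mu]_y (y ord0 i)%:E)%E.

Definition gauss_at (gamma : set V -> \bar R) (u : V) : set V -> \bar R :=
  fun A => gamma [set y | A (y + u)].

Definition coupling (pi : probability (V * V)%type R) (mu1 mu2 : set V -> \bar R)
  : Prop :=
  forall A : set V, measurable A ->
    pi (A `*` [set: V]) = mu1 A /\ pi ([set: V] `*` A) = mu2 A.

Definition W2sq (mu1 mu2 : set V -> \bar R) : \bar R :=
  ereal_inf [set c | exists pi : probability (V * V)%type R,
     coupling pi mu1 mu2 /\
     c = (\int[pi]_z (enorm (z.1 - z.2) ^+ 2)%:E)%E].

End defs.

(* Main.v *)
(* Let h(y) = sup_x <grad f(x) - grad f(0), y>, so that E h = D(f).  If D(f) is finite,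
   then f is Lipschitz.

   Choice of x0.  Let b(x) be the mean of grad f under nu_x.  Its divergence is
   v(x) = sum_i Var_{nu_x}(y_i) - n, and <b(x) - grad f(0), y> <= h(y).  Integrating the
   divergence of the field y |-> b(r y / t) against (t^8 - |y|^8)_+ dy, and then averaging over
   t > 0 with a weight that turns the Lebesgue integral of h into a Gaussian one, bounds
   the minimum of v over the ball of radius r by 2 sqrt(n) D(f) / r.

   Energy.  Comparing the integral of e^f for gamma with that of e^f(c .) at second order as
   c -> 1, through y' = c y + sqrt(1 - c^2) z and the heat lower bound
   E f(x + s z) >= f(x) - L s^2 / 2, gives int e^f (|grad f|^2 - L) <= int e^f (|y|^2 - n).
   Applied to f + <x0, .> with u the centroid of nu_x0, it bounds the relative Fisher information
   int |grad f + x0 - u|^2 dnu_x0 by L + v(x0), where -L = inf Delta f.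

   Transport.  The triangular (Knothe) map sends nu_x0 to gamma coordinate by coordinate, and a
   one-dimensional transport-information inequality on each coordinate bounds its cost, after
   the translation by u, by that Fisher information. *)
Require Import Defs.
From HB Require Import structures.
From mathcomp Require Import all_boot all_order all_algebra.
From mathcomp Require Import all_classical all_reals all_analysis.
From mathcomp Require Import measurable_realfun ring lra.
Set Implicit Arguments. Unset Strict Implicit. Unset Printing Implicit Defensive.
Import Order.TTheory GRing.Theory Num.Theory.
Import numFieldNormedType.Exports.
Local Open Scope classical_set_scope.
Local Open Scope ring_scope.

(** * Row vectors: coordinates, boxes and measurability *)

Section rowvectors.
Context {R : realType} {n : nat}.
Local Notation V := 'rV[R]_n.

(** The potential is only twice differentiable, so [laplacian f] need not be continuous, and it is
    never integrated. Its lower bound enters at single points, at the maximum that yields the heat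
    inequality; from there on only f, its continuous gradient and that inequality occur. This is why
    the energy bound compares dilates instead of integrating by parts twice. The triangular map
    suits the transport step because each coordinate is an explicit monotone map of the line, whose
    regularity follows from the bounded gradient of f, and because Fisher information does not
    increase under marginals, so the coordinate costs add up to at most the full one. The averaging
    step bounds the minimum of v by (8/7) sqrt(n + 2) E h / r, with n + 2 where n is wanted; the
    factor 2 of the theorem absorbs this when 4 (7/8)^2 n > n + 2, which at n = 1 reads 49/16 > 3.
    An exponent p in place of 8 would give (p - 1)/p in place of 7/8, and 8 is the least integer for
    which the square of 2 (p - 1)/p exceeds 3. *)

Lemma normv_leP (x : V) (e : R) : 0 <= e ->
  (`|x| <= e) <-> (forall i, `|x ord0 i| <= e).
Proof.
move=> e0; split.
  move=> xe i; apply: le_trans xe.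
  have -> : `|x| = mx_norm x by [].
  rewrite mx_normrE.
  exact: (le_bigmax_cond _ (fun ij => `|x ij.1 ij.2|) (j := (ord0, i))).
move=> xe; have -> : `|x| = mx_norm x by [].
rewrite mx_normrE; apply: bigmax_le => // -[a b] _ /=.
by rewrite (ord1 a); exact: xe.
Qed.

Lemma coord_le_normv (x : V) i : `|x ord0 i| <= `|x|.
Proof. exact: ((normv_leP x (normr_ge0 x)).1 (lexx _)). Qed.

Lemma measurable_coord (i : 'I_n) : measurable_fun setT (fun v : V => v ord0 i).
Proof.
move=> _ Y mY; rewrite setTI; apply: sub_sigma_algebra => /=.
rewrite -bigcup_seq/=; exists i => /=; first by rewrite mem_index_enum.
by exists Y => //; rewrite setTI.
Qed.

Lemma measurable_rowP d (T : measurableType d) (h : T -> V) :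
  measurable_fun setT h <-> forall i, measurable_fun setT (fun x => h x ord0 i).
Proof.
split=> [mh i|mh].
  exact: (measurableT_comp (measurable_coord i) mh).
apply: (measurability (\big[setU/set0]_(i < n)
  preimage_set_system setT (@rV_coord R n i) measurable)) => //.
move=> B [C]; rewrite -bigcup_seq => -[i _ [A mA <-]] <-.
rewrite setTI -comp_preimage.
by have := mh i measurableT A mA; rewrite setTI.
Qed.

Lemma measurable_row d (T : measurableType d) (h : 'I_n -> T -> R) :
  (forall i, measurable_fun setT (h i)) ->
  measurable_fun setT (fun x => \row_i h i x : V).
Proof.
move=> mh; apply/measurable_rowP => i.
by under eq_fun do rewrite mxE; exact: mh.
Qed.

Definition boxes : set (set V) := [set [set v : V | forall i, A i (v ord0 i)] |
  A in [set A : 'I_n -> set R | forall i, measurable (A i)]].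

Lemma box_measurable (A : 'I_n -> set R) : (forall i, measurable (A i)) ->
  measurable [set v : V | forall i, A i (v ord0 i)].
Proof.
move=> mA.
have -> : [set v : V | forall i, A i (v ord0 i)] =
   \bigcap_(i in [set: 'I_n]) ((fun v : V => v ord0 i) @^-1` (A i)).
  by apply/seteqP; split => v /= Av i; [move=> _|]; exact: Av.
rewrite -bigsetI_fset_set; last exact: finite_finset.
apply: bigsetI_measurable => i _; rewrite -[X in measurable X]setTI.
exact: measurable_coord.
Qed.

Lemma measurable_boxes : @measurable _ V = <<s boxes >>.
Proof.
apply/seteqP; split; last first.
  apply: smallest_sub; first exact: sigma_algebra_measurable.
  by move=> _ [A mA <-]; exact: box_measurable.
apply: smallest_sub; first exact: smallest_sigma_algebra.
move=> C; rewrite -bigcup_seq => -[i _ [A mA <-]].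
apply: sub_sigma_algebra; exists (fun j => if j == i then A else setT).
  by move=> j /=; case: ifP.
rewrite setTI; apply/seteqP; split => v /=.
  by move=> /(_ i); rewrite eqxx.
by move=> Av j; case: eqP => // ->.
Qed.

Lemma boxes_setI : setI_closed boxes.
Proof.
move=> _ _ [A mA <-] [B mB <-]; exists (fun i => A i `&` B i).
  by move=> i /=; exact: measurableI.
apply/seteqP; split => v /=; first by move=> h; split => i; case: (h i).
by move=> [h1 h2] i; split.
Qed.

(** Boxes form a pi-system that generates the sigma-algebra. [std_gaussian] prescribes the measure
    of boxes only, and the invariance properties of [gamma] are derived from that prescription
    through this uniqueness. *)
Lemma boxes_unique (m1 m2 : {measure set V -> \bar R}) :
  (m1 setT < +oo)%E ->
  (forall A : 'I_n -> set R, (forall i, measurable (A i)) ->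
    m1 [set v : V | forall i, A i (v ord0 i)] =
    m2 [set v : V | forall i, A i (v ord0 i)]) ->
  forall A, measurable A -> m1 A = m2 A.
Proof.
move=> m1T h; apply: (@measure_unique _ R V boxes (fun=> setT)).
- exact: measurable_boxes.
- exact: boxes_setI.
- move=> _; exists (fun=> setT) => //=.
  by apply/seteqP; split.
- by rewrite bigcup_const.
- by move=> _ [A mA <-]; exact: h.
- by [].
Qed.

(** Rounding down to the grid of mesh 1/(N+1): the map has countable range and its fibres are
    half-open boxes. *)
Let rnd (N : nat) (y : V) : V := \row_i ((Num.floor (N.+1%:R * y ord0 i))%:~R / N.+1%:R).

Let rnd_cvg y : rnd ^~ y @ \oo --> y.
Proof.
apply/cvgrPdist_le => e e0; near=> N; apply/normv_leP; first exact: ltW.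
move=> i; rewrite !mxE.
have N0 : (0 : R) < N.+1%:R by [].
set t := y ord0 i; set z := Num.floor _.
have /andP[z1 z2] : (z%:~R <= N.+1%:R * t) && (N.+1%:R * t < (z + 1)%:~R).
  by rewrite -floor_eq; apply/eqP.
apply: (@le_trans _ _ N.+1%:R^-1).
  rewrite -(ler_pM2l N0) divff ?gt_eqF// -[X in X * `|_|](gtr0_norm N0) -normrM.
  rewrite mulrBr mulrCA divff ?gt_eqF// mulr1 ger0_norm ?subr_ge0//.
  by rewrite lerBlDl; apply/ltW; rewrite intrD in z2.
rewrite invf_ple ?posrE//.
near: N; exists (Num.truncn e^-1) => // N /= hN.
have := truncnS_gt e^-1; move=> /ltW /le_trans; apply.
by rewrite ler_nat ltnS.
Unshelve. all: end_near. Qed.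

(** Supplies a countable dense set, to which the supremum defining the support function of the
    gradients is restricted later. *)
Lemma grid_approx (x : V) : exists z : nat -> 'rV[int]_n,
  (fun N => \row_i ((z N ord0 i)%:~R / N.+1%:R) : V) @ \oo --> x.
Proof.
exists (fun N => \row_i Num.floor (N.+1%:R * x ord0 i)).
rewrite (_ : (fun N => _) = rnd ^~ x); first exact: rnd_cvg.
by apply/funext => N; apply/rowP => i; rewrite !mxE.
Qed.

(** The sigma-algebra is generated by the coordinates, not by the open sets. A continuous f is the
    pointwise limit of f composed with [rnd N], which takes countably many values, each on a union
    of boxes. *)
Lemma continuous_measurable_rV (f : V -> R) : continuous f -> measurable_fun setT f.
Proof.
move=> cf; apply: (@measurable_fun_cvg _ _ _ setT (fun N y => f (rnd N y))).
  move=> N _ B mB; rewrite setTI.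
  have -> : (fun y => f (rnd N y)) @^-1` B =
    \bigcup_(z in [set z : 'rV[int]_n | B (f (\row_i ((z ord0 i)%:~R / N.+1%:R)))])
     [set y : V | forall i, [set t : R | Num.floor (N.+1%:R * t) = z ord0 i] (y ord0 i)].
    apply/seteqP; split => y /=.
      move=> By; exists (\row_i Num.floor (N.+1%:R * y ord0 i)) => /=.
        have <- // : rnd N y = \row_i (((\row_j Num.floor (N.+1%:R * y ord0 j)) ord0 i)%:~R / N.+1%:R).
        by apply/rowP => i; rewrite !mxE.
      by move=> i; rewrite mxE.
    move=> [z /= Bz hz].
    have -> // : rnd N y = \row_i ((z ord0 i)%:~R / N.+1%:R).
    by apply/rowP => i; rewrite !mxE hz.
  rewrite bigcup_mkcond; apply: countable_bigcupT_measurable; first exact: countableP.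
  move=> z; case: ifP => // _; apply: (@box_measurable (fun i => [set t : R | Num.floor (N.+1%:R * t) = z ord0 i])) => i.
  have -> : [set t : R | Num.floor (N.+1%:R * t) = z ord0 i] =
      [set` `[(z ord0 i)%:~R / N.+1%:R, (z ord0 i + 1)%:~R / N.+1%:R[].
    apply/seteqP; split => t /=; rewrite in_itv /=.
      by move=> /eqP; rewrite floor_eq ler_pdivrMr// ltr_pdivlMr// (mulrC t).
    rewrite ler_pdivrMr// ltr_pdivlMr// (mulrC t) => h.
    by apply/eqP; rewrite floor_eq.
  exact: measurable_itv.
by move=> y _; apply: (cvg_comp (fun N => rnd N y) f); [exact: rnd_cvg|exact: cf].
Qed.

End rowvectors.

(** * Integrals against densities and image measures *)

Section density.
Local Open Scope ereal_scope.
Context d (T : measurableType d) (R : realType).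
Variables (mu nu : {measure set T -> \bar R}) (rho : T -> R).
Hypothesis mrho : measurable_fun setT rho.
Hypothesis rho0 : forall x, (0 <= rho x)%R.
Hypothesis nuE : forall A, measurable A -> nu A = \int[mu]_(x in A) (rho x)%:E.

Import HBNNSimple.

(** The density relation is known on sets only, as for [nu] in the theorem; simple functions and
    monotone convergence carry it over to integrals. *)
Lemma ge0_integral_density (F : T -> \bar R) : measurable_fun setT F ->
  (forall x, 0 <= F x) ->
  \int[nu]_x F x = \int[mu]_x (F x * (rho x)%:E).
Proof.
move=> mF F0; pose f_ := nnsfun_approx measurableT mF.
have cvgf x : (f_ n x)%:E @[n --> \oo] --> F x by apply: cvg_nnsfun_approx => //= y _; exact: F0.
have ndf x : {homo (fun n => f_ n x) : m n / (m <= n)%N >-> (m <= n)%R}.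
  by move=> m n mn; exact/lefP/nd_nnsfun_approx.
transitivity (limn (fun n => \int[nu]_x (f_ n x)%:E)).
  rewrite -monotone_convergence//.
  - by apply: eq_integral => y _; apply/esym/cvg_lim => //; exact: cvgf.
  - by move=> n; exact/measurable_EFinP/measurable_funP.
  - by move=> n y _; rewrite lee_fin.
  - by move=> y _ m n mn; rewrite lee_fin; exact: ndf.
transitivity (limn (fun n => \int[mu]_x ((f_ n x)%:E * (rho x)%:E))); last first.
  rewrite -monotone_convergence//.
  - apply: eq_integral => y _; apply/cvg_lim => //.
    by apply: cvgeZr => //; exact: cvgf.
  - by move=> n; apply: emeasurable_funM; apply/measurable_EFinP.
  - by move=> n y _; rewrite mule_ge0// lee_fin.
  - by move=> y _ m n mn; rewrite lee_wpmul2r// lee_fin//; exact: ndf.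
congr (limn _); apply/funext => n.
transitivity (\sum_(k \in range (f_ n))
    \int[nu]_x (k * \1_(f_ n @^-1` [set k]) x)%:E).
  under eq_integral do rewrite fimfunE -fsumEFin//.
  rewrite ge0_integral_fsum//.
  - by move=> y; exact/measurable_EFinP/measurable_funM.
  - by move=> y x _; rewrite nnfun_muleindic_ge0.
transitivity (\sum_(k \in range (f_ n))
    \int[mu]_x ((k * \1_(f_ n @^-1` [set k]) x)%:E * (rho x)%:E)).
  apply: eq_fsbigr => k; rewrite inE => -[x _ kE].
  have k0 : (0 <= k)%R by rewrite -kE.
  have mk : measurable (f_ n @^-1` [set k]) by [].
  under eq_integral do rewrite EFinM.
  under [RHS]eq_integral do rewrite EFinM -muleA.
  rewrite !ge0_integralZl//.
  - congr (_ * _); rewrite integral_indic// setIT nuE// [LHS]integral_mkcond.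
    apply: eq_integral => y _; rewrite /patch indicE; case: ifPn => _ /=.
      by rewrite mul1e.
    by rewrite mul0e.
  - by apply: emeasurable_funM; apply/measurable_EFinP => //; exact: measurable_indic.
  - by move=> y _; rewrite mule_ge0// lee_fin.
  - by apply/measurable_EFinP; exact: measurable_indic.
rewrite -ge0_integral_fsum//.
- apply: eq_integral => x _; rewrite [in RHS]fimfunE -fsumEFin// -ge0_mule_fsuml//.
  by move=> k; rewrite EFinM; exact: nnfun_muleindic_ge0.
- move=> y; apply: emeasurable_funM; apply/measurable_EFinP => //.
  exact: measurable_funM.
- by move=> k x _; apply: mule_ge0; [rewrite EFinM; exact: nnfun_muleindic_ge0|rewrite lee_fin].
Qed.

Lemma integral_density (F : T -> \bar R) : measurable_fun setT F ->
  \int[nu]_x F x = \int[mu]_x (F x * (rho x)%:E).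
Proof.
move=> mF; rewrite integralE [RHS]integralE.
rewrite !ge0_integral_density//; [|exact: measurable_funeneg|exact: measurable_funepos].
congr (_ - _); apply: eq_integral => x _.
  rewrite !funeposE; have [F0|F0] := leP 0 (F x).
    by rewrite !max_l// mule_ge0// lee_fin.
  by rewrite !max_r ?mul0e// ?(ltW F0)// mule_le0_ge0 ?lee_fin// ltW.
rewrite !funenegE; have [F0|F0] := leP 0 (F x).
  by rewrite !max_r ?mul0e// oppe_le0 ?F0// mule_ge0// lee_fin.
by rewrite !max_l ?mulNe// oppe_ge0 ?(ltW F0)// mule_le0_ge0 ?lee_fin// ltW.
Qed.

End density.

Section law.
Context {R : realType} {n : nat}.
Local Notation V := 'rV[R]_n.
Variable gamma : probability V R.

Lemma law_transfer d (T : measurableType d) (mu : {measure set T -> \bar R})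
    (phi : T -> V) (mphi : measurable_fun setT phi) :
  (forall A : 'I_n -> set R, (forall i, measurable (A i)) ->
    mu (phi @^-1` [set v | forall i, A i (v ord0 i)]) =
    gamma [set v : V | forall i, A i (v ord0 i)]) ->
  forall A, measurable A -> mu (phi @^-1` A) = gamma A.
Proof.
move=> h A mA; apply/esym.
apply: (@boxes_unique R n gamma (pushforward mu phi)) => //.
  exact: le_lt_trans (probability_le1 gamma measurableT) (ltry _).
by move=> B mB; exact: esym (h B mB).
Qed.

End law.

Lemma integral_law d (T : measurableType d) d' (U : measurableType d') (R : realType)
    (mu : {measure set T -> \bar R}) (nu : {measure set U -> \bar R})
    (phi : T -> U) (mphi : measurable_fun setT phi) :
  (forall A, measurable A -> mu (phi @^-1` A) = nu A) ->
  forall F : U -> \bar R, measurable_fun setT F ->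
  (\int[mu]_x F (phi x) = \int[nu]_y F y)%E.
Proof.
move=> h.
have ge0 : forall F : U -> \bar R, measurable_fun setT F -> (forall y, 0 <= F y)%E ->
  (\int[mu]_x F (phi x) = \int[nu]_y F y)%E.
  move=> F mF F0.
  have := @ge0_integral_pushforward _ _ _ _ R phi mphi mu setT F measurableT mF (fun y _ => F0 y).
  rewrite preimage_setT => <-.
  by apply: eq_measure_integral => A mA _; rewrite -h.
move=> F mF; rewrite integralE [RHS]integralE -!ge0//.
- by congr (_ - _)%E; apply: eq_integral => x _; rewrite !(funeposE, funenegE).
- exact: measurable_funeneg.
- exact: measurable_funepos.
Qed.

Lemma if_measurable d (T : measurableType d) (b : bool) (A B : set T) :
  measurable A -> measurable B -> measurable (if b then A else B).
Proof. by case: b. Qed.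

(** * The Gaussian measure on row vectors *)

Section gaussian.
Context {R : realType} {n : nat}.
Local Notation V := 'rV[R]_n.
Local Notation N01 := (normal_prob (0:R) 1).

Definition mix (S : pred 'I_n) (y w : V) : V :=
  \row_j (if S j then y ord0 j else w ord0 j).

Definition upd (y : V) (i : 'I_n) (z : R) : V :=
  \row_j (if j == i then z else y ord0 j).

Lemma measurable_mix S : measurable_fun setT (fun p : V * V => mix S p.1 p.2).
Proof.
apply: measurable_row => i; case: (S i).
  exact: (measurableT_comp (measurable_coord i) measurable_fst).
exact: (measurableT_comp (measurable_coord i) measurable_snd).
Qed.

Lemma measurable_upd i : measurable_fun setT (fun p : V * R => upd p.1 i p.2).
Proof.
apply: measurable_row => j; case: (j == i); first exact: measurable_snd.
exact: (measurableT_comp (measurable_coord j) measurable_fst).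
Qed.

Variable gamma : probability V R.
Hypothesis hgamma : std_gaussian gamma.

(** Row vectors are not a product type, so integrating out some coordinates is expressed by
    resampling them from an independent copy. The preimage of a box is a product of two boxes, each
    with some sides equal to the whole line, and the product formula multiplies back to the original
    one. *)
Lemma gauss_mix S (F : V -> \bar R) : measurable_fun setT F ->
  (\int[gamma \x gamma]_p F (mix S p.1 p.2) = \int[gamma]_y F y)%E.
Proof.
move=> mF.
apply: (@integral_law _ _ _ _ R (gamma \x gamma)%E gamma (fun p => mix S p.1 p.2)) => //.
  exact: measurable_mix.
apply: law_transfer; first exact: measurable_mix.
move=> A mA.
have -> : (fun p : V * V => mix S p.1 p.2) @^-1` [set v : V | forall i, A i (v ord0 i)] =
  [set v : V | forall i, (if S i then A i else setT) (v ord0 i)] `*`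
  [set v : V | forall i, (if S i then setT else A i) (v ord0 i)].
  apply/seteqP; split => [[y w]|[y w]] /=.
    by move=> h; split => i; move: (h i); rewrite mxE; case: (S i).
  by move=> [h1 h2] i; move: (h1 i) (h2 i); rewrite mxE; case: (S i).
etransitivity.
  apply: product_measure1E.
    by apply: (@box_measurable _ _ (fun i => if S i then A i else setT)) => i; case: ifP.
  by apply: (@box_measurable _ _ (fun i => if S i then setT else A i)) => i; case: ifP.
have e1 := hgamma (A := fun i => if S i then A i else setT) (fun i => if_measurable _ (mA i) measurableT).
have e2 := hgamma (A := fun i => if S i then setT else A i) (fun i => if_measurable _ measurableT (mA i)).
etransitivity; first exact: (f_equal2 mule e1 e2).
rewrite hgamma//.
rewrite -big_split/=; apply: eq_bigr => i _.
by case: (S i); rewrite probability_setT ?mule1 ?mul1e.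
Qed.

Lemma gauss_upd i (F : V -> \bar R) : measurable_fun setT F ->
  (\int[gamma \x N01]_p F (upd p.1 i p.2) = \int[gamma]_y F y)%E.
Proof.
move=> mF.
apply: (@integral_law _ _ _ _ R (gamma \x N01)%E gamma (fun p => upd p.1 i p.2)) => //.
  exact: measurable_upd.
apply: law_transfer; first exact: measurable_upd.
move=> A mA.
have -> : (fun p : V * R => upd p.1 i p.2) @^-1` [set v : V | forall i, A i (v ord0 i)] =
  [set v : V | forall j, (if j == i then setT else A j) (v ord0 j)] `*` A i.
  apply/seteqP; split => [[y w]|[y w]] /=.
    move=> h; split; first by move=> j; move: (h j); rewrite mxE; case: (j == i).
    by have := h i; rewrite mxE eqxx.
  by move=> [h1 h2] j; move: (h1 j); rewrite mxE; case: eqP => // ->.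
etransitivity.
  apply: product_measure1E => //.
  by apply: (@box_measurable _ _ (fun j => if j == i then setT else A j)) => j; case: ifP.
  exact: mA.
have e1 := hgamma (A := fun j => if j == i then setT else A j) (fun j => if_measurable _ measurableT (mA j)).
etransitivity; first exact: (f_equal2 mule e1 erefl).
rewrite hgamma//.
rewrite (bigD1 i)//= eqxx probability_setT mul1e [in RHS](bigD1 i)//= muleC.
by congr (_ * _)%E; apply: eq_bigr => j /negbTE ->.
Qed.

Lemma gauss_coord i (F : R -> \bar R) : measurable_fun setT F ->
  (\int[gamma]_y F (y ord0 i) = \int[N01]_z F z)%E.
Proof.
move=> mF.
apply: (@integral_law _ _ _ _ R gamma N01 (fun y => y ord0 i)) => //.
  exact: measurable_coord.
move=> A mA.
have -> : (fun y : V => y ord0 i) @^-1` A =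
   [set v : V | forall j, (if j == i then A else setT) (v ord0 j)].
  apply/seteqP; split => y /=; first by move=> Ay j; case: eqP => // ->.
  by move=> /(_ i); rewrite eqxx.
etransitivity; first exact: (hgamma (A := fun j => if j == i then A else setT) (fun j => if_measurable _ mA measurableT)).
rewrite (bigD1 i)//= eqxx big1 ?mule1// => j /negbTE ->.
by rewrite probability_setT.
Qed.

Lemma ge0_gauss_mix S (F : V -> \bar R) : measurable_fun setT F ->
  (forall y, 0 <= F y)%E ->
  (\int[gamma]_y \int[gamma]_w F (mix S y w) = \int[gamma]_y F y)%E.
Proof.
move=> mF F0; rewrite -(gauss_mix S mF).
rewrite (@fubini_tonelli1 _ _ _ _ R gamma gamma (fun p => F (mix S p.1 p.2)))//.
exact: (measurableT_comp mF (measurable_mix S)).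
Qed.

Lemma ge0_gauss_upd i (F : V -> \bar R) : measurable_fun setT F ->
  (forall y, 0 <= F y)%E ->
  (\int[gamma]_y \int[N01]_z F (upd y i z) = \int[gamma]_y F y)%E.
Proof.
move=> mF F0; rewrite -(gauss_upd i mF).
rewrite (@fubini_tonelli1 _ _ _ _ R gamma N01 (fun p => F (upd p.1 i p.2)))//.
exact: (measurableT_comp mF (measurable_upd i)).
Qed.

End gaussian.

(** * The Gaussian density on the line and affine substitutions *)

Section gauss1.
Context {R : realType}.
Local Notation N01 := (normal_prob (0:R) 1).
Local Notation mu := (@lebesgue_measure R).
Local Notation phi := (normal_pdf (0:R) 1).

Lemma phiE z : phi z = phi 0 * expR (- (z ^+ 2 / 2)).
Proof.
rewrite !normal_pdfE ?oner_eq0// /normal_fun !subr0 expr0n oppr0 mul0r expR0 mulr1.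
by rewrite expr1n mulNr.
Qed.

Lemma phi_gt0 z : 0 < phi z.
Proof. by rewrite normal_pdfE ?oner_eq0// mulr_gt0 ?expR_gt0// normal_peak_gt0 ?oner_eq0. Qed.

Lemma integral_N01 (F : R -> \bar R) : measurable_fun setT F ->
  (\int[N01]_z F z = \int[mu]_z (F z * (phi z)%:E))%E.
Proof.
move=> mF; apply: (@integral_density _ _ R mu N01 phi) => //.
  exact: measurable_normal_pdf.
move=> z.
exact: normal_pdf_ge0.
Qed.

(** The image of Lebesgue measure under the affine map, multiplied by s, agrees with Lebesgue
    measure on half-open intervals, hence on all measurable sets. *)
Lemma lebesgue_affine (s b : R) (F : R -> \bar R) : 0 < s -> measurable_fun setT F ->
  (forall z, 0 <= F z)%E ->
  (\int[mu]_z F (s * z + b)%R = s^-1%:E * \int[mu]_z F z)%E.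
Proof.
move=> s0 mF F0.
have s0' : s != 0 by rewrite gt_eqF.
have maff : measurable_fun setT (fun z : measurableTypeR R => s * z + b : measurableTypeR R).
  by apply: measurable_funD => //; apply: measurable_funM.
have sE : (s = (NngNum (ltW s0))%:num)%R by [].
pose m2 := pushforward mu (fun z : measurableTypeR R => s * z + b : measurableTypeR R).
have mE : forall A, measurable A -> mscale (NngNum (ltW s0)) mu ((fun z => s * z + b) @^-1` A) = mu A.
  move=> A mA; apply/esym.
  apply: (@lebesgue_measure_unique R (mscale (NngNum (ltW s0)) (pushforward mu (fun z : measurableTypeR R => s * z + b : measurableTypeR R)))) => //.
  move=> _ [[a c] /= ac <-].
  rewrite /= /mscale /= /pushforward /= (_ : (fun z : R => s * z + b) @^-1` `]a, c] = `](a - b) / s, (c - b) / s]%classic); last first.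
    apply/seteqP; split => z /=; rewrite !in_itv /= ltr_pdivrMr// ler_pdivlMr// ltrBlDr lerBrDr (mulrC z)//.
  rewrite !lebesgue_measure_itv /= !lte_fin ltr_pM2r ?invr_gt0// ltrD2r.
  case: ifP => _; last by rewrite mule0.
  rewrite -!EFinB -EFinM; congr EFin.
  by field.
rewrite -(@integral_law _ _ _ _ R (mscale (NngNum (ltW s0)) mu) mu _ maff mE F mF).
rewrite ge0_integral_mscale//=; last first.
  exact: (measurableT_comp mF maff).
by rewrite muleA -EFinM mulVf// mul1e.
Qed.

End gauss1.

Section fubini_measurable.
Context d1 d2 (T1 : measurableType d1) (T2 : measurableType d2) (R : realType).

Lemma measurable_integral_snd (m2 : {sigma_finite_measure set T2 -> \bar R})
    (f : T1 * T2 -> \bar R) : measurable_fun setT f -> (forall p, 0 <= f p)%E ->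
  measurable_fun setT (fun x => \int[m2]_y f (x, y))%E.
Proof. by move=> mf f0; exact: measurable_fun_fubini_tonelli_F. Qed.

Lemma measurable_integral_fst (m1 : {sigma_finite_measure set T1 -> \bar R})
    (f : T1 * T2 -> \bar R) : measurable_fun setT f -> (forall p, 0 <= f p)%E ->
  measurable_fun setT (fun y => \int[m1]_x f (x, y))%E.
Proof. by move=> mf f0; exact: measurable_fun_fubini_tonelli_G. Qed.

End fubini_measurable.

(** * The Euclidean scalar product *)

Section dot.
Context {R : realType} {n : nat}.
Local Notation V := 'rV[R]_n.
Implicit Types x y z : V.

Lemma dotvC x y : dotv x y = dotv y x.
Proof. by apply: eq_bigr => i _; rewrite mulrC. Qed.

Lemma dotvDl x y z : dotv (x + y) z = dotv x z + dotv y z.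
Proof. by rewrite -big_split/=; apply: eq_bigr => i _; rewrite mxE mulrDl. Qed.

Lemma dotvDr x y z : dotv x (y + z) = dotv x y + dotv x z.
Proof. by rewrite dotvC dotvDl !(dotvC x). Qed.

Lemma dotvZl (a : R) x z : dotv (a *: x) z = a * dotv x z.
Proof. by rewrite mulr_sumr; apply: eq_bigr => i _; rewrite mxE mulrA. Qed.

Lemma dotvZr (a : R) x z : dotv x (a *: z) = a * dotv x z.
Proof. by rewrite dotvC dotvZl dotvC. Qed.

Lemma dotvNl x z : dotv (- x) z = - dotv x z.
Proof. by rewrite -scaleN1r dotvZl mulN1r. Qed.

Lemma dotvNr x z : dotv x (- z) = - dotv x z.
Proof. by rewrite dotvC dotvNl dotvC. Qed.

Lemma dotv0l z : dotv (0 : V) z = 0.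
Proof. by rewrite -(scale0r (0 : V)) dotvZl mul0r. Qed.

Lemma dotvv_ge0 x : 0 <= dotv x x.
Proof. by apply: sumr_ge0 => i _; rewrite -expr2 sqr_ge0. Qed.

Definition dotvE := (dotvDl, dotvDr, dotvNl, dotvNr, dotvZl, dotvZr).

(** [|x|] is the largest absolute value of a coordinate, hence the factor n where the Cauchy-Schwarz
    inequality has none. This norm serves growth and continuity estimates; the Euclidean geometry is
    carried by [dotv]. *)
Lemma normv_sum x y : `|dotv x y| <= n%:R * (`|x| * `|y|).
Proof.
apply: le_trans (ler_norm_sum _ _ _) _.
apply: (@le_trans _ _ (\sum_(i < n) `|x| * `|y|)).
  by apply: ler_sum => i _; rewrite normrM ler_pM// coord_le_normv.
by rewrite sumr_const card_ord -[leLHS]mulr_natl.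
Qed.

Lemma measurable_dotv d (T : measurableType d) (g h : T -> V) :
  measurable_fun setT g -> measurable_fun setT h ->
  measurable_fun setT (fun t => dotv (g t) (h t)).
Proof.
move=> mg mh; apply: measurable_sum => i.
by apply: measurable_funM; [exact: (measurable_rowP g).1|exact: (measurable_rowP h).1].
Qed.

Lemma measurable_scaleD d (T : measurableType d) (a : R) (g h : T -> V) :
  measurable_fun setT g -> measurable_fun setT h ->
  measurable_fun setT (fun t => a *: g t + h t).
Proof.
move=> mg mh; apply/measurable_rowP => i.
rewrite (_ : (fun t => _) = (fun t => a * g t ord0 i + h t ord0 i)); last first.
  by apply/funext => t; rewrite !mxE.
apply: measurable_funD; last exact: (measurable_rowP h).1.
by apply: measurable_funM => //; exact: (measurable_rowP g).1.
Qed.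

Lemma measurable_idV : measurable_fun setT (id : V -> V). Proof. exact: measurable_id. Qed.

Lemma measurable_normv : measurable_fun setT (fun y : V => `|y|).
Proof. by apply: continuous_measurable_rV => y; exact: norm_continuous. Qed.

End dot.

(** * Changes of variables under the Gaussian measure *)

Section weights.
Context {R : realType} {n : nat}.
Local Notation V := 'rV[R]_n.
Local Notation N01 := (normal_prob (0:R) 1).
Local Notation mu := (@lebesgue_measure R).
Local Notation phi := (normal_pdf (0:R) 1).

(** The reciprocal of the Gaussian density, up to a constant: [wt] times [gamma] is a multiple of
    Lebesgue measure on row vectors and takes its place throughout. *)
Definition wt (y : V) : R := expR (dotv y y / 2).

Lemma measurable_wt : measurable_fun setT wt.
Proof.
apply: measurableT_comp => //; apply: measurable_funM => //.
by apply: measurable_dotv; exact: measurable_id.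
Qed.

Lemma wt_gt0 y : 0 < wt y. Proof. exact: expR_gt0. Qed.

Lemma wt_upd y i z : wt (upd y i z) = expR ((\sum_(j | j != i) y ord0 j ^+ 2) / 2) * expR (z ^+ 2 / 2).
Proof.
rewrite /wt -expRD -mulrDl; congr (expR (_ / 2)).
rewrite /dotv (bigD1 i)//= !mxE eqxx addrC -expr2; congr (_ + _).
by apply: eq_bigr => j /negbTE ji; rewrite !mxE ji expr2.
Qed.

Lemma integral_N01_wt (G : R -> \bar R) : measurable_fun setT G ->
  (forall z, 0 <= G z)%E ->
  (\int[N01]_z (G z * (expR (z ^+ 2 / 2))%:E) = (phi 0)%:E * \int[mu]_z G z)%E.
Proof.
move=> mG G0; rewrite integral_N01; last first.
  apply: emeasurable_funM => //; apply/measurable_EFinP; apply: measurableT_comp => //.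
  by apply: measurable_funM => //; exact: measurable_funX.
rewrite -ge0_integralZl//; last by rewrite lee_fin ltW// phi_gt0.
apply: eq_integral => z _; rewrite phiE -muleA -EFinM muleC; congr (EFin _ * _)%E.
by rewrite mulrCA -expRD subrr expR0 mulr1.
Qed.

Variable gamma : probability V R.
Hypothesis hgamma : std_gaussian gamma.

(** Affine on the first k coordinates and the identity on the others, so that variables are changed
    one at a time. *)
Let aff (s : R) (v : V) k (y : V) : V :=
  \row_(j < n) (if (j < k)%N then s * y ord0 j + v ord0 j else y ord0 j).

Let measurable_aff s v k : measurable_fun setT (aff s v k).
Proof.
apply: measurable_row => j; case: (j < k)%N; last exact: measurable_coord.
by apply: measurable_funD => //; apply: measurable_funM => //; exact: measurable_coord.
Qed.

(** This is the scaling and translation rule of Lebesgue measure, read through [wt]. Each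
    coordinate, once isolated by [ge0_gauss_upd], contributes a factor s^-1 by [lebesgue_affine]. *)
Lemma gauss_affine (s : R) (v : V) (F : V -> \bar R) : 0 < s ->
  measurable_fun setT F -> (forall y, 0 <= F y)%E ->
  (\int[gamma]_y (F (s *: y + v)%R * (wt y)%:E) =
    (s ^- n)%:E * \int[gamma]_y (F y * (wt y)%:E))%E.
Proof.
move=> s0 mF F0.
have mwt : measurable_fun setT (fun y : V => (wt y)%:E) by apply/measurable_EFinP; exact: measurable_wt.
suff H k : (k <= n)%N -> (\int[gamma]_y (F (aff s v k y) * (wt y)%:E) =
    (s ^- k)%:E * \int[gamma]_y (F y * (wt y)%:E))%E.
  rewrite -H//; apply: eq_integral => y _; congr (F _ * _)%E.
  by apply/rowP => j; rewrite !mxE ltn_ord.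
elim: k => [_|k IH kn].
  rewrite expr0 invr1 mul1e; apply: eq_integral => y _; congr (F _ * _)%E.
  by apply/rowP => j; rewrite !mxE.
pose i := Ordinal kn.
have mk m : measurable_fun setT (fun y => F (aff s v m y) * (wt y)%:E)%E.
  by apply: emeasurable_funM => //; exact: (measurableT_comp mF (measurable_aff s v m)).
have gk m y : (0 <= F (aff s v m y) * (wt y)%:E)%E by rewrite mule_ge0// lee_fin ltW// wt_gt0.
rewrite -(ge0_gauss_upd hgamma i (mk k.+1)) ?gk//.
transitivity ((s^-1)%:E * \int[gamma]_y (F (aff s v k y) * (wt y)%:E))%E; last first.
  by rewrite IH ?(ltnW kn)// muleA -EFinM exprS invfM.
rewrite -[in RHS](ge0_gauss_upd hgamma i (mk k)) ?gk//.
rewrite -ge0_integralZl//; last 3 first.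
- apply: (@measurable_integral_snd _ _ _ _ R N01 (fun p : V * R => F (aff s v k (upd p.1 i p.2)) * (wt (upd p.1 i p.2))%:E)%E) => //.
  exact: (measurableT_comp (mk k) (measurable_upd i)).
- by move=> y _; apply: integral_ge0 => z _; rewrite gk.
- by rewrite lee_fin invr_ge0 ltW.
apply: eq_integral => y _.
pose c := (expR ((\sum_(j | j != i) y ord0 j ^+ 2) / 2)).
have c0 : 0 <= c by exact: expR_ge0.
pose G t := (F (upd (aff s v k y) i t) * c%:E)%E.
have mG : measurable_fun setT G.
  apply: emeasurable_funM => //; apply: (measurableT_comp mF) => /=.
  exact: (measurableT_comp (measurable_upd i) (measurable_fun_pair (measurable_cst _) (@measurable_id _ _ setT))).
have G0 t : (0 <= G t)%E by rewrite mule_ge0.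
transitivity (\int[N01]_z (G (s * z + v ord0 i)%R * (expR (z ^+ 2 / 2))%:E))%E.
  apply: eq_integral => z _; rewrite wt_upd EFinM /G muleA; congr (F _ * _ * _)%E.
  apply/rowP => j; rewrite !mxE; case: eqP => [->|/eqP ji]; first by rewrite /= ltnSn.
  rewrite ltnS leq_eqVlt (_ : (j == k :> nat) = false)//=.
  by apply/negbTE; apply: contra ji => /eqP jk; apply/eqP/val_inj.
rewrite integral_N01_wt//; last first.
  by apply: (measurableT_comp mG) => /=; apply: measurable_funD.
rewrite lebesgue_affine// muleCA; congr (_ * _)%E.
rewrite -integral_N01_wt//.
apply: eq_integral => z _; rewrite wt_upd EFinM /G muleA; congr (F _ * _ * _)%E.
apply/rowP => j; rewrite !mxE; case: eqP => [->|//]; first by rewrite /= ltnn.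
Qed.

(** For fixed x, the substitution z = a x + b y produces a Gaussian kernel in z centred at a x.
    After the integrals are exchanged, a^2 + b^2 = 1 turns it into a kernel in x of the same width
    centred at a z, by the symmetry of the joint law of (x, z); its total mass cancels the Jacobian
    b^-n. *)
Lemma gauss_rotation (a b : R) (F : V -> \bar R) : 0 < b -> a ^+ 2 + b ^+ 2 = 1 ->
  measurable_fun setT F -> (forall y, 0 <= F y)%E ->
  (\int[gamma]_x \int[gamma]_y F (a *: x + b *: y)%R = \int[gamma]_y F y)%E.
Proof.
move=> b0 ab mF F0.
have bn : (0 <= b ^- n) by rewrite invr_ge0 exprn_ge0// ltW.
have b1 : b != 0 by rewrite gt_eqF.
pose K (x z : V) : R := expR (- (dotv (z - a *: x) (z - a *: x) / (2 * b ^+ 2))).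
have mK : measurable_fun setT (fun p : V * V => K p.1 p.2).
  apply: measurableT_comp => //; apply: measurableT_comp => //; apply: measurable_funM => //.
  have mm : measurable_fun setT (fun p : V * V => p.2 - a *: p.1).
    rewrite (_ : (fun p => _) = (fun p : V * V => (- a) *: p.1 + p.2)).
      apply: measurable_scaleD; [exact: measurable_fst|exact: measurable_snd].
    by apply/funext => p; rewrite scaleNr addrC.
  exact: measurable_dotv.
have K0 x z : 0 <= K x z by exact: expR_ge0.
have mwt : measurable_fun setT (fun y : V => (wt y)%:E) by apply/measurable_EFinP; exact: measurable_wt.
have mKx x : measurable_fun setT (fun z => (K x z)%:E).
  by apply/measurable_EFinP; exact: (measurableT_comp mK (measurable_fun_pair (measurable_cst x) (@measurable_id _ _ setT))).
have mKz z : measurable_fun setT (fun x => (K x z)%:E).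
  by apply/measurable_EFinP; exact: (measurableT_comp mK (measurable_fun_pair (@measurable_id _ _ setT) (measurable_cst z))).
transitivity (\int[gamma]_x ((b ^- n)%:E * \int[gamma]_z (F z * (K x z)%:E * (wt z)%:E)))%E.
  apply: eq_integral => x _.
  rewrite -(gauss_affine (a *: x) b0 (F := fun z => F z * (K x z)%:E)%E); last 2 first.
  - exact: emeasurable_funM.
  - by move=> z; rewrite mule_ge0// lee_fin.
  apply: eq_integral => y _; rewrite -muleA -EFinM addrC.
  rewrite /K /wt addrK !dotvE -expRD [X in expR X](_ : _ = 0) ?expR0 ?mule1//.
  by field.
have mJ : measurable_fun setT (fun p : V * V => (F p.2 * (K p.1 p.2)%:E * (wt p.2)%:E)%E).
  apply: emeasurable_funM; last exact: (measurableT_comp mwt measurable_snd).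
  apply: emeasurable_funM; first exact: (measurableT_comp mF measurable_snd).
  exact/measurable_EFinP.
have J0 (p : V * V) : (0 <= F p.2 * (K p.1 p.2)%:E * (wt p.2)%:E)%E.
  by rewrite !mule_ge0// lee_fin// ltW// wt_gt0.
rewrite ge0_integralZl//; last 2 first.
- exact: (measurable_integral_snd gamma mJ J0).
- by move=> x _; apply: integral_ge0 => z _; exact: (J0 (x, z)).
rewrite (@fubini_tonelli _ _ _ _ R gamma gamma _ mJ J0) /=.
rewrite -ge0_integralZl//; last 2 first.
- exact: (measurable_integral_fst gamma mJ J0).
- by move=> x _; apply: integral_ge0 => z _; exact: (J0 (z, x)).
apply: eq_integral => z _.
under eq_integral do rewrite -muleA.
pose G x : R := expR (- (dotv (x - a *: z) (x - a *: z) / (2 * b ^+ 2))).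
have mG : measurable_fun setT (fun x => (G x)%:E).
  apply/measurable_EFinP; apply: measurableT_comp => //; apply: measurableT_comp => //; apply: measurable_funM => //.
  have mm : measurable_fun setT (fun x : V => x - a *: z).
    rewrite (_ : (fun p => _) = (fun p : V => 1 *: p + (- a) *: z)).
      apply: measurable_scaleD; [exact: measurable_id|exact: measurable_cst].
    by apply/funext => p; rewrite scale1r scaleNr.
  exact: measurable_dotv.
have G1 : (\int[gamma]_x ((G x)%:E * (wt x)%:E) = (b ^+ n)%:E)%E.
  have := gauss_affine (a *: z) b0 mG (fun x => expR_ge0 _).
  have -> : (\int[gamma]_y ((G (b *: y + a *: z))%:E * (wt y)%:E) = 1)%E.
    rewrite -(probability_setT gamma) -[RHS]mul1e -integral_cst//.
    apply: eq_integral => y _; rewrite -EFinM /G /wt addrK !dotvE -expRD [X in expR X](_ : _ = 0) ?expR0//.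
    by field.
  move=> h; have := f_equal (fun e => (b ^+ n)%:E * e)%E h.
  by rewrite /= mule1 muleA -EFinM divff ?mul1e// expf_neq0.
transitivity ((b ^- n)%:E * (F z * \int[gamma]_x ((G x)%:E * (wt x)%:E)))%E; last first.
  by rewrite G1 muleCA -EFinM mulVf ?mule1// expf_neq0// gt_eqF.
congr (_ * _)%E; etransitivity; last first.
  apply: ge0_integralZl => //; first exact: emeasurable_funM.
  by move=> x _; rewrite mule_ge0// lee_fin ?expR_ge0// ltW// wt_gt0.
apply: eq_integral => x _; congr (_ * _)%E; rewrite -!EFinM; congr EFin.
rewrite /K /G /wt -!expRD; congr expR; rewrite !dotvE (dotvC z x).
set zz := dotv z z; set xx := dotv x x; set xz := dotv x z.
apply/eqP; rewrite -subr_eq0.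
rewrite (_ : _ - _ = (zz - xx) * (b ^+ 2 + a ^+ 2 - 1) / (2 * b ^+ 2)); last by field.
by rewrite (addrC (b ^+ 2)) ab subrr mulr0 mul0r.
Qed.

End weights.

(** * Functions of at most exponential growth *)

Section tame.
Context d (T : measurableType d) (R : realType).
Variable h : T -> R.
Implicit Types F G : T -> R.

(** Growth is measured by a gauge h, so that one calculus serves the line, row vectors and products
    of these. The class is closed under products, and its members are integrable as soon as all
    exponential moments of h are finite. *)
Definition tame F := measurable_fun setT F /\
  exists C a, [/\ 0 <= C, 0 <= a & forall x, `|F x| <= C * expR (a * h x)].

Lemma tame_measurable F : tame F -> measurable_fun setT F.
Proof. by case. Qed.

Hypothesis mh : measurable_fun setT h.
Hypothesis h0 : forall x, 0 <= h x.

Lemma tame_bound F G : measurable_fun setT F -> tame G ->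
  (forall x, `|F x| <= `|G x|) -> tame F.
Proof.
move=> mF [_ [C [a [C0 a0 hG]]]] FG; split => //; exists C, a; split => // x.
exact: le_trans (FG x) (hG x).
Qed.

Lemma tame_cst (c : R) : tame (fun=> c).
Proof.
split; first exact: measurable_cst.
by exists `|c|, 0; split => // x; rewrite mul0r expR0 mulr1.
Qed.

Lemma tameD F G : tame F -> tame G -> tame (fun x => F x + G x).
Proof.
move=> [mF [C [a [C0 a0 hF]]]] [mG [C' [a' [C0' a0' hG]]]].
split; first exact: measurable_funD.
exists (C + C'), (a + a'); split; [exact: addr_ge0|exact: addr_ge0|move=> x].
apply: le_trans (ler_normD _ _) _; rewrite mulrDl; apply: lerD.
  apply: le_trans (hF x) _; apply: ler_wpM2l => //.
  by rewrite ler_expR ler_wpM2r// lerDl.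
apply: le_trans (hG x) _; apply: ler_wpM2l => //.
by rewrite ler_expR ler_wpM2r// lerDr.
Qed.

Lemma tameM F G : tame F -> tame G -> tame (fun x => F x * G x).
Proof.
move=> [mF [C [a [C0 a0 hF]]]] [mG [C' [a' [C0' a0' hG]]]].
split; first exact: measurable_funM.
exists (C * C'), (a + a'); split; [exact: mulr_ge0|exact: addr_ge0|move=> x].
by rewrite normrM mulrDl expRD mulrACA; apply: ler_pM.
Qed.

Lemma tameN F : tame F -> tame (fun x => - F x).
Proof.
move=> [mF [C [a [C0 a0 hF]]]]; split; first exact: measurableT_comp.
by exists C, a; split => // x; rewrite normrN.
Qed.

Lemma tameB F G : tame F -> tame G -> tame (fun x => F x - G x).
Proof. by move=> hF hG; apply: tameD => //; exact: tameN. Qed.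

Lemma tameX F k : tame F -> tame (fun x => F x ^+ k).
Proof.
move=> hF; elim: k => [|k IH]; first by under eq_fun do rewrite expr0; exact: tame_cst.
by under eq_fun do rewrite exprS; exact: tameM.
Qed.

Lemma tame_norm F : tame F -> tame (fun x => `|F x|).
Proof.
move=> tF; apply: (@tame_bound _ F) => //; last by move=> x; rewrite normr_id.
by apply: measurableT_comp => //; exact: tame_measurable.
Qed.

Lemma tame_sum (I : Type) (r : seq I) (P : pred I) (F : I -> T -> R) :
  (forall i, tame (F i)) -> tame (fun x => \sum_(i <- r | P i) F i x).
Proof.
move=> hF; elim: r => [|i r IH].
  by under eq_fun do rewrite big_nil; exact: tame_cst.
under eq_fun do rewrite big_cons.
by case: (P i) => //; exact: tameD.
Qed.

Lemma tame_expR F A B : measurable_fun setT F -> 0 <= B -> (forall x, F x <= A + B * h x) ->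
  tame (fun x => expR (F x)).
Proof.
move=> mF B0 FA; split; first exact: measurableT_comp.
exists (expR A), B; split => //.
by move=> x; rewrite ger0_norm ?expR_ge0// -expRD ler_expR.
Qed.

Lemma tame_id F : measurable_fun setT F -> (forall x, `|F x| <= h x) -> tame F.
Proof.
move=> mF Fh; split => //; exists 1, 1; split => // x.
rewrite !mul1r; apply: le_trans (Fh x) _.
by apply: le_trans (expR_ge1Dx _); rewrite lerDr.
Qed.

Variable mu : {measure set T -> \bar R}.
Hypothesis hexp : forall a, (\int[mu]_x (expR (a * h x))%:E < +oo)%E.

Lemma tame_integrable F : tame F -> mu.-integrable setT (EFin \o F).
Proof.
move=> [mF [C [a [C0 a0 hF]]]].
have iG : mu.-integrable setT (EFin \o (fun x => C * expR (a * h x))).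
  rewrite (_ : _ \o _ = (fun x => C%:E * (expR (a * h x))%:E)%E); last first.
    by apply/funext => x /=; rewrite EFinM.
  apply: integrableZl => //; apply/integrableP; split.
    by apply/measurable_EFinP; apply: measurableT_comp => //; exact: measurable_funM.
  by under eq_integral do rewrite gee0_abs ?lee_fin ?expR_ge0//; exact: hexp.
apply: le_integrable iG => //; first exact/measurable_EFinP.
move=> x _ /=; rewrite lee_fin; apply: le_trans (hF x) _; exact: ler_norm.
Qed.

Lemma tame_fin F : tame F -> (\int[mu]_x (F x)%:E)%E = (\int[mu]_x F x)%:E.
Proof.
by move=> tF; rewrite fineK//; apply: integrable_fin_num => //; exact: tame_integrable.
Qed.

Lemma tame_intD F G : tame F -> tame G ->
  \int[mu]_x (F x + G x) = \int[mu]_x F x + \int[mu]_x G x.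
Proof. by move=> tF tG; rewrite RintegralD//; exact: tame_integrable. Qed.

Lemma tame_intB F G : tame F -> tame G ->
  \int[mu]_x (F x - G x) = \int[mu]_x F x - \int[mu]_x G x.
Proof. by move=> tF tG; rewrite RintegralB//; exact: tame_integrable. Qed.

Lemma tame_intZl (c : R) F : tame F -> \int[mu]_x (c * F x) = c * \int[mu]_x F x.
Proof. by move=> tF; rewrite RintegralZl//; exact: tame_integrable. Qed.

Lemma tame_intZr (c : R) F : tame F -> \int[mu]_x (F x * c) = (\int[mu]_x F x) * c.
Proof. by move=> tF; rewrite RintegralZr//; exact: tame_integrable. Qed.

Lemma tame_int_le F G : tame F -> tame G -> (forall x, F x <= G x) ->
  \int[mu]_x F x <= \int[mu]_x G x.
Proof. by move=> tF tG FG; apply: le_Rintegral => //; exact: tame_integrable. Qed.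

Lemma tame_int_sum (I : Type) (r : seq I) (P : pred I) (F : I -> T -> R) :
  (forall i, tame (F i)) ->
  \int[mu]_x (\sum_(i <- r | P i) F i x) = \sum_(i <- r | P i) \int[mu]_x F i x.
Proof.
move=> hF; elim: r => [|i r IH].
  rewrite big_nil; under eq_Rintegral do rewrite big_nil.
  by rewrite Rintegral_cst// mul0r.
rewrite big_cons; under eq_Rintegral do rewrite big_cons.
by case: (P i) => //; rewrite tame_intD// ?IH//; exact: tame_sum.
Qed.

Lemma tame_int_norm F : tame F -> `|\int[mu]_x F x| <= \int[mu]_x `|F x|.
Proof. by move=> tF; apply: le_normr_Rintegral => //; exact: tame_integrable. Qed.

End tame.

Lemma tame_comp d1 d2 (T1 : measurableType d1) (T2 : measurableType d2) (R : realType)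
    (h1 : T1 -> R) (h2 : T2 -> R) (F : T2 -> R) (phi : T1 -> T2) A B :
  tame h2 F -> measurable_fun setT phi -> (forall x, 0 <= h1 x) -> 0 <= B ->
  (forall x, h2 (phi x) <= A + B * h1 x) -> tame h1 (fun x => F (phi x)).
Proof.
move=> [mF [C [a [C0 a0 hF]]]] mphi h10 B0 hphi; split.
  exact: measurableT_comp mF mphi.
exists (C * expR (a * A)), (a * B); split; [|exact: mulr_ge0|].
  by rewrite mulr_ge0// expR_ge0.
move=> x; apply: le_trans (hF _) _; rewrite -mulrA -expRD; apply: ler_wpM2l => //.
by rewrite ler_expR -mulrA -mulrDr; exact: ler_wpM2l.
Qed.

(** * Fubini's theorem under exponential growth *)

Section tame_fubini.
Context d1 d2 (T1 : measurableType d1) (T2 : measurableType d2) (R : realType).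
Variables (h1 : T1 -> R) (h2 : T2 -> R).
Hypotheses (mh1 : measurable_fun setT h1) (mh2 : measurable_fun setT h2).
Hypotheses (h10 : forall x, 0 <= h1 x) (h20 : forall x, 0 <= h2 x).
Variables (P1 : probability T1 R) (P2 : probability T2 R).
Hypothesis hexp1 : forall a, (\int[P1]_x (expR (a * h1 x))%:E < +oo)%E.
Hypothesis hexp2 : forall a, (\int[P2]_x (expR (a * h2 x))%:E < +oo)%E.

Definition sumh (p : T1 * T2) : R := h1 p.1 + h2 p.2.

Lemma measurable_sumh : measurable_fun setT sumh.
Proof.
apply: measurable_funD.
  exact: (measurableT_comp mh1 measurable_fst).
exact: (measurableT_comp mh2 measurable_snd).
Qed.

Lemma sumh_ge0 p : 0 <= sumh p. Proof. exact: addr_ge0. Qed.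

Lemma sumh_exp a : (\int[(P1 \x P2)%E]_p (expR (a * sumh p))%:E < +oo)%E.
Proof.
have m1 : measurable_fun setT (fun x => (expR (a * h1 x))%:E).
  by apply/measurable_EFinP; apply: measurableT_comp => //; exact: measurable_funM.
have m2 : measurable_fun setT (fun x => (expR (a * h2 x))%:E).
  by apply/measurable_EFinP; apply: measurableT_comp => //; exact: measurable_funM.
rewrite fubini_tonelli1//=; last first.
  apply/measurable_EFinP; apply: measurableT_comp => //; apply: measurable_funM => //.
  exact: measurable_sumh.
rewrite /fubini_F /sumh /=.
under eq_integral => x _.
  under eq_integral do rewrite mulrDr expRD EFinM.
  rewrite ge0_integralZl//.
  over.
rewrite /= ge0_integralZr//.
  by rewrite lte_mul_pinfty// ?ge0_fin_numE//; apply: integral_ge0.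
by apply: integral_ge0.
Qed.

Variable F : T1 * T2 -> R.
Hypothesis tF : tame sumh F.

Let iF : (P1 \x P2)%E.-integrable setT (EFin \o F).
Proof. apply: tame_integrable tF; [exact: measurable_sumh|exact: sumh_exp]. Qed.

Lemma tame_section x : tame h2 (fun y => F (x, y)).
Proof.
apply: (tame_comp (A := h1 x) (B := 1) tF) => //.
by move=> y; rewrite mul1r.
Qed.

Lemma tame_section2 y : tame h1 (fun x => F (x, y)).
Proof.
apply: (tame_comp (A := h2 y) (B := 1) tF) => //.
by move=> x; rewrite mul1r /sumh addrC.
Qed.

Let mE : measurable_fun setT (EFin \o F).
Proof. by apply/measurable_EFinP; case: tF. Qed.

Lemma tame_fubini_F : tame h1 (fun x => \int[P2]_y F (x, y)).
Proof.
split.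
  apply: measurableT_comp => //.
  rewrite (_ : (fun x => _) = (fun x => \int[P2]_y (EFin \o F)^\+ (x, y) - \int[P2]_y (EFin \o F)^\- (x, y))%E).
    apply: emeasurable_funB; apply: measurable_integral_snd => //.
      exact: measurable_funepos.
    exact: measurable_funeneg.
  apply/funext => x; rewrite integralE; congr (_ - _)%E; apply: eq_integral => y _.
    by rewrite !funeposE.
  by rewrite !funenegE.
have [_ [C [a [C0 a0 hF]]]] := tF.
have tg : tame h2 (fun y => expR (a * h2 y)).
  by apply: (tame_expR (A := 0) (B := a)) => // [|x]; [exact: measurable_funM|rewrite add0r].
exists (C * \int[P2]_y expR (a * h2 y)), a; split => //.
  by rewrite mulr_ge0// Rintegral_ge0// => y _; exact: expR_ge0.
move=> x; have ts := tame_section x.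
apply: le_trans (tame_int_norm mh2 hexp2 ts) _.
rewrite mulrAC -(tame_intZl mh2 hexp2 _ tg).
apply: (tame_int_le mh2 hexp2).
- exact: tame_norm.
- by apply: tameM => //; exact: tame_cst.
- by move=> y; apply: le_trans (hF _) _; rewrite /sumh /= mulrDr expRD mulrA.
Qed.

Lemma tame_int_prod : \int[(P1 \x P2)%E]_p F p = \int[P1]_x \int[P2]_y F (x, y).
Proof.
rewrite /Rintegral -(integral12_prod_meas1 iF); congr fine.
apply: eq_integral => x _; rewrite /fubini_F /= fineK//.
apply: integrable_fin_num => //; apply: (tame_integrable mh2 hexp2).
exact: tame_section.
Qed.

Lemma tame_int_prod2 : \int[(P1 \x P2)%E]_p F p = \int[P2]_y \int[P1]_x F (x, y).
Proof.
rewrite /Rintegral -(integral21_prod_meas1 iF); congr fine.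
apply: eq_integral => y _; rewrite /fubini_G /= fineK//.
apply: integrable_fin_num => //; apply: (tame_integrable mh1 hexp1).
exact: tame_section2.
Qed.

End tame_fubini.

(** * Exponential moments of the Gaussian measure *)

Section gaussian_tame.
Context {R : realType} {n : nat}.
Local Notation V := 'rV[R]_n.
Local Notation N01 := (normal_prob (0:R) 1).
Local Notation mu := (@lebesgue_measure R).
Local Notation phi := (normal_pdf (0:R) 1).

Lemma gauss1_mgf (a : R) : (\int[N01]_z (expR (a * z))%:E = (expR (a ^+ 2 / 2))%:E)%E.
Proof.
have me : measurable_fun setT (fun z : R => (expR (a * z))%:E).
  by apply/measurable_EFinP; apply: measurableT_comp => //; exact: measurable_funM.
have mphi := @measurable_normal_pdf R 0 1.
rewrite integral_N01//.
(* Completing the square: a z - z^2/2 = a^2/2 - (z - a)^2/2. *)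
transitivity (\int[mu]_z ((expR (a ^+ 2 / 2))%:E * (phi (1 * z + - a))%:E))%E.
  apply: eq_integral => z _; rewrite -!EFinM; congr EFin.
  rewrite phiE (phiE (1 * z + _)) !(mulrCA _ (phi 0)) -!expRD; congr (_ * expR _).
  by field.
rewrite ge0_integralZl//; last 2 first.
- apply/measurable_EFinP; apply: (measurableT_comp mphi) => //; exact: measurable_funD.
- by move=> z _; rewrite lee_fin normal_pdf_ge0.
rewrite (@lebesgue_affine R 1 (- a) (fun z => (phi z)%:E))//; last 2 first.
- exact/measurable_EFinP.
- by move=> z; rewrite lee_fin normal_pdf_ge0.
by rewrite integral_normal_pdf invr1 !mule1.
Qed.

Lemma gauss1_exp (a : R) : (\int[N01]_z (expR (a * `|z|))%:E < +oo)%E.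
Proof.
have me (b : R) : measurable_fun setT (fun z : R => (expR (b * z))%:E).
  by apply/measurable_EFinP; apply: measurableT_comp => //; exact: measurable_funM.
apply: (@le_lt_trans _ _ (\int[N01]_z ((expR (a * z))%:E + (expR (- a * z))%:E))%E).
  apply: ge0_le_integral => //.
  - apply/measurable_EFinP; apply: measurableT_comp => //; exact: measurable_funM.
  - by apply: emeasurable_funD; exact: me.
  - move=> z _; rewrite -EFinD lee_fin; have [z0|z0] := leP 0 z.
      by rewrite ger0_norm// lerDl expR_ge0.
    by rewrite ltr0_norm// mulrN -mulNr lerDr expR_ge0.
rewrite ge0_integralD//; last 2 first.
- exact: me.
- exact: me.
by rewrite !gauss1_mgf -EFinD ltry.
Qed.

Variable gamma : probability V R.
Hypothesis hgamma : std_gaussian gamma.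

Lemma gauss_exp (a : R) : (\int[gamma]_y (expR (a * `|y|))%:E < +oo)%E.
Proof.
(* The norm is attained at some coordinate, whose summand dominates the integrand; the 1 covers the
   zero vector, in particular dimension 0. *)
pose G (y : V) := (1 + \sum_(i < n) (expR (`|a| * `|y ord0 i|))%:E)%E.
have mi i : measurable_fun setT (fun y : V => (expR (`|a| * `|y ord0 i|))%:E).
  apply/measurable_EFinP; apply: measurableT_comp => //; apply: measurable_funM => //.
  by apply: measurableT_comp => //; exact: measurable_coord.
apply: (@le_lt_trans _ _ (\int[gamma]_y G y)%E).
  apply: ge0_le_integral => //.
  - apply/measurable_EFinP; apply: measurableT_comp => //; apply: measurable_funM => //.
    exact: measurable_normv.
  - by apply: emeasurable_funD => //; apply: emeasurable_sum => i.
  - move=> y _; rewrite /G.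
    have Ga : (expR (a * `|y|) <= expR (`|a| * `|y|))%R.
      by rewrite ler_expR ler_wpM2r// ler_norm.
    have [y0|y0] := eqVneq (mx_norm y) 0.
      apply: (@le_trans _ _ 1%E).
        by rewrite lee_fin (_ : `|y| = 0)// mulr0 expR0.
      by rewrite leeDl// sume_ge0// => i _; rewrite lee_fin expR_ge0.
    have [[i0 i] iE] := mx_norm_neq0 y0.
    apply: (@le_trans _ _ (expR (`|a| * `|y|))%:E); first by rewrite lee_fin.
    have -> : `|y| = `|y ord0 i| by rewrite -[LHS]/(mx_norm y) iE /= (ord1 i0).
    rewrite (bigD1 i)//= addeCA leeDl// adde_ge0// ?sume_ge0//.
rewrite ge0_integralD//; last 2 first.
- by move=> y _; rewrite sume_ge0// => i _; rewrite lee_fin expR_ge0.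
- by apply: emeasurable_sum => i.
rewrite ge0_integral_sum//.
apply: lte_add_pinfty.
  rewrite integral_cst// mul1e.
  exact: le_lt_trans (probability_le1 gamma measurableT) (ltry _).
apply: lte_sum_pinfty => i _.
rewrite (gauss_coord hgamma i (F := fun z => (expR (`|a| * `|z|))%:E)).
  exact: gauss1_exp.
by apply/measurable_EFinP; apply: measurableT_comp => //; exact: measurable_funM.
Qed.

End gaussian_tame.

(** * Dominated convergence and calculus on the line *)

Lemma Rintegral_cvg_dominated d (T : measurableType d) (R : realType) (mu : {measure set T -> \bar R})
    (F_ : nat -> T -> R) (F G : T -> R) :
  (forall k, measurable_fun setT (F_ k)) ->
  (forall x, F_ ^~ x @ \oo --> F x) ->
  mu.-integrable setT (EFin \o G) ->
  (forall k x, `|F_ k x| <= G x) ->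
  (\int[mu]_x F_ k x) @[k --> \oo] --> \int[mu]_x F x.
Proof.
move=> mF_ cF iG FG.
have mF : measurable_fun setT F by apply: (measurable_fun_cvg mF_) => x _; exact: cF.
have [||||iF _ cvgI] := @dominated_convergence _ _ _ mu setT measurableT
    (fun k x => (F_ k x)%:E) (EFin \o F) (EFin \o G) _ _ _ iG.
- by move=> k; exact/measurable_EFinP.
- exact/measurable_EFinP.
- by apply: aeW => x _; apply: cvg_EFin; [exact: nearW|exact: cF].
- by apply: aeW => x k _; rewrite lee_fin.
apply: fine_cvg; rewrite fineK; last exact: integrable_fin_num.
exact: cvgI.
Qed.

Section calculus.
Context {R : realType}.
Local Notation mu := (@lebesgue_measure R).
Implicit Types f g m : R -> R.

Lemma is_derive_continuous (f g : R -> R) : (forall x : R, is_derive x 1 f (g x)) -> continuous f.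
Proof.
move=> df x; apply: differentiable_continuous; apply/derivable1_diffP.
by have [] := df x.
Qed.

Lemma FTC2 f g (a b : R) : a <= b -> continuous g ->
  (forall x : R, is_derive x 1 f (g x)) ->
  \int[mu]_(x in `[a, b]) g x = f b - f a.
Proof.
rewrite le_eqVlt => /predU1P[<-|ab] cg df.
  by rewrite set_itv1 Rintegral_set1 subrr.
have cf := is_derive_continuous df.
rewrite /Rintegral (@continuous_FTC2 _ g f)//.
- exact: continuous_subspaceT.
- split.
  + by move=> x _; have [] := df x.
  + exact/cvg_at_right_filter/cf.
  + exact/cvg_at_left_filter/cf.
- by move=> x _; rewrite derive1E; have [_ ->] := df x.
Qed.

Lemma integrable_itv f (a b : R) : continuous f -> mu.-integrable `[a, b] (EFin \o f).
Proof.
move=> cf; apply: continuous_compact_integrable; first exact: segment_compact.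
exact: continuous_subspaceT.
Qed.

Lemma increasing_derive f g : (forall x : R, is_derive x 1 f (g x)) -> (forall x, 0 < g x) ->
  {mono f : x y / x <= y}.
Proof.
move=> df g0; apply: le_mono => x y xy.
have cf := is_derive_continuous df.
have [c _ e] := @MVT _ f g x y xy (fun t _ => df t) (continuous_subspaceT cf).
by rewrite -subr_gt0 e mulr_gt0// subr_gt0.
Qed.

Lemma Rintegral_cvg_sets g (A_ : nat -> set R) (A : set R) :
  mu.-integrable setT (EFin \o g) -> (forall k, measurable (A_ k)) -> measurable A ->
  (forall x, \forall k \near \oo, A_ k x <-> A x) ->
  (\int[mu]_(x in A_ k) g x) @[k --> \oo] --> \int[mu]_(x in A) g x.
Proof.
move=> ig mA_ mA hA.
have mg : measurable_fun setT g by apply/measurable_EFinP; exact: measurable_int ig.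
rewrite Rintegral_mkcond; under eq_fun do rewrite Rintegral_mkcond.
apply: (@Rintegral_cvg_dominated _ _ _ mu _ _ (fun x => `|g x|)).
- move=> k; apply/(measurable_restrictT _ (mA_ k)).
  exact: measurable_funTS.
- move=> x; apply: cvg_near_cst; near=> k.
  have [h1 h2] : A_ k x <-> A x by near: k; exact: hA.
  rewrite /patch; case: ifPn => [/set_mem/h1 Ax|/negP nA]; first by rewrite mem_set.
  by case: ifPn => // /set_mem/h2 Ax; exfalso; apply: nA; exact: mem_set.
- exact: (integrable_norm ig).
- by move=> k x; rewrite /patch; case: ifPn => // _; rewrite normr0.
Unshelve. all: end_near. Qed.

Lemma Rintegral_itv_cvg g : mu.-integrable setT (EFin \o g) ->
  (\int[mu]_(x in `[- (k%:R : R), k%:R]) g x) @[k --> \oo] --> \int[mu]_x g x.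
Proof.
move=> ig; apply: Rintegral_cvg_sets => // x; near=> k; split => // _ /=.
have : `|x| <= k%:R.
  near: k; exists (Num.truncn `|x|).+1 => // k /= hk.
  have /ltW/le_trans := truncnS_gt `|x|; apply.
  by rewrite ler_nat.
by rewrite in_itv /= ler_norml.
Unshelve. all: end_near. Qed.

End calculus.

(** * Distribution functions and quantiles of positive densities *)

Section cdf.
Context {R : realType}.
Local Notation mu := (@lebesgue_measure R).
Variable m : R -> R.
Hypothesis m0 : forall x, 0 < m x.
Hypothesis cm : continuous m.
Hypothesis im : mu.-integrable setT (EFin \o m).
Hypothesis m1 : \int[mu]_x m x = 1.

Definition cdfm (z : R) : R := \int[mu]_(t in `]-oo, z]) m t.

Definition quant (p : R) : R := sup [set t | cdfm t <= p].

Let imA (A : set R) : measurable A -> mu.-integrable A (EFin \o m).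
Proof. by move=> mA; exact: (integrableS measurableT). Qed.

Lemma cdfm_derive (z : R) : is_derive z 1 cdfm (m z).
Proof.
have [d1 d2] : derivable cdfm z 1 /\ cdfm^`()%classic z = m z.
  apply: (@continuous_FTC1 R m -oo%O z (z + 1)); [|exact: imA| |exact: cm].
    by rewrite ltrDl.
  by rewrite ltNyr.
by apply: DeriveDef; [exact: d1|rewrite -derive1E; exact: d2].
Qed.

Lemma cdfm_le : {mono cdfm : x y / x <= y}.
Proof. exact: increasing_derive cdfm_derive m0. Qed.

Lemma cdfm_lt : {mono cdfm : x y / x < y}.
Proof. exact: leW_mono cdfm_le. Qed.

Let cdfm_cont : continuous cdfm.
Proof. exact: is_derive_continuous cdfm_derive. Qed.

Let cvg_cdfm1 : cdfm k%:R @[k --> \oo] --> (1 : R).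
Proof.
rewrite -[X in _ --> X]m1; apply: Rintegral_cvg_sets => // x; near=> k; split => // _ /=.
rewrite in_itv /=; near: k; exists (Num.truncn `|x|).+1 => // k /= hk.
have /ltW/(le_trans (ler_norm x))/le_trans := truncnS_gt `|x|; apply.
by rewrite ler_nat.
Unshelve. all: end_near. Qed.

Let cvg_cdfm0 : cdfm (- k%:R) @[k --> \oo] --> (0 : R).
Proof.
rewrite -[X in _ --> X](Rintegral_set0 mu m).
apply: Rintegral_cvg_sets => // x; near=> k; split => //=.
rewrite in_itv /= => xk; have : x > - k%:R; last by rewrite ltNge xk.
rewrite ltrNl; apply: (@le_lt_trans _ _ `|x|); first by rewrite -normrN ler_norm.
near: k; exists (Num.truncn `|x|).+1 => // k /= hk.
by apply: lt_le_trans (truncnS_gt _) _; rewrite ler_nat.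
Unshelve. all: end_near. Qed.

Lemma cdfm_gt0 z : 0 < cdfm z.
Proof.
apply: (@le_lt_trans _ _ (cdfm (z - 1))); last by rewrite cdfm_lt ltrBlDr ltrDl.
by apply: Rintegral_ge0 => t _; exact: ltW.
Qed.

Lemma cdfm_lt1 z : cdfm z < 1.
Proof.
apply: (@lt_le_trans _ _ (cdfm (z + 1))); first by rewrite cdfm_lt ltrDl.
have [k hk] : exists k : nat, z + 1 <= k%:R.
  exists (Num.truncn `|z + 1|).+1; apply: le_trans (ler_norm _) _.
  exact/ltW/truncnS_gt.
apply: (@le_trans _ _ (cdfm k%:R)); first by rewrite cdfm_le.
rewrite -[leRHS]m1; apply: fine_le.
- by apply: integrable_fin_num => //; exact: imA.
- exact: integrable_fin_num.
- have mm : measurable_fun setT m by exact: continuous_measurable_fun.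
  apply: ge0_subset_integral => //; first by apply/measurable_EFinP.
  by move=> x _; rewrite lee_fin ltW.
Qed.

Lemma cdfm_surj p : 0 < p < 1 -> exists z, cdfm z = p.
Proof.
move=> /andP[p0 p1].
have [a ap] : exists a, cdfm a < p.
  have /cvgr_lt/(_ p p0) [k _ hk] := cvg_cdfm0.
  by exists (- k%:R); exact: (hk k (leqnn k)).
have [b bp] : exists b, p < cdfm b.
  have /cvgr_gt/(_ p p1) [k _ hk] := cvg_cdfm1.
  by exists (k%:R); exact: (hk k (leqnn k)).
have ab : a <= b by rewrite -cdfm_le; apply: ltW; exact: lt_trans ap bp.
have [|c _ <-] := @IVT _ cdfm a b p ab (continuous_subspaceT cdfm_cont); last by exists c.
by rewrite min_l ?max_r ?cdfm_le// !ltW.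
Qed.

Lemma cdfmK : cancel cdfm quant.
Proof.
move=> z; rewrite /quant.
have -> : [set t | cdfm t <= cdfm z] = `]-oo, z]%classic; last by rewrite sup_itv.
by apply/seteqP; split => t /=; rewrite in_itv /= cdfm_le.
Qed.

Lemma quantK p : 0 < p < 1 -> cdfm (quant p) = p.
Proof. by move=> /cdfm_surj[z <-]; rewrite cdfmK. Qed.

Lemma quant_gt t p : 0 < p < 1 -> (t < quant p) = (cdfm t < p).
Proof. by move=> /cdfm_surj[z <-]; rewrite cdfmK cdfm_lt. Qed.

Lemma quant_derive (p : R) : 0 < p < 1 -> is_derive p 1 quant (m (quant p))^-1.
Proof.
move=> /cdfm_surj[z <-]; rewrite cdfmK.
apply: (@is_derive_inverse R cdfm quant (m z) z).
- by near=> x; exact: cdfmK.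
- by near=> x; exact: cdfm_cont.
- exact: cdfm_derive.
- by rewrite gt_eqF.
Unshelve. all: end_near. Qed.

Lemma measurable_quant d (T : measurableType d) (p : T -> R) :
  measurable_fun setT p -> (forall x, 0 < p x < 1) ->
  measurable_fun setT (fun x => quant (p x)).
Proof.
move=> mp p01; apply: (measurability _ (RGenOInfty.measurableE R)).
move=> B [C [t ->]] <-; rewrite setTI.
have -> : (fun x => quant (p x)) @^-1` `]t, +oo[ = p @^-1` `]cdfm t, +oo[.
  by apply/seteqP; split => x /=; rewrite !in_itv /= !andbT quant_gt.
rewrite -[X in measurable X]setTI.
exact: mp.
Qed.

End cdf.

(** Rays are the convenient pi-system for a monotone map, since the preimage of a ray is again a
    ray. *)
Lemma rays_unique {R : realType} (m1 m2 : {measure set (measurableTypeR R) -> \bar R}) :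
  (m1 setT < +oo)%E ->
  (forall t : R, m1 `]t, +oo[%classic = m2 `]t, +oo[%classic) ->
  forall A, measurable A -> m1 A = m2 A.
Proof.
move=> m1T h.
refine (@measure_unique _ R (measurableTypeR R) (@RGenOInfty.G R)
  (fun k => `](- (k%:R : R)), +oo[%classic) (RGenOInfty.measurableE R) _ _ _ m1 m2 _ _).
- move=> _ _ [s ->] [t ->]; exists (Num.max s t).
  apply/seteqP; split => x /=; rewrite !in_itv /= !andbT gt_max.
    by move=> [-> ->].
  by move=> /andP[].
- by move=> k; exists (- k%:R).
- apply/seteqP; split => // x _; exists (Num.truncn `|x|).+1 => //=.
  rewrite in_itv /= andbT ltrNl.
  apply: (@le_lt_trans _ _ `|x|); first by rewrite -normrN ler_norm.
  exact: truncnS_gt.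
- by move=> _ [t ->].
- by move=> k; apply: le_lt_trans m1T; rewrite le_measure// inE.
Qed.

(** Packs the set function as a measure, so that uniqueness on rays or boxes applies to its
    images. *)
Lemma exists_density d (T : measurableType d) (R : realType)
    (mu : {measure set T -> \bar R}) (rho : T -> R) :
  measurable_fun setT rho -> (forall x, 0 <= rho x) ->
  exists nu : {measure set T -> \bar R},
    forall A, nu A = (\int[mu]_(x in A) (rho x)%:E)%E.
Proof.
move=> mrho rho0.
pose nu (A : set T) := (\int[mu]_(x in A) (rho x)%:E)%E.
have nu0 : nu set0 = 0%E by rewrite /nu integral_set0.
have nu_ge0 A : (0 <= nu A)%E by apply: integral_ge0 => x _; rewrite lee_fin.
have nu_sa : semi_sigma_additive nu.
  move=> /= A mA tA mUA; rewrite /nu ge0_integral_bigcup//=.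
  - by apply: is_cvg_ereal_nneg_natsum_cond => k _ _; apply: integral_ge0 => x _; rewrite lee_fin.
  - by apply: measurable_funTS; exact/measurable_EFinP.
  - by move=> x _; rewrite lee_fin.
pose nuM := isMeasure.Build _ _ _ nu nu0 nu_ge0 nu_sa.
pose nu' : {measure set T -> \bar R} := HB.pack nu nuM.
by exists nu'.
Qed.

(** * Integration by parts for the Gaussian on the line *)

Section gauss1_calculus.
Context {R : realType}.
Local Notation mu := (@lebesgue_measure R).
Local Notation N01 := (normal_prob (0:R) 1).
Local Notation phi := (normal_pdf (0:R) 1).
Local Notation tame1 := (tame (fun z : R => `|z|)).

Lemma is_derive_ext (f g : R -> R) (x a b : R) :
  is_derive x 1 f a -> (forall y, f y = g y) -> a = b -> is_derive x 1 g b.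
Proof. by move=> + /funext <- <-. Qed.

Lemma measurable_norm1 : measurable_fun setT (fun z : R => `|z|).
Proof. exact: measurableT_comp. Qed.

Lemma phi_continuous : continuous phi.
Proof. by apply: continuous_normal_pdf; rewrite oner_eq0. Qed.

Lemma phi_derive (z : R) : is_derive z 1 phi (- z * phi z).
Proof.
have -> : phi = (fun z => phi 0 * expR (- (z ^+ 2 / 2))) by apply/funext => w; exact: phiE.
have d1 : is_derive z 1 (fun w : R => - (w ^+ 2 / 2)) (- z).
  by apply: is_derive_eq; rewrite /GRing.scale /=; field.
have d2 := @is_derive1_comp R expR (fun w : R => - (w ^+ 2 / 2)) z _ _ (is_derive_expR _) d1.
have d3 := @is_deriveZ R R^o R^o _ (phi 0) z 1 _ d2.
apply: (is_derive_ext d3) => [//|].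
by rewrite /GRing.scale /=; ring.
Qed.

Lemma gauss1_integrable (F : R -> R) : tame1 F -> N01.-integrable setT (EFin \o F).
Proof.
move=> tF.
have h := @tame_integrable _ (measurableTypeR R) R (fun z => `|z|) measurable_norm1 N01 gauss1_exp F tF.
exact: h.
Qed.

Lemma gauss1_intB (F G : R -> R) : tame1 F -> tame1 G ->
  \int[N01]_x (F x - G x) = \int[N01]_x F x - \int[N01]_x G x.
Proof. by move=> tF tG; rewrite RintegralB//; exact: gauss1_integrable. Qed.

Lemma gauss1_intD (F G : R -> R) : tame1 F -> tame1 G ->
  \int[N01]_x (F x + G x) = \int[N01]_x F x + \int[N01]_x G x.
Proof. by move=> tF tG; rewrite RintegralD//; exact: gauss1_integrable. Qed.

Lemma gauss1_intZl (c : R) (F : R -> R) : tame1 F ->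
  \int[N01]_x (c * F x) = c * \int[N01]_x F x.
Proof. by move=> tF; rewrite RintegralZl//; exact: gauss1_integrable. Qed.

Lemma gauss1_int_le (F G : R -> R) : tame1 F -> tame1 G -> (forall x, F x <= G x) ->
  \int[N01]_x F x <= \int[N01]_x G x.
Proof. by move=> tF tG FG; apply: le_Rintegral => //; exact: gauss1_integrable. Qed.

Lemma tame1_id : tame1 (fun z => z).
Proof. by apply: tame_id => //; exact: measurable_id. Qed.

Lemma RintegralN01 (F : R -> R) : measurable_fun setT F ->
  \int[N01]_z F z = \int[mu]_z (F z * phi z).
Proof.
move=> mF; rewrite /Rintegral integral_N01; last exact/measurable_EFinP.
by congr fine; apply: eq_integral => z _; rewrite EFinM.
Qed.

Lemma integrable_tame_phi (F : R -> R) : tame1 F -> mu.-integrable setT (EFin \o (fun z => F z * phi z)).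
Proof.
move=> tF; have mF := tame_measurable tF.
have mp := measurable_normal_pdf (0:R) 1.
apply/integrableP; split; first by apply/measurable_EFinP; exact: measurable_funM.
have /integrableP[_] := gauss1_integrable tF.
rewrite integral_N01; last by apply: measurableT_comp => //; exact/measurable_EFinP.
congr (_ < _)%E; apply: eq_integral => z _ /=.
by rewrite normrM (ger0_norm (normal_pdf_ge0 _ _ _)).
Qed.

Lemma tame_phi_decay (F : R -> R) : tame1 F ->
  exists2 C, 0 <= C & forall z, `|F z * phi z| <= C * expR (- `|z|).
Proof.
move=> [_ [C [a [C0 a0 hF]]]].
(* From (a + 1)|z| - z^2/2 <= (a + 1)^2/2: one unit of the exponential rate is kept as decay. *)
exists (C * phi 0 * expR ((a + 1) ^+ 2 / 2)).
  by rewrite !mulr_ge0 ?expR_ge0// normal_pdf_ge0.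
move=> z; rewrite normrM (ger0_norm (normal_pdf_ge0 _ _ _)).
apply: (@le_trans _ _ (C * expR (a * `|z|) * phi z)).
  by rewrite ler_wpM2r ?normal_pdf_ge0.
rewrite phiE mulrACA -expRD -[leRHS]mulrA -expRD; apply: ler_wpM2l.
  by rewrite mulr_ge0// normal_pdf_ge0.
rewrite ler_expR -[in leLHS](real_normK (num_real z)).
have := sqr_ge0 (`|z| - (a + 1)).
rewrite sqrrB; nra.
Qed.

Lemma expRN_cvg0 (C : R) : C * expR (- (k%:R : R)) @[k --> \oo] --> (0 : R).
Proof.
have h : expR (- (k%:R : R)) @[k --> \oo] --> (0 : R).
  apply: (@squeeze_cvgr _ _ _ _ (fun=> 0) (fun k : nat => (k.+1%:R : R)^-1)).
  - near=> k; rewrite expR_ge0/= expRN lef_pV2 ?posrE ?expR_gt0//.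
    by apply: le_trans (expR_ge1Dx _); rewrite -natr1 addrC.
  - exact: cvg_cst.
  - exact: cvg_harmonic.
by rewrite -[X in _ --> X](mulr0 C); apply: cvgM => //; exact: cvg_cst.
Unshelve. all: end_near. Qed.

(** One-sided integration by parts: on [-k, k] the integral of W is at most a difference of boundary
    values of H, which tend to 0. Integrability is asked of W and not of [H'], because the
    derivative met in the transport argument contains the unknown slope of the transport map. *)
Lemma ibp_le (H H' W : R -> R) (C : R) : (forall z : R, is_derive z 1 H (H' z)) ->
  continuous H' -> continuous W -> mu.-integrable setT (EFin \o W) ->
  (forall z, W z <= H' z) -> (forall z, `|H z| <= C * expR (- `|z|)) ->
  \int[mu]_z W z <= 0.
Proof.
move=> dH cH' cW iW WH hH.
have cv := Rintegral_itv_cvg iW.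
have : C * expR (- (k%:R : R)) + C * expR (- (k%:R : R)) @[k --> \oo] --> (0 + 0 : R).
  by apply: cvgD; exact: expRN_cvg0.
rewrite addr0 => cv0.
apply: (ler_cvg_to cv cv0); near=> k.
apply: (@le_trans _ _ (\int[mu]_(z in `[- (k%:R : R), k%:R]) H' z)).
  by apply: le_Rintegral => //; exact: integrable_itv.
rewrite (FTC2 _ cH' dH); last by rewrite lerNl (@le_trans _ _ 0)// oppr_le0.
apply: le_trans (ler_norm _) _; apply: le_trans (ler_normB _ _) _.
apply: lerD; apply: le_trans (hH _) _; rewrite ?normrN.
  by rewrite ger0_norm.
by rewrite ger0_norm.
Unshelve. all: end_near. Qed.

Lemma gauss1_ibp (F F' : R -> R) : (forall z : R, is_derive z 1 F (F' z)) ->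
  continuous F' -> tame1 F -> tame1 F' ->
  \int[N01]_z (F' z - z * F z) = 0.
Proof.
move=> dF cF' tF tF'.
have cF := is_derive_continuous dF.
have tz : tame1 (fun z => z) by apply: tame_id => //; exact: measurable_id.
have tW : tame1 (fun z => F' z - z * F z) by apply: tameB => //; exact: tameM.
have [C C0 hC] := tame_phi_decay tF.
have cW : continuous (fun z => (F' z - z * F z) * phi z).
  move=> z; apply: cvgM; last exact: phi_continuous.
  apply: cvgB; first exact: cF'.
  by apply: cvgM; [exact: cvg_id|exact: cF].
have dH (z : R) : is_derive z 1 (fun z => F z * phi z) ((F' z - z * F z) * phi z).
  have d := @is_deriveM R R^o F phi z 1 _ _ (dF z) (phi_derive z).
  by apply: (is_derive_ext d) => [//|]; rewrite /GRing.scale /=; ring.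
rewrite RintegralN01; last by case: tW.
apply/eqP; rewrite eq_le; apply/andP; split.
  by apply: (ibp_le dH cW cW) hC => //; exact: integrable_tame_phi.
rewrite -oppr_le0.
have iW := integrable_tame_phi tW.
have -> : - (\int[mu]_z ((F' z - z * F z) * phi z)) = \int[mu]_z (- ((F' z - z * F z) * phi z)).
  rewrite -[LHS]mulN1r -RintegralZl//.
  by apply: eq_Rintegral => z _; rewrite mulN1r.
apply: (@ibp_le (fun z => - (F z * phi z)) (fun z => - ((F' z - z * F z) * phi z)) _ C).
- by move=> z; apply: cvgN; exact: cW.
- by move=> z; apply: cvgN; exact: cW.
- have tNW := tameN tW.
  rewrite (_ : (fun z => _) = (fun z => - (F' z - z * F z) * phi z)); first exact: integrable_tame_phi.
  by apply/funext => z; rewrite mulNr.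
- by [].
- by move=> z; rewrite normrN.
Qed.

Let cst_cont (c : R) : continuous (fun _ : R => c).
Proof. by move=> z; exact: cvg_cst. Qed.

Lemma gauss1_mean : \int[N01]_z z = 0.
Proof.
have := @gauss1_ibp (fun=> 1) (fun=> 0) (fun z => is_derive_cst (1:R) z 1) (@cst_cont 0)
  (tame_cst _ _) (tame_cst _ _).
under eq_Rintegral do rewrite mulr1 sub0r -mulN1r.
by rewrite (gauss1_intZl _ tame1_id) mulN1r => /eqP; rewrite oppr_eq0 => /eqP.
Qed.

Lemma gauss1_var : \int[N01]_z (z ^+ 2) = 1.
Proof.
have tz := tame1_id.
have := @gauss1_ibp (fun z => z) (fun=> 1) (fun z => is_derive_id z 1) (@cst_cont 1) tz (tame_cst _ _).
rewrite gauss1_intB; [|exact: tame_cst|exact: tameM].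
rewrite Rintegral_cst// => /eqP; rewrite subr_eq0 => /eqP.
under [in RHS]eq_Rintegral do rewrite -expr2.
by move=> <-; rewrite mul1r [X in fine X]probability_setT.
Qed.

End gauss1_calculus.

(** * Tails of a positive density *)

Section tails.
Context {R : realType}.
Local Notation mu := (@lebesgue_measure R).
Variable m : R -> R.
Hypothesis m0 : forall x, 0 < m x.
Hypothesis cm : continuous m.
Hypothesis im : mu.-integrable setT (EFin \o m).
Hypothesis m1 : \int[mu]_x m x = 1.

Let imA (A : set R) : measurable A -> mu.-integrable A (EFin \o m).
Proof. by move=> mA; exact: (integrableS measurableT). Qed.

Lemma cdfm_right z : \int[mu]_(t in `]z, +oo[) m t = 1 - cdfm m z.
Proof.
rewrite -m1 -(setUv `]-oo, z]%classic) Rintegral_setU//.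
- rewrite /cdfm addrC addKr; congr Rintegral.
  by rewrite setCitvl.
- exact: measurableC.
- by rewrite setUv.
- exact/disj_setPCl.
Qed.

Let mm : measurable_fun setT m.
Proof. exact: continuous_measurable_fun. Qed.

Let chernoff (A : set R) (a t : R) : measurable A ->
  (forall x, A x -> 0 <= a * (x - t)) ->
  mu.-integrable setT (EFin \o (fun x => expR (a * x) * m x)) ->
  \int[mu]_(x in A) m x <= expR (- (a * t)) * \int[mu]_x (expR (a * x) * m x).
Proof.
move=> mA hA iE.
rewrite -RintegralZl//; apply: (@le_trans _ _ (\int[mu]_(x in A) (expR (- (a * t)) * (expR (a * x) * m x)))).
  have iE' : mu.-integrable setT (EFin \o (fun x => expR (- (a * t)) * (expR (a * x) * m x))).
    rewrite (_ : _ \o _ = (fun x => (expR (- (a * t)))%:E * (expR (a * x) * m x)%:E)%E); last first.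
      by apply/funext => x; rewrite /= EFinM.
    exact: integrableZl.
  apply: le_Rintegral => //; [exact: imA|exact: integrableS iE'|move=> x Ax].
  rewrite mulrA -expRD; apply: ler_peMl; first exact: ltW.
  rewrite -[leLHS]expR0 ler_expR.
  by rewrite addrC -mulrBr; exact: hA.
have iE' : mu.-integrable setT (EFin \o (fun x => expR (- (a * t)) * (expR (a * x) * m x))).
  rewrite (_ : _ \o _ = (fun x => (expR (- (a * t)))%:E * (expR (a * x) * m x)%:E)%E); last first.
    by apply/funext => x; rewrite /= EFinM.
  exact: integrableZl.
apply: fine_le.
- by apply: integrable_fin_num => //; exact: integrableS iE'.
- exact: integrable_fin_num.
- apply: ge0_subset_integral => //; first exact: measurable_int iE'.
  by move=> x _; rewrite lee_fin !mulr_ge0 ?expR_ge0// ltW.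
Qed.

Lemma cdfm_chernoff (a t : R) : 0 <= a ->
  mu.-integrable setT (EFin \o (fun x => expR (a * x) * m x)) ->
  1 - cdfm m t <= expR (- (a * t)) * \int[mu]_x (expR (a * x) * m x).
Proof.
move=> a0 iE; rewrite -cdfm_right; apply: chernoff => // x /=.
by rewrite in_itv /= andbT => /ltW tx; rewrite mulr_ge0// subr_ge0.
Qed.

Lemma cdfm_chernoffN (a t : R) : a <= 0 ->
  mu.-integrable setT (EFin \o (fun x => expR (a * x) * m x)) ->
  cdfm m t <= expR (- (a * t)) * \int[mu]_x (expR (a * x) * m x).
Proof.
move=> a0 iE; apply: chernoff => // x /=.
by rewrite in_itv /= => tx; rewrite mulr_le0// subr_le0.
Qed.

(** By the mean value theorem the mass of the unit interval to the right of t is the density at some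
    point c of it. Tails are thus bounded below by values of the density, the counterpart of the
    Chernoff bounds above. *)
Lemma cdfm_tail_right (t : R) : exists2 c, `|c| <= `|t| + 1 & m c <= 1 - cdfm m t.
Proof.
have dm := cdfm_derive cm im.
have [] := @MVT _ (cdfm m) m t (t + 1) _ (fun x _ => dm x) (continuous_subspaceT (is_derive_continuous dm)).
  by rewrite ltrDl.
move=> c; rewrite in_itv /= => /andP[tc ct]; rewrite (addrC t) addrK mulr1 => e.
exists c.
  rewrite ler_norml; apply/andP; split.
    by have := ler_norm (- t); rewrite normrN; lra.
  by have := ler_norm t; lra.
by rewrite -e; have := cdfm_lt1 m0 cm im m1 (t + 1); rewrite addrC; lra.
Qed.

Lemma cdfm_tail_left (t : R) : exists2 c, `|c| <= `|t| + 1 & m c <= cdfm m t.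
Proof.
have dm := cdfm_derive cm im.
have [] := @MVT _ (cdfm m) m (t - 1) t _ (fun x _ => dm x) (continuous_subspaceT (is_derive_continuous dm)).
  by rewrite ltrBlDr ltrDl.
move=> c; rewrite in_itv /= => /andP[tc ct] e.
exists c.
  rewrite ler_norml; apply/andP; split.
    by have := ler_norm (- t); rewrite normrN; lra.
  by have := ler_norm t; lra.
have := cdfm_gt0 m0 cm im (t - 1).
by move: e; rewrite opprB addrCA subrr addr0 mulr1 => e; rewrite -e; lra.
Qed.

End tails.

(** * Monotone transport on the line *)

Section transport1.
Context {R : realType}.
Local Notation mu := (@lebesgue_measure R).
Local Notation N01 := (normal_prob (0:R) 1).
Local Notation phi := (normal_pdf (0:R) 1).
Local Notation tame1 := (tame (fun z : R => `|z|)).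

Variables (r r' : R -> R) (b : R).
Hypothesis b0 : 0 <= b.
Hypothesis r0 : forall z, 0 < r z.
Hypothesis dr : forall z : R, is_derive z 1 r (r' z).
Hypothesis cr' : continuous r'.
Hypothesis r'b : forall z, `|r' z| <= b * r z.
Hypothesis rlip : forall z w, r z <= expR (b * `|z - w|) * r w.
Hypothesis r1 : \int[N01]_z r z = 1.

(** The monotone rearrangement of r [phi] onto [phi]; r is a density with respect to the standard
    Gaussian. *)
Definition transport (z : R) : R := quant phi (cdfm (fun w => r w * phi w) z).

Local Notation T := transport.
Local Notation m := (fun w => r w * phi w).

Let cr : continuous r. Proof. exact: is_derive_continuous dr. Qed.

Let mr : measurable_fun setT r. Proof. exact: continuous_measurable_fun. Qed.
Let mr' : measurable_fun setT r'. Proof. exact: continuous_measurable_fun. Qed.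

Let tr : tame1 r.
Proof.
split => //; exists (r 0), b; split => //; first exact: ltW.
by move=> z; rewrite gtr0_norm// mulrC; have := rlip z 0; rewrite subr0.
Qed.

Let tr' : tame1 r'.
Proof.
have tbr : tame1 (fun z => b * r z) by apply: tameM => //; exact: tame_cst.
apply: (tame_bound mr' tbr) => z; apply: le_trans (r'b z) _; exact: ler_norm.
Qed.

Let te (a : R) : tame1 (fun z => expR (a * z)).
Proof.
apply: (@tame_expR _ _ _ _ _ 0 `|a|) => //.
by move=> z; rewrite add0r -normrM ler_norm.
Qed.

Let m_gt0 z : 0 < m z. Proof. by rewrite mulr_gt0// phi_gt0. Qed.

Let cm : continuous m.
Proof. by move=> z; apply: cvgM; [exact: cr|exact: phi_continuous]. Qed.

Let im : mu.-integrable setT (EFin \o m).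
Proof. exact: integrable_tame_phi. Qed.

Let m1 : \int[mu]_z m z = 1.
Proof. by rewrite -RintegralN01. Qed.

Let cphi : continuous phi := @phi_continuous R.
Let iphi : mu.-integrable setT (EFin \o phi).
Proof. exact: integrable_normal_pdf. Qed.
Let phi1 : \int[mu]_z phi z = 1.
Proof. by rewrite /Rintegral integral_normal_pdf. Qed.

Lemma cdfm_density01 z : 0 < cdfm m z < 1.
Proof. by rewrite cdfm_gt0//= cdfm_lt1. Qed.

Let cdfmT z : cdfm phi (T z) = cdfm m z.
Proof. by apply: (quantK (@phi_gt0 R)) => //; exact: cdfm_density01. Qed.

Let phi_exp a : \int[mu]_z (expR (a * z) * phi z) = expR (a ^+ 2 / 2).
Proof.
rewrite -RintegralN01; last by case: (te a).
by rewrite /Rintegral gauss1_mgf.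
Qed.

Lemma transport_derive (z : R) : is_derive z 1 T (m z / phi (T z)).
Proof.
have d1 := @cdfm_derive R m cm im z.
have d2 := quant_derive (@phi_gt0 R) cphi iphi phi1 (cdfm_density01 z).
have d := @is_derive1_comp R _ _ z _ _ d2 d1.
by apply: (is_derive_ext d) => //; rewrite mulrC.
Qed.

Let cT : continuous T. Proof. exact: is_derive_continuous transport_derive. Qed.

Let mT : measurable_fun setT T. Proof. exact: continuous_measurable_fun. Qed.

(** From (|t| + 1)^2 <= 2 t^2 + 2. Giving up a square allows the unknown point c of the tail lemmas
    to be replaced by t. *)
Let phi2_le (t c : R) : `|c| <= `|t| + 1 -> phi t ^+ 2 <= phi 0 * expR 1 * phi c.
Proof.
move=> ct.
have e2 : expR (- (t ^+ 2 / 2)) ^+ 2 = expR (- t ^+ 2) by rewrite [LHS]expr2 -expRD; congr expR; field.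
rewrite (phiE t) (phiE c) exprMn e2 [phi 0 ^+ 2]expr2 -!mulrA ler_wpM2l ?normal_pdf_ge0//.
rewrite (mulrCA (expR 1)) ler_wpM2l ?normal_pdf_ge0// -expRD ler_expR.
have c2 : `|c| ^+ 2 <= (`|t| + 1) ^+ 2 by rewrite ler_pXn2r ?nnegrE ?addr_ge0.
have := sqr_ge0 (`|t| - 1); move: c2; rewrite sqrrD sqrrB !real_normK ?num_real//; lra.
Qed.

(** Over a distance d the function r falls by at most a factor e^(b d), so up to a constant m stays
    above a Gaussian; b (|z| + 1) + (|z| + 1)^2/2 is completed to the square of |z| + 1 + b. *)
Let m_lower : exists2 c0, 0 <= c0 & forall z c : R, `|c| <= `|z| + 1 ->
  expR (- ((`|z| + 1 + b) ^+ 2 / 2 + c0)) <= m c.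
Proof.
pose a := ln (r 0 * phi 0).
have a_pos : 0 < r 0 * phi 0 by rewrite mulr_gt0// phi_gt0.
exists `|a| => // z c cz.
have h1 : r 0 * expR (- (b * (`|z| + 1))) <= r c.
  have := rlip 0 c; rewrite sub0r normrN => h.
  rewrite expRN ler_pdivrMr ?expR_gt0// mulrC.
  apply: le_trans h _; apply: ler_wpM2r; first exact: ltW.
  by rewrite ler_expR ler_wpM2l.
have h2 : phi 0 * expR (- ((`|z| + 1) ^+ 2 / 2)) <= phi c.
  rewrite (phiE c) ler_wpM2l ?normal_pdf_ge0// ler_expR lerN2 ler_wpM2r//.
  by rewrite -(real_normK (num_real c)) ler_pXn2r ?nnegrE ?addr_ge0.
apply: (@le_trans _ _ ((r 0 * expR (- (b * (`|z| + 1)))) * (phi 0 * expR (- ((`|z| + 1) ^+ 2 / 2))))); last first.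
  by apply: ler_pM => //; rewrite mulr_ge0 ?expR_ge0 ?normal_pdf_ge0// ltW.
rewrite mulrACA -expRD -[X in _ <= X * _](lnK (x := r 0 * phi 0))// -expRD ler_expR -/a.
have := ler_norm (- a); rewrite normrN.
have := normr_ge0 z; nra.
Qed.

Let phi_chernoff t : expR (t ^+ 2 / 2) * (if 0 <= t then 1 - cdfm phi t else cdfm phi t) <= 1.
Proof.
have e : expR (t ^+ 2 / 2) * (expR (- (t * t)) * expR (t ^+ 2 / 2)) = 1.
  by rewrite -!expRD -[RHS]expR0; congr expR; field.
rewrite -[leRHS]e ler_wpM2l ?expR_ge0//; case: ifPn => [t0|].
  by have := cdfm_chernoff (@phi_gt0 R) iphi phi1 t t0 (integrable_tame_phi (te t)); rewrite phi_exp.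
rewrite -ltNge => /ltW t0.
by have := cdfm_chernoffN (@phi_gt0 R) iphi t t0 (integrable_tame_phi (te t)); rewrite phi_exp.
Qed.

(** The tail of [phi] at T z equals the tail of m at z. The former is at most e^(-T^2/2) by
    Chernoff, the latter is at least Gaussian by [m_lower], and comparing exponents bounds T. *)
Let T_growth : exists2 A, 0 <= A & forall z, `|T z| <= A + `|z|.
Proof.
have [c0 c00 hm] := m_lower.
exists (1 + b + (1 + 2 * c0)); first by rewrite !addr_ge0// mulr_ge0.
move=> z.
have key : T z ^+ 2 <= (`|z| + 1 + b) ^+ 2 + 2 * c0.
  have h : expR (T z ^+ 2 / 2) * expR (- ((`|z| + 1 + b) ^+ 2 / 2 + c0)) <= 1.
    apply: le_trans (phi_chernoff (T z)); rewrite ler_wpM2l ?expR_ge0// cdfmT.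
    case: ifP => _.
      by have [c cz] := cdfm_tail_right m_gt0 cm im m1 z; apply: le_trans; exact: hm.
    by have [c cz] := cdfm_tail_left m_gt0 cm im z; apply: le_trans; exact: hm.
  by move: h; rewrite -expRD -[X in _ <= X]expR0 ler_expR; lra.
have : `|T z| ^+ 2 <= (1 + b + (1 + 2 * c0) + `|z|) ^+ 2.
  rewrite real_normK ?num_real//; apply: le_trans key _.
  have := mulr_ge0 (addr_ge0 (normr_ge0 z) b0) c00; have := mulr_ge0 (normr_ge0 z) b0.
  set w := `|z| + 1 + b; have w1 : 1 <= w by rewrite /w -addrA addrCA lerDl addr_ge0.
  rewrite (_ : 1 + b + _ + _ = w + (1 + 2 * c0)); last by rewrite /w; ring.
  by clearbody w; nra.
by rewrite ler_pXn2r// nnegrE !addr_ge0// mulr_ge0.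
Qed.

Let tT : tame1 T.
Proof.
have [A A0 hA] := T_growth.
have tA : tame1 (fun z => A + `|z|).
  apply: tameD => //; first exact: tame_cst.
  by apply: tame_norm; exact: tame1_id.
apply: (tame_bound mT tA) => z; apply: le_trans (hA z) _; exact: ler_norm.
Qed.

(** Makes the boundary term z phi(T z) of the integration by parts vanish. The value phi(T z) is
    controlled by the tail of [phi] at T z, which is the tail of m at z and decays exponentially by
    Chernoff. *)
Let phiT_decay : exists2 C, 0 <= C & forall z, `|z * phi (T z)| <= C * expR (- `|z|).
Proof.
pose e a := \int[mu]_z (expR (a * z) * m z).
have ie a : mu.-integrable setT (EFin \o (fun z => expR (a * z) * m z)).
  rewrite (_ : (fun z => _) = (fun z => (expR (a * z) * r z) * phi z)); last first.
    by apply/funext => z; rewrite mulrA.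
  by apply: integrable_tame_phi; exact: tameM.
have e0 a : 0 <= e a.
  by apply: Rintegral_ge0 => z _; rewrite mulr_ge0 ?expR_ge0// ltW.
(* Chernoff at rate 4 bounds the square of phi(T z); the square root leaves rate 2, and one unit of
   it is spent on the factor |z|. *)
pose K := phi 0 * expR 1 * (e 4 + e (- 4)).
have K0 : 0 <= K by rewrite !mulr_ge0 ?addr_ge0 ?expR_ge0 ?normal_pdf_ge0.
have key z : phi (T z) ^+ 2 <= K * expR (- (4 * `|z|)).
  rewrite /K -!mulrA.
  have [z0|z0] := leP 0 z.
    have [c cz hc] := cdfm_tail_right (@phi_gt0 R) cphi iphi phi1 (T z).
    apply: le_trans (phi2_le cz) _; rewrite -mulrA ler_wpM2l ?normal_pdf_ge0// ler_wpM2l ?expR_ge0//.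
    apply: le_trans hc _; rewrite cdfmT.
    apply: le_trans (cdfm_chernoff m_gt0 im m1 z (ler0n R 4) (ie 4)) _.
    by rewrite ger0_norm// mulrC -/(e 4) ler_wpM2r ?expR_ge0// lerDl.
  have [c cz hc] := cdfm_tail_left (@phi_gt0 R) cphi iphi (T z).
  apply: le_trans (phi2_le cz) _; rewrite -mulrA ler_wpM2l ?normal_pdf_ge0// ler_wpM2l ?expR_ge0//.
  apply: le_trans hc _; rewrite cdfmT.
  have n4 : - 4 <= 0 :> R by rewrite oppr_le0.
  apply: le_trans (cdfm_chernoffN m_gt0 im z n4 (ie (- 4))) _.
  rewrite ltr0_norm// mulNr opprK mulrN opprK mulrC -/(e (- 4)) ler_wpM2r ?expR_ge0//.
  by rewrite lerDr.
exists (1 + K); first by rewrite addr_ge0.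
move=> z; rewrite normrM (ger0_norm (normal_pdf_ge0 _ _ _)).
have h1 : phi (T z) <= (1 + K) * expR (- (2 * `|z|)).
  have : phi (T z) ^+ 2 <= ((1 + K) * expR (- (2 * `|z|))) ^+ 2.
    apply: le_trans (key z) _; rewrite exprMn [X in _ <= _ * X]expr2 -expRD.
    rewrite (_ : - (2 * `|z|) + - (2 * `|z|) = - (4 * `|z|)); last by ring.
    by rewrite ler_wpM2r ?expR_ge0//; nra.
  by rewrite ler_pXn2r// nnegrE ?normal_pdf_ge0// mulr_ge0 ?expR_ge0// addr_ge0.
apply: le_trans (ler_wpM2l (normr_ge0 z) h1) _.
rewrite mulrCA ler_wpM2l ?addr_ge0//.
rewrite (_ : - (2 * `|z|) = - `|z| + - `|z|); last by ring.
rewrite expRD mulrA ler_piMl ?expR_ge0//.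
rewrite expRN ler_pdivrMr ?expR_gt0// mul1r.
by apply: le_trans (expR_ge1Dx _); rewrite lerDr.
Qed.

Let tz : tame1 (fun z => z) := @tame1_id R.

Let tW : tame1 (fun z => 2 * r z + (r' z * T z - 2 * (z * r z * T z))).
Proof.
apply: tameD => //; first by apply: tameM => //; exact: tame_cst.
apply: tameB => //; first exact: tameM.
by apply: tameM; [exact: tame_cst|apply: tameM => //; exact: tameM].
Qed.

Let transport_ineq : \int[N01]_z (2 * r z + (r' z * T z - 2 * (z * r z * T z))) <= 0.
Proof.
rewrite RintegralN01; last by case: tW.
have [C1 C10 h1] := tame_phi_decay (tameM tr tT).
have [C2 C20 h2] := phiT_decay.
have dm (z : R) : is_derive z 1 m (r z * (- z * phi z) + phi z * r' z).
  exact: (@is_deriveM R R^o r phi z 1 _ _ (dr z) (phi_derive z)).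
have d1 (z : R) : is_derive z 1 (fun w => m w * T w)
   (m z * (m z / phi (T z)) + T z * (r z * (- z * phi z) + phi z * r' z)).
  exact: (@is_deriveM R R^o m T z 1 _ _ (dm z) (transport_derive z)).
have d2 (z : R) : is_derive z 1 (fun w => phi (T w)) ((- T z * phi (T z)) * (m z / phi (T z))).
  exact: (@is_derive1_comp R phi T z _ _ (phi_derive _) (transport_derive z)).
have d3 (z : R) : is_derive z 1 (fun w => w * phi (T w))
   (z * ((- T z * phi (T z)) * (m z / phi (T z))) + phi (T z) * 1).
  exact: (@is_deriveM R R^o id (fun w => phi (T w)) z 1 _ _ (is_derive_id z 1) (d2 z)).
(* The derivative of m T + z phi(T). Since phi(T) T' = m, it equals m T' + phi(T) + (r' T - 2 z r T)
   phi, which exceeds the integrand by the square (m - phi(T))^2 / phi(T). *)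
pose H' z := (m z * (m z / phi (T z)) + T z * (r z * (- z * phi z) + phi z * r' z)) +
   (z * ((- T z * phi (T z)) * (m z / phi (T z))) + phi (T z) * 1).
have dH (z : R) : is_derive z 1 (fun w => m w * T w + w * phi (T w)) (H' z).
  exact: (@is_deriveD R R^o R^o _ _ z 1 _ _ (d1 z) (d3 z)).
have cphiT : continuous (fun z => phi (T z)).
  by move=> z; apply: (cvg_comp T phi); [exact: cT|exact: cphi].
have cdT : continuous (fun z => m z / phi (T z)).
  move=> z; apply: cvgM; first exact: cm.
  by apply: cvgV; [rewrite gt_eqF// phi_gt0|exact: cphiT].
have cid : continuous (fun z : R => z) by move=> z; exact: cvg_id.
have cN (f : R -> R) : continuous f -> continuous (fun z => - f z) by move=> cf z; apply: cvgN; exact: cf.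
have cM (f g : R -> R) : continuous f -> continuous g -> continuous (fun z => f z * g z).
  by move=> cf cg z; apply: cvgM; [exact: cf|exact: cg].
have cD (f g : R -> R) : continuous f -> continuous g -> continuous (fun z => f z + g z).
  by move=> cf cg z; apply: cvgD; [exact: cf|exact: cg].
have c1 (c : R) : continuous (fun _ : R => c) by move=> z; exact: cvg_cst.
apply: (@ibp_le _ (fun w => m w * T w + w * phi (T w)) H' _ (C1 + C2)) => //.
- apply: (cD); first apply: (cD).
  + by apply: (cM).
  + apply: (cM) => //; apply: (cD); last by apply: (cM).
    by apply: (cM) => //; apply: (cM) => //; exact: cN.
  + apply: (cD); last by apply: (cM).
    by apply: (cM) => //; apply: (cM) => //; apply: (cM) => //; exact: cN.
- apply: (cM) => //; apply: (cD); first by apply: (cM).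
  apply: (cD); first by apply: (cM).
  by apply: cN; apply: (cM) => //; apply: (cM) => //; by apply: (cM).
- exact: integrable_tame_phi.
- move=> z; rewrite /H'.
  have p0 : 0 < phi (T z) by exact: phi_gt0.
  have p1 : phi (T z) != 0 by rewrite gt_eqF.
  have -> : m z * (m z / phi (T z)) + T z * (r z * (- z * phi z) + phi z * r' z) +
    (z * (- T z * phi (T z) * (m z / phi (T z))) + phi (T z) * 1) =
    ((2 * r z + (r' z * T z - 2 * (z * r z * T z))) * phi z) + (m z - phi (T z)) ^+ 2 / phi (T z).
    by field.
  by rewrite lerDl divr_ge0 ?sqr_ge0// ltW.
- move=> z; apply: le_trans (ler_normD _ _) _; rewrite mulrDl; apply: lerD => //.
  by rewrite mulrAC; exact: h1.
Qed.

Lemma transport_law (B : set R) : measurable B ->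
  (\int[N01]_z ((\1_B (T z) * r z)%:E) = N01 B)%E.
Proof.
have [nu nuE] := exists_density N01 mr (fun z => ltW (r0 z)).
have lawT : forall A, measurable A -> nu (T @^-1` A) = N01 A.
  move=> A mA; apply/esym.
  have mT' : measurable_fun setT (T : measurableTypeR R -> measurableTypeR R) by exact: mT.
  apply: (@rays_unique R N01 (pushforward nu (T : measurableTypeR R -> measurableTypeR R))) => //.
    by apply: (le_lt_trans (probability_le1 N01 measurableT)); rewrite ltry.
  move=> t; rewrite /pushforward; etransitivity; last by symmetry; exact: nuE.
  have [St e] : exists S, cdfm m S = cdfm phi t.
    by apply: cdfm_surj => //; rewrite cdfm_gt0//= ?cdfm_lt1//; exact: phi_gt0.
  have Tt z : (t < T z) = (St < z).
    by rewrite -(cdfm_lt (@phi_gt0 R) cphi iphi t (T z)) cdfmT -e cdfm_lt.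
  have -> : T @^-1` `]t, +oo[ = `]St, +oo[%classic.
    by apply/seteqP; split => z /=; rewrite !in_itv /= !andbT Tt.
  transitivity (\int[mu]_(z in `]St, +oo[) (m z)%:E)%E; last first.
    rewrite [RHS]integral_mkcond integral_N01; last first.
      by apply/(measurable_restrictT _ _).1 => //; apply: measurable_funTS; exact/measurable_EFinP.
    rewrite integral_mkcond; apply: eq_integral => z _; rewrite /patch; case: ifP => _.
      by rewrite EFinM.
    by rewrite mul0e.
  transitivity ((1 - cdfm phi t)%:E); last first.
    rewrite -e -(cdfm_right im m1) fineK//; apply: integrable_fin_num => //.
    exact: (integrableS measurableT).
  rewrite -(cdfm_right iphi phi1) fineK//; apply: integrable_fin_num => //.
  exact: (integrableS measurableT).
move=> mB; rewrite -lawT//.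
rewrite nuE [RHS]integral_mkcond; apply: eq_integral => z _.
rewrite /patch indicE; have -> : (z \in T @^-1` B) = (T z \in B) by apply/idP/idP; rewrite !inE.
by case: ifP; rewrite ?mul1r ?mul0r.
Qed.

Let transport_int (F : R -> R) : measurable_fun setT F ->
  \int[N01]_z (F (T z) * r z) = \int[N01]_z F z.
Proof.
move=> mF.
have [nu nuE] := exists_density N01 mr (fun z => ltW (r0 z)).
have mT' : measurable_fun setT (T : measurableTypeR R -> measurableTypeR R) by exact: mT.
have lawT : forall A, measurable A -> nu (T @^-1` A) = N01 A.
  move=> A mA; rewrite -transport_law// nuE integral_mkcond; apply: eq_integral => z _.
  rewrite /patch indicE; have -> : (z \in T @^-1` A) = (T z \in A) by apply/idP/idP; rewrite !inE.
  by case: ifP; rewrite ?mul1r ?mul0r.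
rewrite /Rintegral; congr fine.
rewrite -(@integral_law _ _ _ _ R nu N01 T mT' lawT (EFin \o F)); last exact/measurable_EFinP.
have mFT : measurable_fun setT (fun z => (F (T z))%:E).
  by apply/measurable_EFinP; exact: (measurableT_comp mF mT).
have h := @integral_density _ (measurableTypeR R) R N01 nu r mr (fun z => ltW (r0 z)) (fun A _ => nuE A) _ mFT.
etransitivity; last by symmetry; exact: h.
by apply: eq_integral => z _; rewrite EFinM.
Qed.

(* With m = r phi, AM-GM on the Monge-Ampere equation m = phi(T) T' gives 2 m <= m T' + phi(T),
   and the right-hand side is integrated by parts. *)
Lemma transport_cost (u : R) :
  (\int[N01]_z (((z - u - T z) ^+ 2 * r z)%:E) <=
   \int[N01]_z (((r' z - u * r z) ^+ 2 / r z)%:E))%E.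
Proof.
have tu : tame1 (fun=> u) by exact: tame_cst.
have tA : tame1 (fun z => (z - u - T z) ^+ 2 * r z).
  by apply: tameM => //; apply: tameX; apply: tameB => //; exact: tameB.
have tB : tame1 (fun z => (r' z - u * r z) ^+ 2 / r z).
  have tbr : tame1 (fun z => (b + `|u|) ^+ 2 * r z) by apply: tameM => //; exact: tame_cst.
  apply: (tame_bound _ tbr).
    apply: measurable_funM.
      by apply: measurable_funX; apply: measurable_funB => //; exact: measurable_funM.
    apply: continuous_measurable_fun => z; apply: cvgV; last exact: cr.
    by rewrite gt_eqF.
  move=> z; rewrite [leRHS]ger0_norm; last by rewrite mulr_ge0 ?sqr_ge0// ltW.
  rewrite ger0_norm; last by rewrite divr_ge0 ?sqr_ge0// ltW.
  rewrite ler_pdivrMr// -mulrA -expr2 -exprMn -ler_sqrt.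
    rewrite !sqrtr_sqr [leRHS]ger0_norm; last by rewrite mulr_ge0 ?addr_ge0// ltW.
    apply: le_trans (ler_normB _ _) _; rewrite mulrDl lerD//.
    by rewrite normrM (gtr0_norm (r0 z)).
  exact: sqr_ge0.
have tC : tame1 (fun z => (z - u - T z) * (r' z - u * r z)).
  apply: tameM; apply: tameB => //; [exact: tameB|exact: tameM].
(* Let A and B be the two sides and C the cross term. Since 2 C <= A + B, the bound A <= C gives A
   <= B. *)
suff AC : \int[N01]_z ((z - u - T z) ^+ 2 * r z) <= \int[N01]_z ((z - u - T z) * (r' z - u * r z)).
  have fA := integrable_fin_num measurableT (gauss1_integrable tA).
  have fB := integrable_fin_num measurableT (gauss1_integrable tB).
  rewrite -(fineK fA) -(fineK fB) lee_fin.
  have h : \int[N01]_z (2 * ((z - u - T z) * (r' z - u * r z))) <=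
     \int[N01]_z ((z - u - T z) ^+ 2 * r z + (r' z - u * r z) ^+ 2 / r z).
    apply: gauss1_int_le; [by apply: tameM => //; exact: tame_cst|exact: tameD|].
    move=> z; have rz : r z != 0 by rewrite gt_eqF.
    rewrite -subr_ge0 (_ : _ - _ = (((z - u - T z) * r z - (r' z - u * r z)) ^+ 2) / r z); last by field.
    by rewrite divr_ge0 ?sqr_ge0// ltW.
  move: h; rewrite gauss1_intD// gauss1_intZl//.
  move: AC; rewrite /Rintegral /=; lra.
rewrite -subr_le0 -gauss1_intB//.
(* A - C is split into five integrals. [X1] and [X4] vanish by Gaussian integration by parts for z r
   and r; [X2] and [X5] vanish because T carries r N(0,1) to N(0,1), of mean 0 and second moment 1;
   [X3] is the one bounded by [transport_ineq]. *)
pose X1 z := r z + z * r' z - z * (z * r z).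
pose X2 z := T z ^+ 2 * r z - r z.
pose X3 z := 2 * r z + (r' z * T z - 2 * (z * r z * T z)).
pose X4 z := r' z - z * r z.
pose X5 z := T z * r z.
have tX1 : tame1 X1.
  by apply: tameB => //; [apply: tameD => //|apply: tameM => //]; exact: tameM.
have tX2 : tame1 X2 by apply: tameB => //; apply: tameM => //; exact: tameX.
have tX4 : tame1 X4 by apply: tameB => //; exact: tameM.
have tX5 : tame1 X5 by exact: tameM.
have X1E : \int[N01]_z X1 z = 0.
  have d (z : R) : is_derive z 1 (fun z => z * r z) (r z + z * r' z).
    have dd := @is_deriveM R R^o id r z 1 _ _ (is_derive_id z 1) (dr z).
    by apply: (is_derive_ext dd) => //; rewrite /GRing.scale /=; ring.
  apply: (gauss1_ibp d).
  - move=> z; apply: cvgD; first exact: cr.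
    by apply: cvgM; [exact: cvg_id|exact: cr'].
  - exact: tameM.
  - by apply: tameD => //; exact: tameM.
have X4E : \int[N01]_z X4 z = 0 by exact: (gauss1_ibp dr).
have X5E : \int[N01]_z X5 z = 0.
  by rewrite (transport_int (F := fun z => z)) ?gauss1_mean//; exact: measurable_id.
have X2E : \int[N01]_z X2 z = 0.
  rewrite gauss1_intB//; last by apply: tameM => //; exact: tameX.
  rewrite (transport_int (F := fun z => z ^+ 2)); last exact: measurable_funX.
  by rewrite gauss1_var r1 subrr.
have -> : \int[N01]_z ((z - u - T z) ^+ 2 * r z - (z - u - T z) * (r' z - u * r z)) =
   \int[N01]_z ((X3 z + (u * X4 z)) + (u * X5 z + (X2 z - X1 z))).
  by apply: eq_Rintegral => z _; rewrite /X1 /X2 /X3 /X4 /X5; ring.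
have tuX4 : tame1 (fun z => u * X4 z) by exact: tameM.
have tuX5 : tame1 (fun z => u * X5 z) by exact: tameM.
have tX21 : tame1 (fun z => X2 z - X1 z) by exact: tameB.
rewrite gauss1_intD; [|exact: tameD|exact: tameD].
rewrite gauss1_intD// (gauss1_intD tuX5 tX21) (gauss1_intB tX2 tX1) !gauss1_intZl//.
by rewrite X4E X5E X2E X1E !mulr0 !(subrr, addr0); exact: transport_ineq.
Qed.

End transport1.

(** * Gaussian moments and resampling of coordinates *)

Section gaussian_resampling.
Context {R : realType} {n : nat}.
Local Notation V := 'rV[R]_n.
Local Notation N01 := (normal_prob (0:R) 1).
Variable gamma : probability V R.
Hypothesis hgamma : std_gaussian gamma.
Local Notation tameV := (tame (fun y : V => `|y|)).
Local Notation tame1 := (tame (fun z : R => `|z|)).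
Local Notation tameVV := (tame (sumh (fun y : V => `|y|) (fun y : V => `|y|))).
Local Notation tameV1 := (tame (sumh (fun y : V => `|y|) (fun z : R => `|z|))).

Let mh := @measurable_normv R n.
Let h0 (y : V) : 0 <= `|y| := normr_ge0 y.
Let hexp := gauss_exp hgamma.

Lemma gauss_integrable F : tameV F -> gamma.-integrable setT (EFin \o F).
Proof. exact: tame_integrable. Qed.

Lemma gauss_intD F G : tameV F -> tameV G ->
  \int[gamma]_y (F y + G y) = \int[gamma]_y F y + \int[gamma]_y G y.
Proof. exact: tame_intD. Qed.

Lemma gauss_intB F G : tameV F -> tameV G ->
  \int[gamma]_y (F y - G y) = \int[gamma]_y F y - \int[gamma]_y G y.
Proof. exact: tame_intB. Qed.

Lemma gauss_intZl c F : tameV F -> \int[gamma]_y (c * F y) = c * \int[gamma]_y F y.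
Proof. exact: tame_intZl. Qed.

Lemma gauss_intZr c F : tameV F -> \int[gamma]_y (F y * c) = (\int[gamma]_y F y) * c.
Proof. exact: tame_intZr. Qed.

Lemma gauss_int_le F G : tameV F -> tameV G -> (forall y, F y <= G y) ->
  \int[gamma]_y F y <= \int[gamma]_y G y.
Proof. exact: tame_int_le. Qed.

Lemma gauss_int_sum (I : Type) (r : seq I) (P : pred I) (F : I -> V -> R) :
  (forall i, tameV (F i)) ->
  \int[gamma]_y (\sum_(i <- r | P i) F i y) = \sum_(i <- r | P i) \int[gamma]_y F i y.
Proof. exact: tame_int_sum. Qed.

Lemma gauss_int_norm F : tameV F -> `|\int[gamma]_y F y| <= \int[gamma]_y `|F y|.
Proof. exact: tame_int_norm. Qed.

Lemma gauss_cst (c : R) : \int[gamma]_y c = c.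
Proof. by rewrite /Rintegral integral_cst//= probability_setT mule1. Qed.

Lemma gauss1_cst (c : R) : \int[N01]_y c = c.
Proof. by rewrite /Rintegral integral_cst//= probability_setT mule1. Qed.

Lemma tame_coord i : tameV (fun y => y ord0 i).
Proof. by apply: tame_id => //; [exact: measurable_coord|move=> y; exact: coord_le_normv]. Qed.

Lemma tame_dotv (g1 g2 : V -> V) : (forall i, tameV (fun y => g1 y ord0 i)) ->
  (forall i, tameV (fun y => g2 y ord0 i)) -> tameV (fun y => dotv (g1 y) (g2 y)).
Proof. by move=> t1 t2; apply: tame_sum => // i; exact: tameM. Qed.

Lemma tame_dotvl (a : V) : tameV (fun y => dotv a y).
Proof. by apply: tame_dotv => i; [exact: tame_cst|exact: tame_coord]. Qed.

Lemma tame_cstM c F : tameV F -> tameV (fun y => c * F y).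
Proof. by move=> tF; apply: tameM => //; exact: tame_cst. Qed.

Lemma tame1_cstM c F : tame1 F -> tame1 (fun y => c * F y).
Proof. by move=> tF; apply: tameM => //; exact: tame_cst. Qed.

Lemma tame_normV : tameV (fun y => `|y|).
Proof. by apply: tame_id => // y; rewrite normr_id. Qed.

(** Jensen's inequality through the tangent to the exponential at the mean of h, which gives the
    explicit lower bound e^m. *)
Lemma gauss_exp_gt0 h : tameV h -> tameV (fun y => expR (h y)) -> 0 < \int[gamma]_y expR (h y).
Proof.
move=> th te; pose m := \int[gamma]_y h y.
have t1 : tameV (fun y => h y - m) by apply: tameB => //; exact: tame_cst.
have t2 : tameV (fun y => expR m * (1 + (h y - m))).
  by apply: tame_cstM; apply: tameD => //; exact: tame_cst.
apply: lt_le_trans (gauss_int_le t2 te _).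
  rewrite gauss_intZl; last by apply: tameD => //; exact: tame_cst.
  rewrite gauss_intD//; last exact: tame_cst.
  rewrite gauss_intB//; last exact: tame_cst.
  by rewrite !gauss_cst -/m subrr addr0 mulr1 expR_gt0.
move=> y; rewrite [leRHS](_ : _ = expR m * expR (h y - m)); last by rewrite -expRD addrC subrK.
apply: ler_wpM2l; first exact: expR_ge0.
exact: expR_ge1Dx.
Qed.

Lemma tame_resample d2 (T2 : measurableType d2) (h2 : T2 -> R)
    (mh2 : measurable_fun setT h2) (h20 : forall x, 0 <= h2 x) (P2 : probability T2 R)
    (hexp2 : forall a, (\int[P2]_x (expR (a * h2 x))%:E < +oo)%E)
    (phi : V * T2 -> V) (F : V -> R) :
  (forall G : V -> \bar R, measurable_fun setT G ->
    \int[(gamma \x P2)%E]_p G (phi p) = \int[gamma]_y G y)%E ->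
  tame (sumh (fun y : V => `|y|) h2) (fun p => F (phi p)) -> tameV F ->
  \int[gamma]_y \int[P2]_z F (phi (y, z)) = \int[gamma]_y F y.
Proof.
move=> law tFp tF.
rewrite -(@tame_int_prod _ _ V T2 R _ h2 mh mh2 h20 gamma P2 hexp hexp2 _ tFp).
rewrite /Rintegral; congr fine; rewrite -(law (EFin \o F))//.
by apply/measurable_EFinP; case: tF.
Qed.

Lemma normv_mix S (y w : V) : `|mix S y w| <= `|y| + `|w|.
Proof.
apply/normv_leP; first exact: addr_ge0.
move=> i; rewrite mxE; case: ifP => _.
  by apply: le_trans (coord_le_normv y i) _; rewrite lerDl.
by apply: le_trans (coord_le_normv w i) _; rewrite lerDr.
Qed.

Lemma normv_upd (y : V) i z : `|upd y i z| <= `|y| + `|z|.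
Proof.
apply/normv_leP; first exact: addr_ge0.
move=> j; rewrite mxE; case: ifP => _; first by rewrite lerDr.
by apply: le_trans (coord_le_normv y j) _; rewrite lerDl.
Qed.

Lemma tame_mixF S F : tameV F -> tameVV (fun p => F (mix S p.1 p.2)).
Proof.
move=> tF; apply: (@tame_comp _ _ _ _ _ _ _ F (fun p => mix S p.1 p.2) 0 1 tF) => //.
- exact: measurable_mix.
- by move=> p; exact: sumh_ge0.
- by move=> p; rewrite add0r mul1r; exact: normv_mix.
Qed.

Lemma tame_updF i F : tameV F -> tameV1 (fun p => F (upd p.1 i p.2)).
Proof.
move=> tF; apply: (@tame_comp _ _ _ _ _ _ _ F (fun p => upd p.1 i p.2) 0 1 tF) => //.
- exact: measurable_upd.
- by move=> p; exact: sumh_ge0.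
- by move=> p; rewrite add0r mul1r; exact: normv_upd.
Qed.

Lemma measurable_scale2 (a b : R) : measurable_fun setT (fun p : V * V => a *: p.1 + b *: p.2 : V).
Proof.
apply/measurable_rowP => i; rewrite (_ : (fun _ => _) = (fun p : V * V => a * p.1 ord0 i + b * p.2 ord0 i)).
  apply: measurable_funD; apply: measurable_funM => //.
    exact: (measurableT_comp (measurable_coord i) measurable_fst).
  exact: (measurableT_comp (measurable_coord i) measurable_snd).
by apply/funext => p; rewrite !mxE.
Qed.

Lemma tame_affF (a b : R) F : tameV F -> tameVV (fun p : V * V => F (a *: p.1 + b *: p.2)).
Proof.
move=> tF; apply: (@tame_comp _ _ _ _ _ _ _ F (fun p : V * V => a *: p.1 + b *: p.2 : V) 0 (`|a| + `|b|) tF) => //.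
- exact: measurable_scale2.
- by move=> p; exact: sumh_ge0.
- move=> p; rewrite add0r; apply: le_trans (ler_normD _ _) _; rewrite !normrZ /sumh.
  by have := mulr_ge0 (normr_ge0 a) (h0 p.2); have := mulr_ge0 (normr_ge0 b) (h0 p.1); lra.
Qed.

Lemma tame_section_upd i y F : tameV F -> tame1 (fun z => F (upd y i z)).
Proof. by move=> tF; exact: (@tame_section _ _ _ _ _ _ (fun z : R => `|z|) (fun z : R => normr_ge0 z) _ (tame_updF i tF)). Qed.

Lemma tame_section_mix S y F : tameV F -> tameV (fun w => F (mix S y w)).
Proof. by move=> tF; exact: (tame_section h0 (tame_mixF S tF)). Qed.

Lemma tame_section_aff (a : R) x F : tameV F -> tameV (fun w => F (x + a *: w)).
Proof.
move=> tF; have := tame_section h0 (tame_affF 1 a tF) x.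
by rewrite /= scale1r.
Qed.

Lemma tame_gauss_upd i F : tameV F ->
  \int[gamma]_y \int[N01]_z F (upd y i z) = \int[gamma]_y F y.
Proof.
move=> tF.
have law (G : V -> \bar R) : measurable_fun setT G ->
  (\int[(gamma \x N01)%E]_p G (upd p.1 i p.2) = \int[gamma]_y G y)%E by move=> mG; exact: gauss_upd.
exact: (@tame_resample _ (measurableTypeR R) (fun z : R => `|z|) (@measurable_norm1 R)
  (fun z : R => normr_ge0 z) N01 (@gauss1_exp R) (fun p => upd p.1 i p.2) F law (tame_updF i tF) tF).
Qed.

Lemma tame_gauss_rotation (a b : R) F : 0 < b -> a ^+ 2 + b ^+ 2 = 1 -> tameV F ->
  \int[gamma]_x \int[gamma]_y F (a *: x + b *: y) = \int[gamma]_y F y.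
Proof.
move=> b0 ab tF.
have mphi : measurable_fun setT (fun p : V * V => a *: p.1 + b *: p.2 : V).
  by apply: measurable_scale2.
apply: (@tame_resample _ _ _ mh h0 gamma hexp (fun p : V * V => a *: p.1 + b *: p.2 : V)) => //; last exact: tame_affF.
move=> G mG.
apply: (@integral_law _ _ _ _ R (gamma \x gamma)%E gamma (fun p : V * V => a *: p.1 + b *: p.2 : V)) => //.
move=> A mA.
have mA1 : measurable_fun setT (fun y : V => (\1_A y)%:E : \bar R).
  by apply/measurable_EFinP; exact: measurable_indic.
have := gauss_rotation hgamma b0 ab mA1 (fun y => _).
rewrite integral_indic// setIT => <-; last by move=> y; rewrite lee_fin.
rewrite -(@fubini_tonelli1 _ _ _ _ _ gamma gamma (fun p : V * V => (\1_A (a *: p.1 + b *: p.2))%:E)) //=.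
- pose B : set (V * V) := (fun p : V * V => a *: p.1 + b *: p.2) @^-1` A.
  have mB : measurable B by rewrite -[X in measurable X]setTI; exact: mphi.
  have := @integral_indic _ _ R (gamma \x gamma)%E setT measurableT B mB.
  rewrite setIT => <-; apply: eq_integral => p _; rewrite /B !indicE.
  by have -> : (p \in (fun p : V * V => a *: p.1 + b *: p.2) @^-1` A) = (a *: p.1 + b *: p.2 \in A) by apply/idP/idP; rewrite !inE.
- exact: (measurableT_comp mA1 mphi).
Qed.

Lemma gauss_mean i : \int[gamma]_y (y ord0 i) = 0.
Proof.
rewrite -(tame_gauss_upd i (tame_coord i)).
under eq_Rintegral => y _ do under eq_Rintegral => z _ do rewrite mxE eqxx.
by rewrite gauss1_mean gauss_cst.
Qed.

Lemma gauss_cov i j : \int[gamma]_y (y ord0 i * y ord0 j) = (i == j)%:R.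
Proof.
rewrite -(tame_gauss_upd i); last by apply: tameM => //; exact: tame_coord.
under eq_Rintegral => y _ do under eq_Rintegral => z _ do rewrite !mxE eqxx (eq_sym j).
have [ij|ij] := eqVneq i j.
  under eq_Rintegral => y _ do under eq_Rintegral => z _ do rewrite -expr2.
  by rewrite gauss1_var gauss_cst.
under eq_Rintegral => y _.
  under eq_Rintegral => z _ do rewrite mulrC.
  rewrite gauss1_intZl; last exact: tame1_id.
  rewrite gauss1_mean mulr0.
  over.
by rewrite gauss_cst.
Qed.

Lemma gauss_mean_dotv a : \int[gamma]_y dotv a y = 0.
Proof.
rewrite /dotv gauss_int_sum; last by move=> i; apply: tame_cstM; exact: tame_coord.
apply: big1 => i _; rewrite gauss_intZl; last exact: tame_coord.
by rewrite gauss_mean mulr0.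
Qed.

Lemma gauss_quadratic (A : 'I_n -> 'I_n -> R) :
  \int[gamma]_y (\sum_(i < n) \sum_(j < n) A i j * (y ord0 i * y ord0 j)) = \sum_(i < n) A i i.
Proof.
have tij i j : tameV (fun y => y ord0 i * y ord0 j) by apply: tameM => //; exact: tame_coord.
rewrite gauss_int_sum; last first.
  by move=> i; apply: tame_sum => // j; exact: tame_cstM.
apply: eq_bigr => i _; rewrite gauss_int_sum; last by move=> j; exact: tame_cstM.
rewrite (bigD1 i)//= gauss_intZl// gauss_cov eqxx mulr1 big1 ?addr0// => j ji.
by rewrite gauss_intZl// gauss_cov eq_sym (negbTE ji) mulr0.
Qed.

Lemma gauss_dotv2 a : \int[gamma]_y (dotv a y ^+ 2) = dotv a a.
Proof.
have := gauss_quadratic (fun i j => a ord0 i * a ord0 j).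
rewrite /= -/(dotv a a) => <-; apply: eq_Rintegral => y _.
rewrite expr2 /dotv mulr_suml; apply: eq_bigr => i _; rewrite mulr_sumr; apply: eq_bigr => j _.
by ring.
Qed.

Lemma gauss_sqnorm : \int[gamma]_y dotv y y = n%:R.
Proof.
rewrite /dotv gauss_int_sum; last by move=> i; apply: tameM => //; exact: tame_coord.
by rewrite (eq_bigr (fun=> 1)) => [|i _]; rewrite ?gauss_cov ?eqxx// sumr_const card_ord.
Qed.

End gaussian_resampling.

(** * Taylor expansion of order two and gradients along lines *)

Lemma taylor2 {R : realType} (p p' : R -> R) (a : R) :
  (forall t : R, is_derive t 1 p (p' t)) -> is_derive (0 : R) 1 p' a ->
  forall e, 0 < e -> exists2 d, 0 < d &
    forall t, `|t| <= d -> `|p t - p 0 - t * p' 0 - a / 2 * t ^+ 2| <= e * t ^+ 2.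
Proof.
move=> dp dp' e e0.
have [d d0 hd] : exists2 d, 0 < d & forall t, `|t| <= d -> `|p' t - p' 0 - a * t| <= e * `|t|.
  have [ex ea] := dp'.
  have : (fun h => h^-1 *: ((p' \o shift 0) (h *: 1) - p' 0)) @ 0^' --> a.
    by rewrite -ea.
  move=> /cvgrPdist_le /(_ e e0) [d /= d0 hd].
  exists (d / 2); first by rewrite divr_gt0.
  move=> t td; have [->|t0] := eqVneq t 0; first by rewrite subrr mulr0 subr0 normr0 mulr0.
  have /hd : ball 0 d t.
    rewrite /ball /= sub0r normrN; apply: le_lt_trans td _.
    by rewrite ltr_pdivrMr// mulr_natr mulr2n ltrDl.
  move=> /(_ t0); rewrite /= /shift /= addr0 /GRing.scale /= mulr1 => h.
  rewrite -(ler_pM2l (x := `|t^-1|)) ?normr_gt0 ?invr_eq0//.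
  rewrite -normrM mulrCA -normrM mulVf// normr1 mulr1 mulrBr mulrCA mulVf// mulr1.
  by rewrite distrC.
exists d => // t td.
(* [p'] is known to be differentiable only at 0, so the remainder is estimated by the mean value
   theorem: its derivative is p' s - p' 0 - a s, which is o(s). *)
pose q s := p s - p 0 - s * p' 0 - a / 2 * s ^+ 2.
have dq (s : R) : is_derive s 1 q (p' s - p' 0 - a * s).
  have d1 : is_derive s 1 (fun s => p s - s * p' 0) (p' s - p' 0).
    have -> : p' s - p' 0 = p' s - (s * 0 + p' 0 * 1) by rewrite mulr0 add0r mulr1.
    exact: (@is_deriveB R R^o R^o _ _ s 1 _ _ (dp s) (@is_deriveM R R^o id (fun=> p' 0) s 1 _ _ (is_derive_id s 1) (is_derive_cst _ _ _))).
  have d2 : is_derive s 1 (fun s => a / 2 * s ^+ 2 + p 0) (a * s).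
    have -> : a * s = (a / 2) *: (s *: 1 + s *: 1) + 0 by rewrite /GRing.scale /=; field.
    have := @is_deriveD R R^o R^o _ _ s 1 _ _ (@is_deriveZ R R^o R^o _ (a / 2) s 1 _ (@is_deriveM R R^o id id s 1 _ _ (is_derive_id s 1) (is_derive_id s 1))) (is_derive_cst (p 0) s 1).
    by move=> h; apply: (is_derive_ext h) => // y; rewrite /= expr2.
  have := @is_deriveB R R^o R^o _ _ s 1 _ _ d1 d2.
  move=> h; apply: (is_derive_ext h) => // y; rewrite /q.
  transitivity (p y - y * p' 0 - (a / 2 * y ^+ 2 + p 0)) ; first by [].
  by ring.
have q0 : q 0 = 0 by rewrite /q; ring.
have cq : continuous q by exact: is_derive_continuous dq.
rewrite -/(q t).
have mvt (u v : R) : u < v -> exists2 c, u < c < v & q v - q u = (p' c - p' 0 - a * c) * (v - u).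
  move=> uv; have [c] := MVT uv (fun x _ => dq x) (continuous_subspaceT cq).
  by rewrite in_itv /= => ?; exists c.
have bnd (c : R) : `|c| <= `|t| -> `|(p' c - p' 0 - a * c) * t| <= e * t ^+ 2.
  move=> ct; rewrite normrM -(real_normK (num_real t)) expr2 mulrA ler_wpM2r//.
  apply: (le_trans (hd c _)); first exact: le_trans td.
  by rewrite ler_wpM2l// ltW.
case: (ltgtP t 0) => t0.
- have [c /andP[tc c0] E] := mvt _ _ t0.
  move: E; rewrite q0 !sub0r mulrN => /oppr_inj ->; apply: bnd.
  by rewrite !ltr0_norm// lerN2 ltW.
- have [c /andP[c0 ct] E] := mvt _ _ t0.
  move: E; rewrite q0 !subr0 => ->; apply: bnd.
  by rewrite !gtr0_norm// ltW.
- by rewrite t0 q0 normr0 expr2 !mulr0.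
Qed.

Lemma cvg_linear {R : realType} (W : normedModType R) (l : W -> R) (T : Type) (F : set_system T) (FF : Filter F) (G : T -> W) a :
  continuous l -> G @ F --> a -> (l \o G) @ F --> l a.
Proof. by move=> cl cG; apply: (cvg_comp G l cG); exact: cl. Qed.

Lemma is_derive_linear {R : realType} (U W : normedModType R) (l : W -> R) (G : U -> W) (x v : U) (a : W) :
  continuous l -> (forall (c : R) u w, l (c *: (u - w)) = c *: (l u - l w)) ->
  is_derive x v G a -> is_derive x v (fun y => l (G y)) (l a).
Proof.
move=> cl ll [dG aE].
have E : (fun h => h^-1 *: (((fun y => l (G y)) \o shift x) (h *: v) - l (G x))) =
    l \o (fun h => h^-1 *: ((G \o shift x) (h *: v) - G x)).
  by apply/funext => h; rewrite /= ll.
have c : (fun h => h^-1 *: (((fun y => l (G y)) \o shift x) (h *: v) - l (G x))) @ 0^' --> l a.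
  by rewrite E; apply: (@cvg_linear _ _ _ _ _ _ _ a cl); rewrite -aE; exact: dG.
by split; [apply/cvg_ex; exists (l a)|exact/cvg_lim].
Qed.

Lemma continuous_sumr {R : realType} (W : topologicalType) (I : Type) (r : seq I) (F : I -> W -> R) :
  (forall i, continuous (F i)) -> continuous (fun y => \sum_(i <- r) F i y).
Proof.
move=> cF; elim: r => [|i r ih].
  by under eq_fun do rewrite big_nil; move=> y; exact: cvg_cst.
under eq_fun do rewrite big_cons.
by move=> y; apply: cvgD; [exact: cF|exact: ih].
Qed.

Section line.
Context {R : realType} {n : nat}.
Local Notation V := 'rV[R]_n.

Lemma is_derive_line (W : normedModType R) (f : V -> W) (x v : V) (t : R) :
  differentiable f (x + t *: v) ->
  is_derive t 1 (fun s : R => f (x + s *: v)) ('d f (x + t *: v) v).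
Proof.
move=> df; rewrite -deriveE//.
have E : (fun h => h^-1 *: (((fun s : R => f (x + s *: v)) \o shift t) (h *: 1) - f (x + t *: v))) =
   (fun h => h^-1 *: ((f \o shift (x + t *: v)) (h *: v) - f (x + t *: v))).
  apply/funext => h; rewrite /= /shift /=; congr (_ *: (f _ - _)).
  by rewrite scalerDl addrCA /GRing.scale /= mulr1.
split; rewrite /derivable /derive E //.
exact: diff_derivable df.
Qed.

Lemma row_sum_evec (v : V) : v = \sum_(i < n) v ord0 i *: evec i.
Proof.
apply/rowP => j; rewrite summxE (bigD1 j)//= !mxE eqxx mulr1 big1 ?addr0// => i ij.
by rewrite !mxE eq_sym (negbTE ij) mulr0.
Qed.

Lemma diff_dotv (f : V -> R) (y v : V) : differentiable f y -> 'd f y v = dotv (grad f y) v.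
Proof.
move=> df; rewrite [in LHS](row_sum_evec v) linear_sum; apply: eq_bigr => i _.
by rewrite linearZ /= mxE /partial deriveE// mulrC.
Qed.

Lemma continuous_coord (i : 'I_n) : continuous (fun y : V => y ord0 i).
Proof. by move=> y; exact: coord_continuous. Qed.

Lemma continuous_dotvl (a : V) : continuous (fun y : V => dotv y a).
Proof.
move=> y; apply: (@continuous_sumr _ _ _ _ (fun i (y : V) => y ord0 i * a ord0 i)) => i {}y.
have ci := @continuous_coord i y.
by have h := cvgM ci (cvg_cst (a ord0 i)); exact: h.
Qed.

Lemma continuous_dotvv : continuous (fun y : V => dotv y y).
Proof.
move=> y; apply: (@continuous_sumr _ _ _ _ (fun i (y : V) => y ord0 i * y ord0 i)) => i {}y.
have ci := @continuous_coord i y.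
by have h := cvgM ci ci; exact: h.
Qed.

Lemma dotv_shift (a : V) (c : R) (u w : V) : dotv (c *: (u - w)) a = c *: (dotv u a - dotv w a).
Proof. by rewrite !dotvE. Qed.

Lemma is_derive_dotv_line (G : V -> V) (x v a : V) (t : R) : differentiable G (x + t *: v) ->
  is_derive t 1 (fun s : R => dotv (G (x + s *: v)) a) (dotv ('d G (x + t *: v) v) a).
Proof.
move=> dG; apply: (@is_derive_linear _ _ _ (fun w : V => dotv w a)).
- exact: continuous_dotvl.
- by move=> *; exact: dotv_shift.
- exact: is_derive_line.
Qed.

(** Derivatives along lines and a continuous gradient. This is stable under adding linear functions,
    as tilting requires, and it is all that the energy, transport and selection steps ask of the
    regularity of the potential. *)
Definition has_gradient (f : V -> R) (g : V -> V) := continuous g /\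
  forall x v (t : R), is_derive t 1 (fun s : R => f (x + s *: v)) (dotv (g (x + t *: v)) v).

Lemma twice_differentiable_gradient f : twice_differentiable f -> has_gradient f (grad f).
Proof.
move=> [df dg]; split; first by move=> x; exact: differentiable_continuous.
by move=> x v t; rewrite -diff_dotv//; exact: is_derive_line.
Qed.

Lemma laplacianE (f : V -> R) x : twice_differentiable f ->
  laplacian f x = \sum_(i < n) ('d (grad f) x (evec i)) ord0 i.
Proof.
move=> [df dg]; apply: eq_bigr => i _.
rewrite {1}/partial (_ : partial i f = fun y => grad f y ord0 i); last by apply/funext => y; rewrite mxE.
have := @is_derive_linear _ V V (fun w : V => w ord0 i) (grad f) x (evec i) ('d (grad f) x (evec i)).
case => //.
- by move=> w; exact: coord_continuous.
- by move=> c u w; rewrite !mxE.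
- by split; [exact: diff_derivable|rewrite deriveE].
Qed.

Lemma gradient_mvt f g (x v : V) : has_gradient f g ->
  exists2 t : R, 0 < t < 1 & f (x + v) - f x = dotv (g (x + t *: v)) v.
Proof.
move=> [cg dg]; have dl (t : R) := dg x v t.
have cl : continuous (fun s : R => f (x + s *: v)) by exact: is_derive_continuous dl.
have [t] := MVT (@ltr01 R) (fun t _ => dl t) (continuous_subspaceT cl).
rewrite in_itv /= => t01; rewrite scale1r scale0r addr0 subr0 mulr1 => E.
by exists t.
Qed.

Lemma gradient_lipschitz f g M : has_gradient f g -> (forall y, `|g y| <= M) ->
  forall x y, `|f x - f y| <= n%:R * (M * `|x - y|).
Proof.
move=> hg gM x y; have [t _] := gradient_mvt y (x - y) hg.
rewrite subrKC => ->; apply: le_trans (normv_sum _ _) _.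
by rewrite ler_wpM2l// ler_wpM2r.
Qed.

End line.

Lemma lipschitz_cont {R : realType} (W : normedModType R) (f : W -> R) (C : R) :
  (forall x y, `|f x - f y| <= C * `|x - y|) -> continuous f.
Proof.
move=> fC x; apply/cvgrPdist_le => e e0.
have C1 : 0 < `|C| + 1 by rewrite ltr_wpDl.
have eC : 0 < e / (`|C| + 1) by exact: divr_gt0.
have /cvgrPdist_le /(_ _ eC) : id @ x --> x by exact: cvg_id.
apply: filterS => y /= xy; apply: le_trans (fC x y) _.
apply: (@le_trans _ _ ((`|C| + 1) * `|x - y|)).
  by rewrite ler_wpM2r//; have := ler_norm C; lra.
by rewrite mulrC -ler_pdivlMr.
Qed.

(** Differentiability at x gives the bound near x, boundedness of G gives it far away. The result is
    the dominating function for the second-order expansion at x, where no bound on a second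
    derivative nearby is at hand. *)
Lemma differentiable_bounded_rate {R : realType} (U W : normedModType R) (G : U -> W) (x : U) (M : R) :
  differentiable G x -> (forall y, `|G y| <= M) ->
  exists2 C, 0 <= C & forall h, `|G (x + h) - G x| <= C * `|h|.
Proof.
move=> dG GM.
have /eqO_exP[k k0 hk] : ('d G x : U -> W) =O_ 0 id by apply: linear_eqO; exact: diff_continuous.
have /eqaddoP /(_ 1 ltr01) ho := diff_locally dG.
have : \forall h \near (0 : U), `|G (x + h) - G x| <= (1 + k) * `|h|.
  near=> h.
  have h1 : `|(G \o shift x - (cst (G x) + 'd G x)) h| <= 1 * `|h| by near: h.
  have h2 : `|'d G x h| <= k * `|h| by near: h.
  have -> : G (x + h) - G x = (G \o shift x - (cst (G x) + 'd G x)) h + 'd G x h.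
    rewrite /= !fctE /= (addrC h); rewrite opprD addrA subrK //.
  by apply: le_trans (ler_normD _ _) _; rewrite mulrDl lerD.
move=> /nbhs_ballP[d /= d0 hd].
exists (1 + k + 2 * `|M| / d).
  by rewrite !addr_ge0 ?(ltW k0)// divr_ge0 ?mulr_ge0// ltW.
move=> h; have [hsmall|hbig] := ltP `|h| d.
  have /hd : ball 0 d h by rewrite -ball_normE /= sub0r normrN.
  by move=> h1; apply: le_trans h1 _; rewrite ler_wpM2r// lerDl divr_ge0 ?mulr_ge0// ltW.
apply: (@le_trans _ _ (2 * `|M|)).
  apply: le_trans (ler_normB _ _) _; rewrite mulr_natl mulr2n.
  by apply: lerD; apply: le_trans (GM _) (ler_norm _).
apply: (@le_trans _ _ (2 * `|M| / d * `|h|)).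
  by rewrite mulrAC ler_pdivlMr// ler_wpM2l// mulr_ge0.
by rewrite ler_wpM2r// lerDr addr_ge0// ltW.
Unshelve. all: by end_near.
Qed.

(** * The heat lower bound *)

Section heat.
Context {R : realType} {n : nat}.
Local Notation V := 'rV[R]_n.
Variable gamma : probability V R.
Hypothesis hgamma : std_gaussian gamma.
Local Notation tameV := (tame (fun y : V => `|y|)).
Variables (f : V -> R) (M : R).
Hypothesis hf : twice_differentiable f.
Hypothesis gM : forall y, `|grad f y| <= M.

Let hg : has_gradient f (grad f) := twice_differentiable_gradient hf.
Let M0 : 0 <= M. Proof. exact: le_trans (normr_ge0 _) (gM 0). Qed.
Let c := n%:R * M.
Let c0 : 0 <= c. Proof. exact: mulr_ge0. Qed.
Let lip x y : `|f x - f y| <= c * `|x - y|.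
Proof. by rewrite /c -mulrA; exact: (gradient_lipschitz hg gM). Qed.
Let cf : continuous f := lipschitz_cont lip.

Lemma tame_lipschitz (h : V -> R) (C : R) : (forall x y, `|h x - h y| <= C * `|x - y|) -> tameV h.
Proof.
move=> hC; have ch := lipschitz_cont hC.
have th : tameV (fun y => `|h 0| + `|C| * `|y|).
  by apply: tameD => //; [exact: tame_cst|apply: tame_cstM; exact: tame_normV].
apply: (tame_bound (continuous_measurable_rV ch) th) => y.
rewrite [leRHS]ger0_norm ?addr_ge0//.
rewrite -[h y](subrK (h 0)); apply: le_trans (ler_normD _ _) _; rewrite addrC lerD2l.
apply: le_trans (hC _ _) _; rewrite subr0 ler_wpM2r// ler_norm//.
Qed.

Let tf : tameV f := tame_lipschitz lip.

(** The heat extension of f. It is parametrised by the standard deviation rather than the variance,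
    which makes it jointly Lipschitz in both variables, down to s = 0. *)
Let K (p : R * V) := \int[gamma]_y f (p.2 + p.1 *: y).

Let tfK p : tameV (fun y => f (p.2 + p.1 *: y)).
Proof. exact: tame_section_aff. Qed.

Let A := \int[gamma]_y `|y|.
Let A0 : 0 <= A. Proof. by apply: Rintegral_ge0. Qed.

Let K_lip p q : `|K p - K q| <= c * (1 + A) * `|p - q|.
Proof.
have tA : tameV (fun y => c * (`|p - q| + `|p - q| * `|y|)).
  by apply: tame_cstM; apply: tameD => //; [exact: tame_cst|apply: tame_cstM; exact: tame_normV].
rewrite /K -(gauss_intB hgamma)//; apply: le_trans (gauss_int_norm hgamma _) _.
  exact: tameB.
apply: (@le_trans _ _ (\int[gamma]_y (c * (`|p - q| + `|p - q| * `|y|)))).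
  apply: (gauss_int_le hgamma) => //; first by apply: tame_norm; exact: tameB.
  move=> y; apply: le_trans (lip _ _) _; rewrite ler_wpM2l//.
  rewrite opprD addrACA -scalerBl; apply: le_trans (ler_normD _ _) _.
  rewrite normrZ; apply: lerD; first by rewrite [leRHS]prod_normE /= le_max lexx orbT.
  by rewrite ler_wpM2r// [leRHS]prod_normE /= le_max lexx.
rewrite (gauss_intZl hgamma)//; last by apply: tameD => //; [exact: tame_cst|apply: tame_cstM; exact: tame_normV].
rewrite (gauss_intD hgamma)//; [|exact: tame_cst|apply: tame_cstM; exact: tame_normV].
rewrite gauss_cst (gauss_intZl hgamma); last exact: tame_normV.
by rewrite -/A -[leRHS]mulrA ler_wpM2l// mulrDl mul1r mulrC.
Qed.

Let cK : continuous K := lipschitz_cont K_lip.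

Let K0 x : K (0, x) = f x.
Proof. by rewrite /K; under eq_Rintegral do rewrite scale0r addr0; rewrite gauss_cst. Qed.

Let K_semigroup (s t u : R) x : 0 < t -> 0 <= u -> s ^+ 2 + t ^+ 2 = u ^+ 2 ->
  \int[gamma]_y K (t, x + s *: y) = K (u, x).
Proof.
move=> t0 u0 stu.
have u1 : 0 < u.
  rewrite lt_def u0 andbT; apply/eqP => uE; move: stu; rewrite uE expr0n/= => /eqP.
  by rewrite paddr_eq0 ?sqr_ge0// !sqrf_eq0 (gt_eqF t0) andbF.
have un : u != 0 by rewrite gt_eqF.
have ab : (s / u) ^+ 2 + (t / u) ^+ 2 = 1.
  by rewrite !expr_div_n -mulrDl stu mulfV// expf_neq0.
have tu : 0 < t / u by rewrite divr_gt0.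
rewrite -[K (u, x)](tame_gauss_rotation hgamma tu ab (tfK (u, x))).
apply: eq_Rintegral => y _; apply: eq_Rintegral => z _ /=.
by rewrite scalerDr !scalerA !(mulrC u) !divfK// addrA.
Qed.

(** The linear term of the expansion of f at x has mean zero. The quadratic term is half the form
    given by the derivative of [grad f] at x, and its Gaussian mean is half the trace;
    [differentiable_bounded_rate] provides the domination. *)
Let rem_cvg x (s_ : nat -> R) : (forall k, 0 < s_ k) -> s_ @ \oo --> 0 ->
  (K (s_ k, x) - f x) / s_ k ^+ 2 @[k --> \oo] --> laplacian f x / 2.
Proof.
move=> s0 s_cvg.
have [C C0 hC] := differentiable_bounded_rate (hf.2 x) gM.
pose F k (y : V) := (f (x + s_ k *: y) - f x - s_ k * dotv (grad f x) y) / s_ k ^+ 2.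
have tF k : tameV (F k).
  apply: tameM => //; last exact: tame_cst.
  apply: tameB => //; last by apply: tame_cstM; exact: tame_dotvl.
  by apply: tameB => //; [exact: (tfK (s_ k, x))|exact: tame_cst].
have intF k : \int[gamma]_y F k y = (K (s_ k, x) - f x) / s_ k ^+ 2.
  rewrite /F gauss_intZr//; last first.
    apply: tameB => //; last by apply: tame_cstM; exact: tame_dotvl.
    by apply: tameB => //; [exact: (tfK (s_ k, x))|exact: tame_cst].
  rewrite gauss_intB//; last 2 first.
    by apply: tameB => //; [exact: (tfK (s_ k, x))|exact: tame_cst].
    by apply: tame_cstM; exact: tame_dotvl.
  rewrite (gauss_intB hgamma); [|exact: (tfK (s_ k, x))|exact: tame_cst].
  rewrite gauss_cst (gauss_intZl hgamma); last exact: tame_dotvl.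
  by rewrite (gauss_mean_dotv hgamma) mulr0 subr0.
rewrite -(_ : (fun k => \int[gamma]_y F k y) = (fun k => (K (s_ k, x) - f x) / s_ k ^+ 2)); last by apply/funext => k; rewrite intF.
have -> : laplacian f x / 2 = \int[gamma]_y (dotv ('d (grad f) x y) y / 2).
  rewrite laplacianE// -(gauss_quadratic hgamma (fun i j => ('d (grad f) x (evec i)) ord0 j)) -(gauss_intZr hgamma); last first.
    apply: tame_sum => // i; apply: tame_sum => // j; apply: tame_cstM.
    by apply: tameM => //; exact: tame_coord.
  apply: eq_Rintegral => y _; congr (_ / 2).
  have -> : 'd (grad f) x y = \sum_(i < n) y ord0 i *: 'd (grad f) x (evec i).
    by rewrite {1}(row_sum_evec y) linear_sum; apply: eq_bigr => i _; rewrite linearZ.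
  rewrite /dotv exchange_big /=; apply: eq_bigr => j _.
  rewrite summxE mulr_suml; apply: eq_bigr => i _.
  by rewrite mxE; ring.
apply: (@Rintegral_cvg_dominated _ V R gamma F (fun y => dotv ('d (grad f) x y) y / 2) (fun y => n%:R * (C * `|y| * `|y|))).
- by move=> k; case: (tF k).
- move=> y; have dp (t : R) := hg.2 x y t.
  have dp' : is_derive (0 : R) 1 (fun t => dotv (grad f (x + t *: y)) y) (dotv ('d (grad f) x y) y).
    have := @is_derive_dotv_line R n (grad f) x y y 0.
    by rewrite scale0r addr0; apply; exact: hf.2.
  apply/cvgrPdist_le => e e0; have [d d0 hd] := taylor2 dp dp' e0.
  have /cvgrPdist_le /(_ d d0) : s_ @ \oo --> 0 by [].
  apply: filterS => k; rewrite sub0r normrN => /hd.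
  rewrite scale0r addr0 => h; rewrite distrC.
  have sk : 0 < s_ k ^+ 2 by rewrite exprn_gt0.
  rewrite -(ler_pM2r sk) -[X in _ * X <= _](gtr0_norm sk) -normrM.
  rewrite (_ : _ * s_ k ^+ 2 = f (x + s_ k *: y) - f x - s_ k * dotv (grad f x) y - dotv ('d (grad f) x y) y / 2 * s_ k ^+ 2) //.
  by rewrite /F; field; rewrite gt_eqF.
- apply: (gauss_integrable hgamma); apply: tame_cstM; apply: tameM => //; last exact: tame_normV.
  by apply: tame_cstM; exact: tame_normV.
- move=> k y; rewrite /F normrM normfV [X in _ / X]gtr0_norm ?exprn_gt0// ler_pdivrMr ?exprn_gt0//.
  have [t /andP[t0 t1]] := gradient_mvt x (s_ k *: y) hg => ->.
  rewrite dotvZr -mulrBr -dotvNl -dotvDl.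
  rewrite normrM (gtr0_norm (s0 k)).
  apply: (@le_trans _ _ (s_ k * (n%:R * (C * (s_ k * `|y|) * `|y|)))); last first.
    by rewrite le_eqVlt; apply/orP; left; apply/eqP; ring.
  rewrite ler_wpM2l ?(ltW (s0 k))//; apply: le_trans (normv_sum _ _) _.
  rewrite ler_wpM2l// ler_wpM2r//; apply: le_trans (hC _) _.
  rewrite ler_wpM2l// !normrZ (gtr0_norm t0) (gtr0_norm (s0 k)).
  by rewrite ler_piMl ?mulr_ge0 ?(ltW (s0 k))// ltW.
Qed.

Variable L : R.
Hypothesis fL : forall y, - L <= laplacian f y.

(* A maximum principle: at a positive maximum (s, x) of the deficit, penalized by |x|^2, splitting
   off a small part of the Gaussian increment contradicts the Taylor expansion of f at x. *)
Lemma heat_lower x (s : R) : 0 <= s -> f x - L / 2 * s ^+ 2 <= \int[gamma]_y f (x + s *: y).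
Proof.
move=> s0; rewrite -[X in _ <= X]/(K (s, x)) leNgt; apply/negP => hlt.
have sp : 0 < s.
  rewrite lt_def s0 andbT; apply/eqP => sE; move: hlt.
  by rewrite sE K0 expr0n/= mulr0 subr0 ltxx.
pose Q (y : V) := dotv y y.
have Q0 y : 0 <= Q y by exact: dotvv_ge0.
(* The deficit is cut into three parts: one pays for the extra curvature eps s^2, one for the
   penalty delta Q(x), and one remains as the positive value of G at (s, x). *)
pose eta := (f x - L / 2 * s ^+ 2 - K (s, x)) / 3.
have eta0 : 0 < eta by rewrite divr_gt0// subr_gt0.
pose eps := eta / s ^+ 2.
have s2 : 0 < s ^+ 2 by rewrite exprn_gt0.
have den0 : 0 < 1 + Q x + n%:R * s ^+ 2 by rewrite -addrA ltr_pwDl// addr_ge0// mulr_ge0// ltW.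
(* The term n s^2 of the denominator makes delta n < eps, so that the Laplacian of the penalty
   cannot outweigh the extra curvature. *)
pose delta := eta / (1 + Q x + n%:R * s ^+ 2).
have delta0 : 0 < delta by rewrite divr_gt0.
have dQ : delta * Q x <= eta.
  rewrite /delta mulrAC ler_pdivrMr// ler_wpM2l ?(ltW eta0)//.
  by rewrite addrAC lerDr addr_ge0// mulr_ge0// ltW.
have dn : delta * n%:R < eps.
  rewrite /delta /eps -mulrA ltr_pM2l// ltr_pdivrMl// ltr_pdivlMr//.
  by rewrite ltrDr ltr_pwDl.
pose a := L / 2 + eps.
pose G (p : R * V) := f p.2 - a * p.1 ^+ 2 - K p - delta * Q p.2.
have cG : continuous G.
  have c2 : continuous (fun p : R * V => f p.2) by move=> p; apply: (cvg_comp snd f); [exact: cvg_snd|exact: cf].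
  have cQ : continuous (fun p : R * V => Q p.2) by move=> p; apply: (cvg_comp snd Q); [exact: cvg_snd|exact: continuous_dotvv].
  have c1 : continuous (fun p : R * V => p.1 * p.1) by move=> p; apply: cvgM; exact: cvg_fst.
  move=> p; apply: cvgB; last by apply: cvgM; [exact: cvg_cst|exact: cQ].
  apply: cvgB; last exact: cK.
  by apply: cvgB; [exact: c2|apply: cvgM; [exact: cvg_cst|exact: c1]].
have Gsx : eta <= G (s, x).
  rewrite /G /= /a mulrDl /eps divfK ?gt_eqF//.
  have : f x - L / 2 * s ^+ 2 - K (s, x) = eta * 3 by rewrite /eta divfK.
  by move: dQ; lra.
pose k0 := c * (1 + A) * s + `|a| * s ^+ 2.
have k00 : 0 <= k0 by rewrite addr_ge0// !mulr_ge0// ?addr_ge0// ltW.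
have G_le (p : R * V) : 0 <= p.1 <= s -> G p <= k0 - delta * Q p.2.
  move=> /andP[p0 ps]; rewrite /G lerD2r.
  have h1 : f p.2 - K p <= c * (1 + A) * s.
    apply: le_trans (ler_norm _) _; rewrite -(K0 p.2); apply: le_trans (K_lip _ _) _.
    rewrite ler_wpM2l ?mulr_ge0 ?addr_ge0//.
    case: p p0 ps => p1 p2 /= p0 ps.
    by rewrite prod_normE /= subrr normr0 sub0r normrN ge_max ger0_norm// ps s0.
  have h2 : - (a * p.1 ^+ 2) <= `|a| * s ^+ 2.
    apply: le_trans (ler_norm _) _; rewrite normrN normrM ler_wpM2l// normrX (ger0_norm p0).
    by rewrite ler_pXn2r// nnegrE.
  by move: h1 h2; rewrite /k0; lra.
(* Outside the box of half-side B the penalty exceeds the bound k0 on the other terms, so the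
   maximum over the strip lies in a compact set. The 1 lets a coordinate beyond B be bounded by its
   square, and [|x|] keeps (s, x) inside. *)
pose B := k0 / delta + 1 + `|x|.
have B1 : 1 <= B by rewrite /B addrAC lerDr addr_ge0// divr_ge0// ltW.
have kB : k0 <= delta * B.
  by rewrite mulrC -ler_pdivrMr// /B -addrA lerDl addr_ge0.
pose D : set (R * V) := `[0, s] `*` [set v : V | forall i, `[- B, B]%classic (v ord0 i)].
have cD : compact D.
  apply: compact_setX; first exact: segment_compact.
  by apply: (@rV_compact R n (fun _ => `[- B, B]%classic)) => i; exact: segment_compact.
have Dsx : D (s, x).
  split; rewrite /= ?in_itv/= ?s0 ?lexx// => i; rewrite in_itv /= -ler_norml.
  by apply: le_trans (coord_le_normv x i) _; rewrite /B lerDr addr_ge0// divr_ge0// ltW.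
have [p0 p0D pmax] := compact_EVT_max (ex_intro _ _ Dsx) cD (continuous_subspaceT cG).
have Gp0 : eta <= G p0 by apply: le_trans Gsx _; apply: pmax; rewrite inE.
have gmax p : 0 <= p.1 <= s -> G p <= G p0.
  move=> ps; have [Dp|nDp] := pselect (D p); first by apply: pmax; rewrite inE.
  have [i Bi] : exists i, B < `|p.2 ord0 i|.
    apply: contrapT => /forallNP h; apply: nDp; split; first by rewrite /= in_itv.
    by move=> i /=; rewrite in_itv /= -ler_norml leNgt; apply/negP; exact: h.
  apply: le_trans (G_le _ ps) _; apply: le_trans (le_trans _ (ltW eta0)) Gp0.
  rewrite subr_le0; apply: le_trans kB _; rewrite ler_wpM2l ?(ltW delta0)//.
  apply: (@le_trans _ _ (p.2 ord0 i * p.2 ord0 i)); last first.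
    rewrite /Q /dotv (bigD1 i)//= lerDl sumr_ge0// => j _; by rewrite -expr2 sqr_ge0.
  rewrite -expr2 -real_normK ?num_real// expr2; have : 1 <= `|p.2 ord0 i| by exact: le_trans B1 (ltW Bi).
  by move: Bi; nra.
have p0s : 0 <= p0.1 <= s by move: p0D; rewrite inE => -[/=]; rewrite in_itv.
case: p0 {pmax p0D} Gp0 gmax p0s => [sig x0] /= Gp0 gmax /andP[sig00 sigs].
(* At s = 0 only the penalty is left and G is at most 0, below the maximum. *)
have sig0 : 0 < sig.
  rewrite lt_def sig00 andbT; apply/eqP => e0; move: Gp0.
  rewrite /G /= e0 K0 expr0n /= mulr0 subr0 subrr sub0r leNgt => /negP; apply.
  by apply: (@le_lt_trans _ _ 0) => //; rewrite oppr_le0 mulr_ge0// ltW.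
(* The inequality G(u, x0 + t y) <= G(sig, x0) with u^2 = sig^2 - t^2 is averaged over y. By the
   semigroup property the two values of K cancel, and what remains is the second-order quotient of f
   at x0. *)
have main t : 0 < t < sig -> (K (t, x0) - f x0) / t ^+ 2 <= delta * n%:R - a.
  move=> /andP[t0 tsig].
  pose u := Num.sqrt (sig ^+ 2 - t ^+ 2).
  have ut : t ^+ 2 + u ^+ 2 = sig ^+ 2.
    by rewrite /u sqr_sqrtr ?subrKC// subr_ge0 ler_pXn2r ?nnegrE ?ltW.
  have u0 : 0 < u by rewrite sqrtr_gt0 subr_gt0 ltr_pXn2r ?nnegrE ?ltW.
  have us : u <= s.
    apply: le_trans sigs; rewrite -(ler_pXn2r (n := 2)) ?nnegrE ?ltW//.
    by rewrite -ut ltrDr exprn_gt0.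
  have tQ : tameV (fun y => Q (x0 + t *: y)).
    by apply: (@tame_section_aff _ _ t x0 Q); apply: tame_dotv => i; exact: tame_coord.
  have tK : tameV (fun y => K (u, x0 + t *: y)).
    apply: (@tame_section_aff _ _ t x0 (fun y => K (u, y))).
    apply: (@tame_lipschitz _ (c * (1 + A))) => y z; apply: le_trans (K_lip _ _) _.
    by rewrite ler_wpM2l ?mulr_ge0 ?addr_ge0// prod_normE /= subrr normr0 ge_max lexx normr_ge0.
  have : \int[gamma]_y (f (x0 + t *: y) - a * u ^+ 2 - K (u, x0 + t *: y) - delta * Q (x0 + t *: y))
       <= \int[gamma]_y (G (sig, x0)).
    apply: gauss_int_le => //; last by move=> y; apply: (gmax (u, x0 + t *: y)); rewrite /= us ltW.
    - apply: tameB => //; last exact: tame_cstM.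
      apply: tameB => //; apply: tameB => //; [exact: (tfK (t, x0))|exact: tame_cst].
    - exact: tame_cst.
  have tfa : tameV (fun y => f (x0 + t *: y) - a * u ^+ 2).
    by apply: tameB => //; [exact: (tfK (t, x0))|exact: tame_cst].
  rewrite gauss_cst gauss_intB//; [|exact: tameB|exact: tame_cstM].
  rewrite gauss_intB// gauss_intB//; [|exact: (tfK (t, x0))|exact: tame_cst].
  rewrite gauss_cst (K_semigroup x0 u0 (ltW sig0) ut) (gauss_intZl hgamma)//.
  have -> : \int[gamma]_y Q (x0 + t *: y) = Q x0 + t ^+ 2 * n%:R.
    transitivity (\int[gamma]_y (Q x0 + 2 * t * dotv x0 y + t ^+ 2 * dotv y y)).
      by apply: eq_Rintegral => y _; rewrite /Q !dotvE (dotvC y x0); ring.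
    have tyy : tameV (fun y => dotv y y) by apply: tame_dotv => i; exact: tame_coord.
    rewrite gauss_intD//; [|apply: tameD => //; [exact: tame_cst|apply: tame_cstM; exact: tame_dotvl]|exact: tame_cstM].
    rewrite gauss_intD//; [|exact: tame_cst|apply: tame_cstM; exact: tame_dotvl].
    rewrite gauss_cst !gauss_intZl//; last exact: tame_dotvl.
    by rewrite (gauss_mean_dotv hgamma) (gauss_sqnorm hgamma) mulr0 addr0.
  rewrite /G /= -/(K (t, x0)) ler_pdivrMr ?exprn_gt0//.
  by rewrite -ut; lra.
pose s_ k := sig / k.+2%:R.
have s_0 k : 0 < s_ k by rewrite divr_gt0.
have s_sig k : s_ k < sig by rewrite ltr_pdivrMr// ltr_pMr// ltr1n.
have s_cvg : s_ @ \oo --> 0.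
  rewrite -(mulr0 sig); apply: cvgM; first exact: cvg_cst.
  have := @cvg_harmonic R; rewrite -(cvg_shiftS (@harmonic R)) /=.
  by apply: cvg_trans; apply: near_eq_cvg; near=> k.
have lim := rem_cvg (x := x0) s_0 s_cvg.
(* As delta n < eps, the right-hand side is below - L / 2, against the lower bound on the
   Laplacian. *)
have : laplacian f x0 / 2 <= delta * n%:R - a.
  rewrite -(cvg_lim _ lim)//; apply: limr_le; first by apply/cvg_ex; exists (laplacian f x0 / 2).
  by near=> k; apply: main; rewrite s_0 s_sig.
by have := fL x0; move: dn; rewrite /a; lra.
Unshelve. all: by end_near.
Qed.
End heat.

(** * Second-order remainder of the exponential *)

Section expansion.
Context {R : realType}.

Lemma expR_remainder_le (d : R) : 0 <= expR d - 1 - d <= d ^+ 2 * expR `|d|.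
Proof.
apply/andP; split; first by have := expR_ge1Dx d; lra.
have mvt (a b : R) : a < b -> exists2 c, a < c < b & expR b - expR a = expR c * (b - a).
  move=> ab; have [c] := MVT ab (fun x _ => is_derive_expR x) (continuous_subspaceT (@continuous_expR R)).
  by rewrite in_itv /= => ?; exists c.
have h1 (c : R) : `|c| <= `|d| -> expR c <= expR `|d|.
  by move=> cd; rewrite ler_expR; apply: le_trans (ler_norm _) cd.
have h2 (c : R) : `|expR c - 1| <= `|c| * expR `|c|.
  have [c0|c0|->] := ltgtP c 0.
  - have [x /andP[cx x0]] := mvt _ _ c0; rewrite expR0 sub0r => E.
    rewrite distrC E normrM normrN mulrC ler_wpM2l// gtr0_norm ?expR_gt0// ler_expR.
    by apply: le_trans (ltW x0) _.
  - have [x /andP[x0 xc]] := mvt _ _ c0; rewrite expR0 subr0 => ->.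
    rewrite normrM mulrC ler_wpM2l// gtr0_norm ?expR_gt0// ler_expR.
    by apply: le_trans (ltW xc) (ler_norm _).
  - by rewrite expR0 subrr normr0 mul0r.
have d1 (x : R) : is_derive x 1 (fun x => expR x - x) (expR x - 1).
  exact: (@is_deriveB R R^o R^o _ _ x 1 _ _ (is_derive_expR x) (is_derive_id x 1)).
have mvt2 (a b : R) : a < b -> exists2 c, a < c < b & (expR b - b) - (expR a - a) = (expR c - 1) * (b - a).
  move=> ab; have [c] := MVT ab (fun x _ => d1 x) (continuous_subspaceT (is_derive_continuous d1)).
  by rewrite in_itv /= => ?; exists c.
have key (c : R) : `|c| <= `|d| -> (expR c - 1) * d <= d ^+ 2 * expR `|d|.
  move=> cd; apply: le_trans (ler_norm _) _; rewrite normrM -(real_normK (num_real d)) expr2 mulrAC.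
  rewrite ler_wpM2r//; apply: le_trans (h2 c) _.
  by apply: ler_pM => //; rewrite ?expR_ge0// ler_expR.
case: (ltgtP d 0) => d0.
- have [c /andP[dc c0]] := mvt2 _ _ d0; rewrite expR0 !sub0r subr0 mulrN => E.
  rewrite (_ : expR d - 1 - d = (expR c - 1) * d); last by lra.
  by apply: key; rewrite !ltr0_norm// lerN2 ltW.
- have [c /andP[c0 cd]] := mvt2 _ _ d0; rewrite expR0 !subr0 => E.
  rewrite (_ : expR d - 1 - d = (expR c - 1) * d); last by lra.
  by apply: key; rewrite !gtr0_norm// ltW.
- by rewrite d0 expR0 expr0n /= mul0r subrr subr0.
Qed.

(** Here q stands for difference quotients of the potential, so that s q is an exact increment; the
    Taylor bound is applied at these moving points, which tend to 0. *)
Lemma expR_remainder_cvg (q : nat -> R) (s : nat -> R) (a B : R) : (forall k, 0 < s k) -> s @ \oo --> 0 ->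
  (forall k, `|q k| <= B) -> q @ \oo --> a ->
  (expR (s k * q k) - 1 - s k * q k) / s k ^+ 2 @[k --> \oo] --> a ^+ 2 / 2.
Proof.
move=> s0 cs qB cq.
have B0 : 0 <= B by exact: le_trans (normr_ge0 _) (qB 0%N).
have B1 : 0 < B ^+ 2 + 1 by rewrite ltr_wpDl ?sqr_ge0.
have c2 : (q k ^+ 2 / 2) @[k --> \oo] --> a ^+ 2 / 2.
  by apply: cvgM; [exact: cvgM|exact: cvg_cst].
apply/cvgrPdist_le => e e0.
have e2 : 0 < e / 2 by rewrite divr_gt0.
have e3 : 0 < e / 2 / (B ^+ 2 + 1) by rewrite divr_gt0.
have [d d0 hd] := taylor2 (@is_derive_expR R) (@is_derive_expR R 0) e3.
have dB : 0 < d / (B + 1) by rewrite divr_gt0// ltr_wpDl.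
have /cvgrPdist_le /(_ _ dB) ns := cs.
have /cvgrPdist_le /(_ _ e2) nq := c2.
near=> k.
have hs : `|0 - s k| <= d / (B + 1) by near: k.
have hq : `|a ^+ 2 / 2 - q k ^+ 2 / 2| <= e / 2 by near: k.
have sk2 : 0 < s k ^+ 2 by rewrite exprn_gt0.
have : `|s k * q k| <= d.
  rewrite normrM; apply: (@le_trans _ _ (d / (B + 1) * B)).
    by apply: ler_pM => //; move: hs; rewrite sub0r normrN.
  by rewrite mulrAC ler_pdivrMr ?ltr_wpDl// ler_wpM2l ?(ltW d0)// lerDl.
move=> /hd; rewrite expR0 mulr1 => h.
have h' : `|(expR (s k * q k) - 1 - s k * q k) / s k ^+ 2 - q k ^+ 2 / 2| <= e / 2.
  rewrite -(ler_pM2r sk2) -[X in _ * X <= _](gtr0_norm sk2) -normrM mulrBl divfK ?gt_eqF//.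
  rewrite (_ : q k ^+ 2 / 2 * s k ^+ 2 = 1 / 2 * (s k * q k) ^+ 2); last by field.
  apply: le_trans h _; rewrite exprMn.
  rewrite (mulrC (s k ^+ 2)) mulrA ler_wpM2r ?(ltW sk2)//.
  rewrite mulrAC ler_pdivrMr// ler_wpM2l ?(ltW e2)//.
  rewrite -[q k ^+ 2]real_normK ?num_real//.
  by apply: (@le_trans _ _ (B ^+ 2)); [rewrite ler_pXn2r ?nnegrE|rewrite lerDl].
rewrite (_ : a ^+ 2 / 2 - _ = (a ^+ 2 / 2 - q k ^+ 2 / 2) -
  ((expR (s k * q k) - 1 - s k * q k) / s k ^+ 2 - q k ^+ 2 / 2)); last by rewrite opprB addrA subrK.
apply: le_trans (ler_normB _ _) _; rewrite [leRHS](splitr e); exact: lerD.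
Unshelve. all: by end_near.
Qed.

End expansion.

(** * Potentials with bounded gradient *)

Section tame_gradient.
Context {R : realType} {n : nat}.
Local Notation V := 'rV[R]_n.
Local Notation tameV := (tame (fun y : V => `|y|)).
Variables (f : V -> R) (g : V -> V) (M : R).
Hypothesis hg : has_gradient f g.
Hypothesis gM : forall y, `|g y| <= M.

Lemma gradient_bound_ge0 : 0 <= M. Proof. exact: le_trans (normr_ge0 _) (gM 0). Qed.

Lemma gradient_lip x y : `|f x - f y| <= (n%:R * M) * `|x - y|.
Proof. by rewrite -mulrA; exact: gradient_lipschitz hg gM x y. Qed.

Lemma gradient_cont : continuous f. Proof. exact: lipschitz_cont gradient_lip. Qed.

Lemma tame_potential : tameV f. Proof. exact: tame_lipschitz gradient_lip. Qed.

Lemma potential_le y : f y <= f 0 + (n%:R * M) * `|y|.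
Proof. have := gradient_lip y 0; rewrite subr0 => h; have := ler_norm (f y - f 0); lra. Qed.

Lemma tame_exp_potential : tameV (fun y => expR (f y)).
Proof.
apply: (tame_expR _ _ potential_le) => //.
  exact: (continuous_measurable_rV gradient_cont).
by rewrite mulr_ge0// gradient_bound_ge0.
Qed.

Lemma tame_gradient_coord i : tameV (fun y => g y ord0 i).
Proof.
have tM : tameV (fun _ => M) by exact: tame_cst.
apply: (tame_bound _ tM) => [|y].
  apply: continuous_measurable_rV => y.
  by apply: (cvg_comp g (fun w : V => w ord0 i)); [exact: hg.1|exact: continuous_coord].
by apply: le_trans (coord_le_normv _ _) _; apply: le_trans (gM y) (ler_norm _).
Qed.

End tame_gradient.

(** * The energy inequality *)

Section energy.
Context {R : realType} {n : nat}.
Local Notation V := 'rV[R]_n.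
Variable gamma : probability V R.
Hypothesis hgamma : std_gaussian gamma.
Local Notation tameV := (tame (fun y : V => `|y|)).
Local Notation tameVV := (tame (sumh (fun y : V => `|y|) (fun y : V => `|y|))).
Variables (f : V -> R) (g : V -> V) (M L : R).
Hypothesis hg : has_gradient f g.
Hypothesis gM : forall y, `|g y| <= M.
Hypothesis heat : forall x (s : R), 0 <= s -> f x - L / 2 * s ^+ 2 <= \int[gamma]_y f (x + s *: y).

Let c0 := n%:R * M.
Let c00 : 0 <= c0. Proof. by rewrite mulr_ge0// (gradient_bound_ge0 gM). Qed.
Let cf : continuous f := gradient_cont hg gM.
Let tf : tameV f := tame_potential hg gM.
Let tE : tameV (fun y => expR (f y)) := tame_exp_potential hg gM.
Let tEQ : tameV (fun y => expR (f y) * dotv y y).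
Proof. by apply: tameM => //; apply: tame_dotv => i; exact: tame_coord. Qed.
Let A := \int[gamma]_y expR (f y).
Let B := \int[gamma]_y (expR (f y) * dotv y y).

Let tdil (c : R) F : tameV F -> tameV (fun y => F (c *: y)).
Proof.
move=> tF; have := @tame_section_aff _ _ c 0 F tF.
by congr tame; apply/funext => y; rewrite add0r.
Qed.

(** Rescaling the variable by c turns e^(f(c y)) into e^f times the quotient of two Gaussian
    densities, e^(- k |y|^2) with k = (c^-2 - 1)/2; then e^(-t) >= 1 - t. *)
Let dilation (c : R) : 0 < c <= 1 ->
  c ^- n * (A - (c ^- 2 - 1) / 2 * B) <= \int[gamma]_y expR (f (c *: y)).
Proof.
move=> /andP[cp c1]; pose k := (c ^- 2 - 1) / 2.
have k0 : 0 <= k.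
  rewrite divr_ge0// subr_ge0 invf_ge1 ?exprn_gt0//.
  by rewrite exprn_ile1// ltW.
have mQ : measurable_fun setT (fun y : V => dotv y y) by apply: measurable_dotv; exact: measurable_idV.
have tG : tameV (fun y => expR (f y) * expR (- (k * dotv y y))).
  apply: (tame_bound _ tE).
    by apply: measurable_funM; [case: tE|apply: measurableT_comp => //; apply: measurableT_comp => //; exact: measurable_funM].
  move=> y; rewrite normrM ler_piMr// ger0_norm ?expR_ge0// -[leRHS]expR0 ler_expR.
  by rewrite oppr_le0 mulr_ge0// dotvv_ge0.
have tL : tameV (fun y => expR (f y) - k * (expR (f y) * dotv y y)) by apply: tameB => //; exact: tame_cstM.
have -> : \int[gamma]_y expR (f (c *: y)) = c ^- n * \int[gamma]_y (expR (f y) * expR (- (k * dotv y y))).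
  apply: EFin_inj; rewrite EFinM.
  rewrite -(tame_fin measurable_normv (gauss_exp hgamma) (tdil c tE)).
  rewrite -(tame_fin measurable_normv (gauss_exp hgamma) tG).
  pose F (y : V) := (expR (f y) * expR (- (dotv y y / (2 * c ^+ 2))))%:E.
  have mF : measurable_fun setT F.
    apply/measurable_EFinP; apply: measurable_funM; first by case: tE.
    by apply: measurableT_comp => //; apply: measurableT_comp => //; exact: measurable_funM.
  have F0 y : (0 <= F y)%E by rewrite lee_fin mulr_ge0// expR_ge0.
  have := gauss_affine hgamma 0 cp mF F0.
  rewrite (_ : (\int[gamma]_y (F y * (wt y)%:E) = \int[gamma]_y (expR (f y) * expR (- (k * dotv y y)))%:E)%E); last first.
    apply: eq_integral => y _; rewrite /F /wt -EFinM -!mulrA -!expRD; congr EFin; congr expR.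
    by rewrite /k; field; rewrite gt_eqF.
  move=> <-; apply: eq_integral => y _; rewrite addr0 /F /wt -EFinM -!mulrA -!expRD; congr EFin; congr expR.
  by rewrite !dotvE; field; rewrite gt_eqF.
rewrite ler_wpM2l ?invr_ge0 ?exprn_ge0 ?(ltW cp)//.
rewrite /A /B -/k -(gauss_intZl hgamma)// -(gauss_intB hgamma)//; last exact: tame_cstM.
apply: (gauss_int_le hgamma) => // y.
rewrite mulrCA -{1}[expR (f y)]mulr1 -mulrBr ler_wpM2l ?expR_ge0//.
by have := expR_ge1Dx (- (k * dotv y y)).
Qed.

(** The offset 2 keeps s < 1, so that c = sqrt(1 - s^2) is positive. *)
Let s_ (k : nat) : R := k.+2%:R^-1.
Let s0 k : 0 < s_ k. Proof. by rewrite invr_gt0. Qed.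
Let s1 k : s_ k < 1. Proof. by rewrite invf_lt1// ltr1n. Qed.
Let s_cvg : s_ @ \oo --> 0.
Proof.
have := @cvg_harmonic R; rewrite -(cvg_shiftS (@harmonic R)) /=.
by apply: cvg_trans; apply: near_eq_cvg; near=> k.
Unshelve. all: by end_near.
Qed.
Let c_ k := Num.sqrt (1 - s_ k ^+ 2).
Let c2 k : c_ k ^+ 2 = 1 - s_ k ^+ 2.
Proof. by rewrite sqr_sqrtr// subr_ge0 exprn_ile1// ltW. Qed.
Let cp k : 0 < c_ k.
Proof. by rewrite sqrtr_gt0 subr_gt0 exprn_ilt1// ltW. Qed.
Let c1 k : c_ k <= 1.
Proof.
by rewrite -(ler_pXn2r (n := 2)) ?nnegrE ?(ltW (cp _))// c2 expr1n gerBl sqr_ge0.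
Qed.
Let c_lb k : 1 - s_ k <= c_ k.
Proof.
rewrite -(ler_pXn2r (n := 2)) ?nnegrE ?(ltW (cp _)) ?subr_ge0 ?(ltW (s1 _))//.
by rewrite c2; have := s1 k; have := s0 k; nra.
Qed.
Let c_cvg : c_ @ \oo --> (1 : R).
Proof.
have h : (1 - s_ k) @[k --> \oo] --> (1 : R) by rewrite -[X in _ --> X]subr0; apply: cvgB => //; exact: cvg_cst.
apply: (@squeeze_cvgr _ _ _ _ (fun k => 1 - s_ k) (fun=> 1)) => //.
- by near=> k; rewrite c_lb c1.
- exact: cvg_cst.
Unshelve. all: by end_near.
Qed.

Let dl k (y z : V) := f (c_ k *: y + s_ k *: z) - f (c_ k *: y).

Let dl_le k y z : `|dl k y z| <= s_ k * (c0 * `|z|).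
Proof.
apply: le_trans (gradient_lip hg gM _ _) _; rewrite addrAC subrr add0r normrZ gtr0_norm//.
by rewrite mulrCA.
Qed.

Let E2 (d : R) := expR d - 1 - d.
(** The second-order part of e^(f(c y + s z)) - e^(f(c y)), divided by s^2. The first-order part is
    left aside because [heat] bounds it after integration in z; this part tends to e^f <g, z>^2 / 2,
    whose mean in z is e^f |g|^2 / 2. *)
Let F k (p : V * V) := expR (f (c_ k *: p.1)) * (E2 (dl k p.1 p.2) / s_ k ^+ 2).
Let G (p : V * V) := expR (f 0 + c0 * `|p.1|) * ((c0 * `|p.2|) ^+ 2 * expR (c0 * `|p.2|)).

Let tfst F0 : tameV F0 -> tameVV (fun p => F0 p.1).
Proof.
move=> tF0; apply: (@tame_comp _ _ _ _ _ _ _ F0 fst 0 1 tF0) => //.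
  by move=> p; exact: sumh_ge0.
by move=> p; rewrite add0r mul1r lerDl.
Qed.
Let tsnd F0 : tameV F0 -> tameVV (fun p => F0 p.2).
Proof.
move=> tF0; apply: (@tame_comp _ _ _ _ _ _ _ F0 snd 0 1 tF0) => //.
  by move=> p; exact: sumh_ge0.
by move=> p; rewrite add0r mul1r lerDr.
Qed.

Let mVV : measurable_fun setT (sumh (fun y : V => `|y|) (fun y : V => `|y|)).
Proof. exact: (measurable_sumh measurable_normv measurable_normv). Qed.

Let sh0 (p : V * V) : 0 <= sumh (fun y : V => `|y|) (fun y : V => `|y|) p.
Proof. exact: sumh_ge0. Qed.

Let tG : tameVV G.
Proof.
have tn : tameV (fun y => c0 * `|y|) by apply: tame_cstM; exact: tame_normV.
have te : tameV (fun y => expR (c0 * `|y|)).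
  apply: (@tame_expR _ _ _ _ _ 0 c0) => //; first by case: tn.
  by move=> y; rewrite add0r.
apply: tameM => //.
  have := @tfst (fun y => expR (f 0) * expR (c0 * `|y|)) (tame_cstM (expR (f 0)) te).
  by congr tame; apply/funext => p; rewrite expRD.
by apply: (@tsnd (fun y => (c0 * `|y|) ^+ 2 * expR (c0 * `|y|))); apply: tameM => //; exact: tameX.
Qed.

Let tFe k : tameVV (fun p => expR (f (c_ k *: p.1 + s_ k *: p.2))).
Proof. exact: (@tame_affF _ _ (c_ k) (s_ k) _ tE). Qed.

Let tFf k : tameVV (fun p => f (c_ k *: p.1 + s_ k *: p.2)).
Proof. exact: (@tame_affF _ _ (c_ k) (s_ k) _ tf). Qed.

Let tf1 k : tameVV (fun p => f (c_ k *: p.1)).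
Proof. exact: (@tfst (fun y => f (c_ k *: y)) (tdil (c_ k) tf)). Qed.

Let te1 k : tameVV (fun p => expR (f (c_ k *: p.1))).
Proof. exact: (@tfst (fun y => expR (f (c_ k *: y))) (tdil (c_ k) tE)). Qed.

Let FG k p : `|F k p| <= G p.
Proof.
have M0 := gradient_bound_ge0 gM.
have /andP[E0 E1] := expR_remainder_le (dl k p.1 p.2).
have sk : 0 < s_ k ^+ 2 by rewrite exprn_gt0.
rewrite ger0_norm; last by rewrite mulr_ge0 ?expR_ge0// divr_ge0// ltW.
apply: ler_pM; rewrite ?expR_ge0//; first by rewrite divr_ge0// ltW.
  rewrite ler_expR; apply: le_trans (potential_le hg gM _) _; rewrite lerD2l ler_wpM2l//.
  by rewrite normrZ gtr0_norm// ler_piMl.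
have h := dl_le k p.1 p.2.
rewrite ler_pdivrMr//; apply: le_trans E1 _.
rewrite [leRHS](_ : _ = (c0 * `|p.2| * s_ k) ^+ 2 * expR (c0 * `|p.2|)); last by rewrite [in RHS]exprMn mulrAC.
apply: ler_pM; rewrite ?expR_ge0 ?sqr_ge0//; last first.
  rewrite ler_expR; apply: le_trans h _; apply: ler_piMl; [exact: mulr_ge0|exact: ltW].
rewrite -real_normK ?num_real// ler_pXn2r ?nnegrE ?mulr_ge0// ?(ltW (s0 k))//.
by rewrite mulrC in h.
Qed.

Let tF k : tameVV (F k).
Proof.
apply: (tame_bound _ tG) => [|p]; last by apply: le_trans (FG k p) (ler_norm _).
have td : tameVV (fun p => dl k p.1 p.2) by exact: tameB.
apply: measurable_funM; first by case: (te1 k).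
apply: measurable_funM => //; apply: measurable_funB; last by case: td.
by apply: measurable_funB => //; apply: measurableT_comp => //; case: td.
Qed.

Let F_cvg p : F ^~ p @ \oo --> expR (f p.1) * (dotv (g p.1) p.2 ^+ 2 / 2).
Proof.
case: p => y z; rewrite /F /=.
have ccy : c_ k *: y @[k --> \oo] --> y.
  by rewrite -[X in _ --> X]scale1r; apply: cvgZ; [exact: c_cvg|exact: cvg_cst].
apply: cvgM.
  apply: (cvg_comp (fun k => c_ k *: y) (fun y => expR (f y))) ccy _.
  by apply: (cvg_comp f expR); [exact: cf|exact: continuous_expR].
pose q k := dl k y z / s_ k.
have sq k : dl k y z = s_ k * q k by rewrite /q mulrC divfK// gt_eqF.
under eq_fun do rewrite sq.
apply: (@expR_remainder_cvg _ q s_ _ (c0 * `|z|)) => //.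
  by move=> k; rewrite /q normrM normfV (gtr0_norm (s0 k)) ler_pdivrMr// mulrC.
apply/cvgrPdist_le => e e0.
have /cvgrPdist_le /(_ _ e0) : (fun u => dotv (g u) z) @ y --> dotv (g y) z.
  by apply: (cvg_comp g (fun w => dotv w z)); [exact: hg.1|exact: continuous_dotvl].
move=> /nbhs_ballP[d /= d0 hd].
have dz : 0 < d / (`|y| + `|z| + 1) by rewrite divr_gt0// ltr_wpDl// addr_ge0.
have /cvgrPdist_lt /(_ _ dz) := s_cvg.
apply: filterS => k; rewrite sub0r normrN (gtr0_norm (s0 k)) => sk.
have [t /andP[t0 t1]] := gradient_mvt (c_ k *: y) (s_ k *: z) hg.
rewrite dotvZr => E; rewrite /q /dl E mulrAC mulfV ?gt_eqF// mul1r; apply: hd.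
rewrite -ball_normE /= opprD addrA -{1}[y]scale1r -scalerBl.
apply: le_lt_trans (ler_normB _ _) _; rewrite !normrZ (gtr0_norm t0) (gtr0_norm (s0 k)).
rewrite ger0_norm ?subr_ge0//.
apply: (@le_lt_trans _ _ (s_ k * `|y| + s_ k * `|z|)).
  apply: lerD; first by rewrite ler_wpM2r//; have := c_lb k; lra.
  by rewrite ler_piMl ?mulr_ge0// ltW.
rewrite -mulrDr; apply: (@le_lt_trans _ _ (s_ k * (`|y| + `|z| + 1))).
  by rewrite ler_wpM2l ?(ltW (s0 k))// lerDl.
by rewrite -ltr_pdivlMr// ltr_wpDl// addr_ge0.
Qed.

Let A_ k := \int[gamma]_y expR (f (c_ k *: y)).
Let B_ k := \int[(gamma \x gamma)%E]_p F k p.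

Let A_cvg : A_ @ \oo --> A.
Proof.
have tn : tameV (fun y => expR (f 0 + c0 * `|y|)).
  apply: (@tame_expR _ _ _ _ _ (f 0) c0) => //.
  by apply: measurable_funD => //; apply: measurable_funM => //; exact: measurable_normv.
apply: (@Rintegral_cvg_dominated _ V R gamma (fun k y => expR (f (c_ k *: y))) (fun y => expR (f y)) (fun y => expR (f 0 + c0 * `|y|))).
- by move=> k; case: (tdil (c_ k) tE).
- move=> y; have ccy : c_ k *: y @[k --> \oo] --> y.
    by rewrite -[X in _ --> X]scale1r; apply: cvgZ; [exact: c_cvg|exact: cvg_cst].
  apply: (cvg_comp (fun k => c_ k *: y) (fun y => expR (f y))) ccy _.
  by apply: (cvg_comp f expR); [exact: cf|exact: continuous_expR].
- exact: (gauss_integrable hgamma).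
- move=> k y; rewrite ger0_norm ?expR_ge0// ler_expR.
  apply: le_trans (potential_le hg gM _) _; rewrite lerD2l ler_wpM2l//.
  by rewrite normrZ gtr0_norm// ler_piMl.
Qed.

Let hexpVV a : (\int[(gamma \x gamma)%E]_p (expR (a * sumh (fun y : V => `|y|) (fun y : V => `|y|) p))%:E < +oo)%E.
Proof. exact: (sumh_exp measurable_normv measurable_normv (gauss_exp hgamma) (gauss_exp hgamma)). Qed.

Let B_cvg : B_ @ \oo --> (\int[gamma]_y (expR (f y) * dotv (g y) (g y))) / 2.
Proof.
have tg := tame_gradient_coord hg gM.
have tlim : tameVV (fun p => expR (f p.1) * (dotv (g p.1) p.2 ^+ 2 / 2)).
  apply: tameM => //; first exact: (@tfst (fun y => expR (f y)) tE).
  apply: tameM => //; last exact: tame_cst.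
  apply: tameX => //; apply: tame_sum => // i; apply: tameM => //.
    exact: (@tfst (fun y => g y ord0 i) (tg i)).
  exact: (@tsnd (fun y => y ord0 i) (tame_coord i)).
have -> : (\int[gamma]_y (expR (f y) * dotv (g y) (g y))) / 2 =
   \int[(gamma \x gamma)%E]_p (expR (f p.1) * (dotv (g p.1) p.2 ^+ 2 / 2)).
  rewrite (tame_int_prod measurable_normv measurable_normv (fun y => normr_ge0 y) (gauss_exp hgamma) (gauss_exp hgamma) tlim).
  rewrite -(gauss_intZr hgamma); last by apply: tameM => //; exact: tame_dotv.
  apply: eq_Rintegral => y _ /=.
  have t2 : tameV (fun z => dotv (g y) z ^+ 2) by apply: tameX => //; exact: tame_dotvl.
  rewrite (gauss_intZl hgamma); last by apply: tameM => //; exact: tame_cst.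
  by rewrite (gauss_intZr hgamma)// (gauss_dotv2 hgamma) mulrA.
apply: (@Rintegral_cvg_dominated _ _ R (gamma \x gamma)%E F (fun p => expR (f p.1) * (dotv (g p.1) p.2 ^+ 2 / 2)) G).
- by move=> k; case: (tF k).
- exact: F_cvg.
- exact: (tame_integrable mVV hexpVV tG).
- exact: FG.
Qed.

(** By rotation invariance A is the mean of e^(f(c y + s z)). Expanded about f(c y), its linear term
    is at least - L s^2 / 2 by [heat], and the rest is [B_ k]. *)
Let lower k : - L / 2 * A_ k + B_ k <= (A - A_ k) / s_ k ^+ 2.
Proof.
have sk : 0 < s_ k ^+ 2 by rewrite exprn_gt0.
have rot := tame_gauss_rotation hgamma (s0 k) (_ : c_ k ^+ 2 + s_ k ^+ 2 = 1) tE.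
rewrite ler_pdivlMr// lerBrDr /A -rot; last by rewrite c2 subrK.
rewrite /B_ (tame_int_prod measurable_normv measurable_normv (fun y => normr_ge0 y) (gauss_exp hgamma) (gauss_exp hgamma) (tF k)).
have tFi : tameV (fun y => \int[gamma]_z F k (y, z)).
  exact: (tame_fubini_F measurable_normv (fun y => normr_ge0 y) (gauss_exp hgamma) (tF k)).
have tA1 : tameV (fun y => expR (f (c_ k *: y))) by exact: (@tdil (c_ k) (fun y => expR (f y)) tE).
rewrite mulrDl -(gauss_intZr hgamma)// mulrAC -(gauss_intZl hgamma)//.
rewrite -(gauss_intD hgamma) -?(gauss_intD hgamma)//; last 3 first.
- by apply: tameD => //; [exact: tame_cstM|apply: tameM => //; exact: tame_cst].
- exact: tame_cstM.
- by apply: tameM => //; exact: tame_cst.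
apply: (gauss_int_le hgamma).
- apply: tameD => //; apply: tameD => //; [exact: tame_cstM|apply: tameM => //; exact: tame_cst].
- exact: (tame_fubini_F measurable_normv (fun y => normr_ge0 y) (gauss_exp hgamma) (tFe k)).
move=> y.
have tFs : tameV (fun z => F k (y, z)) by exact: (tame_section (fun y : V => normr_ge0 y) (tF k) y).
have tds : tameV (fun z => f (c_ k *: y + s_ k *: z)) by exact: tame_section_aff.
have -> : \int[gamma]_z expR (f (c_ k *: y + s_ k *: z)) =
   expR (f (c_ k *: y)) * (1 + (\int[gamma]_z f (c_ k *: y + s_ k *: z) - f (c_ k *: y))) +
   (\int[gamma]_z F k (y, z)) * s_ k ^+ 2.
  transitivity (\int[gamma]_z (expR (f (c_ k *: y)) * (1 + (f (c_ k *: y + s_ k *: z) - f (c_ k *: y))) + F k (y, z) * s_ k ^+ 2)).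
    apply: eq_Rintegral => z _; rewrite /F /= -mulrA divfK ?gt_eqF// -mulrDr /E2.
    rewrite -{1}(subrK (f (c_ k *: y)) (f (c_ k *: y + s_ k *: z))) expRD mulrC -/(dl k y z).
    by congr (_ * _); ring.
  have tA2 : tameV (fun z => f (c_ k *: y + s_ k *: z) - f (c_ k *: y)) by apply: tameB => //; exact: tame_cst.
  have tA3 : tameV (fun z => 1 + (f (c_ k *: y + s_ k *: z) - f (c_ k *: y))) by apply: tameD => //; exact: tame_cst.
  rewrite (gauss_intD hgamma); [|exact: tame_cstM|by apply: tameM => //; exact: tame_cst].
  rewrite (gauss_intZl hgamma)// (gauss_intZr hgamma)// (gauss_intD hgamma)//; last exact: tame_cst.
  by rewrite (gauss_intB hgamma)//; [rewrite !gauss_cst|exact: tame_cst].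
have := heat (c_ k *: y) (ltW (s0 k)); have := expR_gt0 (f (c_ k *: y)).
set e := expR _; set h := \int[gamma]_z f _; set b := \int[gamma]_z F k _.
by nra.
Qed.

(** From [dilation], with c^-2 - 1 = c^-2 s^2 and c^-n - 1 >= n s^2 / 2. *)
Let upper k : (A - A_ k) / s_ k ^+ 2 <= - n%:R / 2 * A + (c_ k)^-1 ^+ n.+2 / 2 * B.
Proof.
have sk : 0 < s_ k ^+ 2 by rewrite exprn_gt0.
have A0 : 0 <= A by apply: Rintegral_ge0 => y _; exact: expR_ge0.
rewrite ler_pdivrMr//.
have := dilation (_ : 0 < c_ k <= 1); rewrite cp c1 => /(_ isT) h.
have cV : 1 + s_ k ^+ 2 / 2 <= (c_ k)^-1.
  rewrite -[leRHS]div1r ler_pdivlMr// -(ler_pXn2r (n := 2)) ?nnegrE ?mulr_ge0 ?addr_ge0 ?divr_ge0 ?exprn_ge0 ?(ltW (s0 k)) ?(ltW (cp k))//.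
  rewrite exprMn c2 expr1n; have := sqr_ge0 (s_ k); set w := s_ k ^+ 2 => w0.
  by have := mulr_ge0 w0 w0; have := mulr_ge0 (mulr_ge0 w0 w0) w0; nra.
(* Bernoulli's inequality, from c^-1 >= 1 + s^2 / 2. *)
have cn : 1 + n%:R * (s_ k ^+ 2 / 2) <= c_ k ^- n.
  rewrite -exprVn; apply: (@le_trans _ _ ((1 + s_ k ^+ 2 / 2) ^+ n)).
    have w0 : 0 <= s_ k ^+ 2 / 2 by rewrite divr_ge0// sqr_ge0.
    move: w0; set w := s_ k ^+ 2 / 2 => w0; elim: n => [|m ih]; first by rewrite mul0r addr0 expr0.
    rewrite exprS; apply: (@le_trans _ _ ((1 + w) * (1 + m%:R * w))); last by apply: ler_wpM2l ih; rewrite addr_ge0.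
    rewrite -natr1; by have := mulr_ge0 (ler0n R m) (mulr_ge0 w0 w0); nra.
  have sk' := ltW (s0 k); have ck' := ltW (cp k).
  by apply: lerXn2r; rewrite // nnegrE ?invr_ge0// addr_ge0// divr_ge0// exprn_ge0.
have e2 : c_ k ^- 2 - 1 = (c_ k)^-1 ^+ 2 * s_ k ^+ 2.
  have -> : s_ k ^+ 2 = 1 - c_ k ^+ 2 by rewrite c2 subKr.
  by field; rewrite gt_eqF.
have := ler_wpM2r A0 cn.
move: h; rewrite e2 -/(A_ k) -exprVn => h.
have -> : (c_ k)^-1 ^+ n.+2 = (c_ k)^-1 ^+ n * (c_ k)^-1 ^+ 2 by rewrite -exprD addn2.
by move: h; set ck := (c_ k)^-1 ^+ n; set w := (c_ k)^-1 ^+ 2; lra.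
Qed.

Lemma energy_le : \int[gamma]_y (expR (f y) * (dotv (g y) (g y) - L)) <=
  \int[gamma]_y (expR (f y) * (dotv y y - n%:R)).
Proof.
have tg := tame_gradient_coord hg gM.
have lim1 : (- L / 2 * A_ k + B_ k) @[k --> \oo] -->
   - L / 2 * A + (\int[gamma]_y (expR (f y) * dotv (g y) (g y))) / 2.
  by apply: cvgD; [apply: cvgM; [exact: cvg_cst|exact: A_cvg]|exact: B_cvg].
have lim2 : (- n%:R / 2 * A + (c_ k)^-1 ^+ n.+2 / 2 * B) @[k --> \oo] -->
   - n%:R / 2 * A + 1 / 2 * B.
  apply: cvgD; first exact: cvg_cst.
  apply: cvgM; last exact: cvg_cst.
  apply: cvgM; last exact: cvg_cst.
  have cV : (c_ k)^-1 @[k --> \oo] --> (1 : R) by rewrite -[X in _ --> X]invr1; apply: cvgV.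
  elim: n.+2 => [|m ih]; first by under eq_fun do rewrite expr0; exact: cvg_cst.
  under eq_fun do rewrite exprS.
  by have := cvgM cV ih; rewrite mulr1; apply.
have tgg : tameV (fun y => expR (f y) * dotv (g y) (g y)) by apply: tameM => //; exact: tame_dotv.
have -> : \int[gamma]_y (expR (f y) * (dotv (g y) (g y) - L)) =
  \int[gamma]_y (expR (f y) * dotv (g y) (g y)) - A * L.
  under eq_Rintegral => y _ do rewrite mulrBr.
  by rewrite (gauss_intB hgamma)//; [rewrite (gauss_intZr hgamma)|apply: tameM => //; exact: tame_cst].
have -> : \int[gamma]_y (expR (f y) * (dotv y y - n%:R)) = B - A * n%:R.
  under eq_Rintegral => y _ do rewrite mulrBr.
  by rewrite (gauss_intB hgamma)//; [rewrite (gauss_intZr hgamma)|apply: tameM => //; exact: tame_cst].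
have : - L / 2 * A + (\int[gamma]_y (expR (f y) * dotv (g y) (g y))) / 2 <= - n%:R / 2 * A + 1 / 2 * B.
  apply: (ler_cvg_to lim1 lim2); near=> k; exact: le_trans (lower k) (upper k).
by lra.
Unshelve. all: by end_near.
Qed.

End energy.

(** * Integrals depending on a parameter *)

Lemma is_derive_Rintegral {R : realType} d (T : measurableType d) (mu : {measure set T -> \bar R})
    (h h' : R -> T -> R) (a : R) (G : T -> R) :
  (forall (t : R) x, is_derive t 1 (h^~ x) (h' t x)) ->
  (forall t, mu.-integrable setT (EFin \o h t)) ->
  (forall x, 0 <= G x) -> mu.-integrable setT (EFin \o G) ->
  (forall t x, `]a - 1, a + 1[%classic t -> `|h' t x| <= G x) ->
  is_derive a 1 (fun t => \int[mu]_x h t x) (\int[mu]_x h' a x).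
Proof.
move=> dh ih G0 iG hG.
have a1 : `]a - 1, a + 1[%classic a by rewrite /= in_itv /= ltrDl ltrBlDr ltrDl ltr01.
have pE t x : partial1of2 h t x = h' t x.
  by rewrite /partial1of2 derive1E; apply: derive_val.
have hG' t x : `]a - 1, a + 1[%classic t -> setT x -> `|partial1of2 h t x| <= G x.
  by move=> ta _; rewrite pE; exact: hG.
have dd t x : `]a - 1, a + 1[%classic t -> setT x -> derivable (h^~ x) t 1.
  by move=> _ _; apply: ex_derive.
have ii t : `]a - 1, a + 1[%classic t -> mu.-integrable setT (EFin \o h t) by move=> _; exact: ih.
split.
  exact: (derivable_under_integral measurableT a1 ii dd G0 iG hG').
rewrite -derive1E (differentiation_under_integral measurableT a1 ii dd G0 iG hG').
by apply: eq_Rintegral => x _; rewrite pE.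
Qed.

Lemma continuous_Rintegral {R : realType} d (T : measurableType d) (mu : {measure set T -> \bar R})
    (h : R -> T -> R) :
  (forall t, mu.-integrable setT (EFin \o h t)) ->
  (forall x, continuous (h^~ x)) ->
  (forall a, exists2 G : T -> R, mu.-integrable setT (EFin \o G) &
     forall t x, `]a - 1, a + 1[%classic t -> `|h t x| <= G x) ->
  continuous (fun t => \int[mu]_x h t x).
Proof.
move=> ih ch hG a; have [G iG Gb] := hG a.
have := @continuity_under_integral R d T mu h setT measurableT (a - 1) (a + 1) (fun t _ => ih t) _ G iG.
apply.
- by apply: aeW => x _ t _; exact: ch.
- by move=> t ta; apply: aeW => x _; exact: Gb.
- by rewrite inE /= in_itv /= ltrDl ltrBlDr ltrDl ltr01.
Qed.

(** * The Knothe map *)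

Section knothe.
Context {R : realType} {n : nat}.
Local Notation V := 'rV[R]_n.
Local Notation N01 := (normal_prob (0:R) 1).
Local Notation mu := (@lebesgue_measure R).
Local Notation phi := (normal_pdf (0:R) 1).
Variable gamma : probability V R.
Hypothesis hgamma : std_gaussian gamma.
Local Notation tameV := (tame (fun y : V => `|y|)).
Local Notation tame1 := (tame (fun z : R => `|z|)).
Local Notation tameVV := (tame (sumh (fun y : V => `|y|) (fun y : V => `|y|))).
Local Notation tameV1 := (tame (sumh (fun y : V => `|y|) (fun z : R => `|z|))).
Variables (f : V -> R) (g : V -> V) (M : R).
Hypothesis hg : has_gradient f g.
Hypothesis gM : forall y, `|g y| <= M.
Hypothesis f1 : \int[gamma]_y expR (f y) = 1.

Let M0 : 0 <= M := gradient_bound_ge0 gM.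
Let c0 := n%:R * M.
Let c00 : 0 <= c0. Proof. exact: mulr_ge0. Qed.
Let cf : continuous f := gradient_cont hg gM.
Let tE : tameV (fun y => expR (f y)) := tame_exp_potential hg gM.

Definition first (k : nat) : pred 'I_n := fun j => (j < k)%N.

Lemma mix_first_upd (k : 'I_n) (y w : V) (z : R) :
  mix (first k.+1) (upd y k z) w = mix (first k) y (upd w k z).
Proof.
apply/rowP => j; rewrite !mxE /first ltnS leq_eqVlt.
have [->|jk] := eqVneq j k; first by rewrite eqxx ltnn.
by rewrite (negbTE (_ : (j : nat) != k :> nat)) //=.
Qed.

Lemma mix_first_shift (k : 'I_n) (y w : V) (z : R) :
  mix (first k.+1) (upd y k z) w = mix (first k.+1) (upd y k 0) w + z *: evec k.
Proof.
apply/rowP => i; rewrite !mxE /first; case: (eqVneq i k) => [->|ik].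
  by rewrite ltnSn add0r mulr1.
by rewrite mulr0 addr0.
Qed.

(** The density of the first k coordinates under e^f gamma, with respect to the Gaussian. It is kept
    as a function of the whole row vector that reads only those coordinates. *)
Definition marginal (k : nat) (y : V) : R := \int[gamma]_w expR (f (mix (first k) y w)).

Let tmix k y : tameV (fun w => expR (f (mix (first k) y w))).
Proof. exact: (tame_section_mix (first k) y tE). Qed.

Lemma tame_marginal k : tameV (marginal k).
Proof.
exact: (tame_fubini_F measurable_normv (fun y : V => normr_ge0 y) (gauss_exp hgamma) (tame_mixF (first k) tE)).
Qed.

Lemma marginal_gt0 k y : 0 < marginal k y.
Proof.
apply: (gauss_exp_gt0 hgamma (h := fun w => f (mix (first k) y w))); last exact: tmix.
exact: (tame_section_mix (first k) y (tame_potential hg gM)).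
Qed.

Lemma marginal0 y : marginal 0 y = 1.
Proof.
rewrite -f1; apply: eq_Rintegral => w _; congr (expR (f _)).
by apply/rowP => i; rewrite mxE.
Qed.

Lemma marginal_step (k : 'I_n) y : \int[N01]_z marginal k.+1 (upd y k z) = marginal k y.
Proof.
rewrite /marginal -(tame_gauss_upd hgamma k (tmix k y)).
have t1 := tame_updF k (tmix k y).
rewrite -(@tame_int_prod _ _ V (measurableTypeR R) R (fun y : V => `|y|) (fun z : R => `|z|) measurable_normv (@measurable_norm1 R) (fun z => normr_ge0 z) gamma N01 (gauss_exp hgamma) (@gauss1_exp R) _ t1).
rewrite (@tame_int_prod2 _ _ V (measurableTypeR R) R (fun y : V => `|y|) (fun z : R => `|z|) measurable_normv (@measurable_norm1 R) (fun y => normr_ge0 y) gamma N01 (gauss_exp hgamma) (@gauss1_exp R) _ t1).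
by apply: eq_Rintegral => z _; apply: eq_Rintegral => w _; rewrite mix_first_upd.
Qed.

(** The conditional density of coordinate k given the earlier ones, with respect to the
    one-dimensional Gaussian. *)
Definition cond (k : 'I_n) (y : V) (z : R) : R := marginal k.+1 (upd y k z) / marginal k y.
Definition dmarginal (k : 'I_n) (y : V) : R :=
  \int[gamma]_w (expR (f (mix (first k.+1) y w)) * g (mix (first k.+1) y w) ord0 k).
Definition dcond (k : 'I_n) (y : V) (z : R) : R := dmarginal k (upd y k z) / marginal k y.
(* The map is kept abstract because unification would otherwise unfold the transport map
   when comparing matrix entries. *)
Variable knothe : V -> V.
Hypothesis knotheE : forall y k, knothe y ord0 k = transport (cond k y) (y ord0 k).

Let tg : forall i, tameV (fun y => g y ord0 i) := tame_gradient_coord hg gM.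
Let tEg k : tameV (fun y => expR (f y) * g y ord0 k). Proof. exact: tameM. Qed.

Let cond_gt0 k y z : 0 < cond k y z.
Proof. by rewrite divr_gt0// marginal_gt0. Qed.

Let flip (k : 'I_n) y w z z' : f (mix (first k.+1) (upd y k z) w) <=
  f (mix (first k.+1) (upd y k z') w) + c0 * `|z - z'|.
Proof.
rewrite (mix_first_shift k y w z) (mix_first_shift k y w z').
set p := mix _ _ _.
have := gradient_lip hg gM (p + z *: evec k) (p + z' *: evec k).
rewrite opprD addrACA subrr add0r -scalerBl normrZ => h.
have e1 : `|evec k : V| <= 1.
  by apply/normv_leP => // i; rewrite mxE; case: ifP; rewrite ?normr1 ?normr0.
have := le_trans h (ler_wpM2l c00 (ler_wpM2l (normr_ge0 _) e1)); rewrite mulr1.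
by have := ler_norm (f (p + z *: evec k) - f (p + z' *: evec k)); rewrite -/c0; lra.
Qed.

(** The one-dimensional transport takes a single constant for the logarithmic Lipschitz bound and
    for the bound on the derivative. Here c0 serves the first and M the second, so their sum serves
    both. *)
Let cond_lip k y z z' : cond k y z <= expR ((c0 + M) * `|z - z'|) * cond k y z'.
Proof.
rewrite /cond mulrA ler_wpM2r ?invr_ge0 ?(ltW (marginal_gt0 _ _))//.
rewrite /marginal -(gauss_intZl hgamma); last exact: tmix.
apply: (gauss_int_le hgamma); [exact: tmix|apply: tame_cstM; exact: tmix|].
move=> w; rewrite -expRD ler_expR; have := flip k y w z z'.
by have := mulr_ge0 M0 (normr_ge0 (z - z')); lra.
Qed.

Let integrand (k : 'I_n) y z w := expR (f (mix (first k.+1) (upd y k z) w)).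
Let dintegrand (k : 'I_n) y z w := integrand k y z w * g (mix (first k.+1) (upd y k z) w) ord0 k.

Let dmix (k : 'I_n) y w (z : R) : is_derive z 1 (fun z => integrand k y z w) (dintegrand k y z w).
Proof.
have E z1 : f (mix (first k.+1) (upd y k z1) w) = f (mix (first k.+1) (upd y k 0) w + z1 *: evec k).
  by rewrite mix_first_shift.
have d1 := hg.2 (mix (first k.+1) (upd y k 0) w) (evec k) z.
have d2 := @is_derive1_comp R expR _ z _ _ (is_derive_expR _) d1.
apply: (is_derive_ext d2) => [z1|]; first by rewrite /= /integrand E.
rewrite /dintegrand /integrand E (mix_first_shift k y w z); congr (_ * _).
rewrite /dotv (bigD1 k)//= big1 => [|i ik]; first by rewrite !mxE eqxx mulr1 addr0.
by rewrite [evec k _ _]mxE (negbTE ik) mulr0.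
Qed.

Let dintegrand_le k y a z w : `]a - 1, a + 1[%classic z ->
  `|dintegrand k y z w| <= M * (expR c0 * integrand k y a w).
Proof.
rewrite /= in_itv /= => /andP[az za].
rewrite /dintegrand normrM mulrC; apply: ler_pM => //.
  by apply: le_trans (coord_le_normv _ _) _; exact: gM.
rewrite ger0_norm ?expR_ge0// -expRD ler_expR; apply: le_trans (flip k y w z a) _.
rewrite addrC lerD2r ler_piMr// ler_norml; apply/andP; split; lra.
Qed.

Let tint k y z : tameV (integrand k y z). Proof. exact: tmix. Qed.
Let tdint k y z : tameV (dintegrand k y z).
Proof. exact: (tame_section_mix (first k.+1) (upd y k z) (tEg k)). Qed.
Let tdom k y a : tameV (fun w => M * (expR c0 * integrand k y a w)).
Proof. by apply: tame_cstM; apply: tame_cstM; exact: tint. Qed.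

Let dmarg (k : 'I_n) y (z : R) : is_derive z 1 (fun z => marginal k.+1 (upd y k z)) (dmarginal k (upd y k z)).
Proof.
apply: (@is_derive_Rintegral R _ _ gamma (integrand k y) (dintegrand k y) z (fun w => M * (expR c0 * integrand k y z w))).
- by move=> t w; exact: dmix.
- by move=> t; exact: (gauss_integrable hgamma (tint k y t)).
- by move=> w; rewrite !mulr_ge0 ?expR_ge0.
- exact: (gauss_integrable hgamma (tdom k y z)).
- by move=> t w; exact: dintegrand_le.
Qed.

Let dcondE k y (z : R) : is_derive z 1 (cond k y) (dcond k y z).
Proof.
have h := @is_deriveZ R R^o R^o _ (marginal k y)^-1 z 1 _ (dmarg k y z).
apply: (is_derive_ext h); last by rewrite /dcond mulrC.
by move=> w; rewrite /cond mulrC.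
Qed.

Let cdcond k y : continuous (dcond k y).
Proof.
have c1 : continuous (fun z => dmarginal k (upd y k z)).
  apply: (@continuous_Rintegral R _ _ gamma (dintegrand k y)).
  - by move=> t; exact: (gauss_integrable hgamma (tdint k y t)).
  - move=> w; have cm : continuous (fun z => mix (first k.+1) (upd y k z) w).
      under eq_fun do rewrite mix_first_shift.
      by move=> z; apply: cvgD; [exact: cvg_cst|apply: cvgZr_tmp; exact: cvg_id].
    move=> z; apply: cvgM.
      exact: (is_derive_continuous (dmix k y w)).
    apply: (cvg_comp (fun z => g (mix (first k.+1) (upd y k z) w)) (fun v : V => v ord0 k)); last exact: continuous_coord.
    by apply: (cvg_comp (fun z => mix (first k.+1) (upd y k z) w) g); [exact: cm|exact: hg.1].
  - move=> a; exists (fun w => M * (expR c0 * integrand k y a w)).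
      exact: (gauss_integrable hgamma (tdom k y a)).
    by move=> t w; exact: dintegrand_le.
by move=> z; apply: cvgM; [exact: c1|exact: cvg_cst].
Qed.

Let dcond_le k y z : `|dcond k y z| <= (c0 + M) * cond k y z.
Proof.
rewrite /dcond /cond normrM (ger0_norm (x := _^-1)) ?invr_ge0 ?(ltW (marginal_gt0 _ _))//.
rewrite mulrA ler_wpM2r ?invr_ge0 ?(ltW (marginal_gt0 _ _))//.
apply: (@le_trans _ _ (M * marginal k.+1 (upd y k z))); last first.
  by rewrite ler_wpM2r ?(ltW (marginal_gt0 _ _))// lerDr.
apply: le_trans (gauss_int_norm hgamma (tdint k y z)) _.
rewrite /marginal -(gauss_intZl hgamma); last exact: tint.
apply: (gauss_int_le hgamma); [apply: tame_norm; exact: tdint|apply: tame_cstM; exact: tint|].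
move=> w; rewrite normrM mulrC (ger0_norm (expR_ge0 _)) ler_wpM2r ?expR_ge0//.
by apply: le_trans (coord_le_normv _ _) _; exact: gM.
Qed.

Let cond1 k y : \int[N01]_z cond k y z = 1.
Proof.
rewrite /cond.
have tm : tame1 (fun z => marginal k.+1 (upd y k z)) by exact: (tame_section_upd k y (tame_marginal k.+1)).
under eq_Rintegral do rewrite mulrC.
by rewrite gauss1_intZl// marginal_step mulVf// gt_eqF// marginal_gt0.
Qed.

Definition agree (k : nat) (y y' : V) := forall i : 'I_n, (i < k)%N -> y ord0 i = y' ord0 i.

Lemma marginal_agree k y y' : agree k y y' -> marginal k y = marginal k y'.
Proof.
move=> h; apply: eq_Rintegral => w _; congr (expR (f _)).
by apply/rowP => i; rewrite !mxE /first; case: ifP => // ik; exact: h.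
Qed.

Lemma agree_upd (k : 'I_n) y y' z : agree k y y' -> agree k.+1 (upd y k z) (upd y' k z).
Proof.
move=> h i; rewrite ltnS !mxE; case: eqVneq => // ik ki; apply: h.
by rewrite ltn_neqAle ki andbT.
Qed.

Lemma agree_upd_ge (k : nat) (j : 'I_n) y z : (k <= j)%N -> agree k (upd y j z) y.
Proof.
move=> kj i ik; rewrite mxE; case: eqP => // ij; move: ik.
by rewrite ij ltnNge kj.
Qed.

Lemma agree_mix (k : nat) y w : agree k (mix (first k) y w) y.
Proof. by move=> i ik; rewrite mxE /first ik. Qed.

Lemma cond_agree (k : 'I_n) y y' : agree k y y' -> cond k y = cond k y'.
Proof.
move=> h; apply/funext => z; rewrite /cond (marginal_agree h).
by rewrite (marginal_agree (agree_upd z h)).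
Qed.

Lemma agree_leq j k y y' : (j <= k)%N -> agree k y y' -> agree j y y'.
Proof. by move=> jk h i ij; apply: h; exact: leq_trans jk. Qed.

Lemma knothe_agree (k : 'I_n) y y' : agree k.+1 y y' -> knothe y ord0 k = knothe y' ord0 k.
Proof.
move=> h; have hk := h k (ltnSn k); have ha := agree_leq (leqnSn k) h.
exact: etrans (knotheE y k) (etrans (f_equal2 (fun c z => transport c z) (cond_agree ha) hk) (esym (knotheE y' k))).
Qed.

Lemma knothe_upd (k : 'I_n) y z : knothe (upd y k z) ord0 k = transport (cond k y) z.
Proof.
have ha := agree_upd_ge y z (leqnn k).
by rewrite knotheE (cond_agree ha) mxE eqxx.
Qed.

Let cond_ge0_meas k y : measurable_fun setT (cond k y).
Proof. exact: (continuous_measurable_fun (is_derive_continuous (dcondE k y))). Qed.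

Let cM0 : 0 <= c0 + M. Proof. exact: addr_ge0. Qed.

Lemma measurable_knothe : measurable_fun setT (knothe : V -> V).
Proof.
apply/measurable_rowP => k.
(* The distribution function of [cond k y] at the k-th coordinate depends on y through the density
   and through the endpoint. Written as a Gaussian integral of an indicator times a marginal, it is
   measurable in y by Fubini. *)
pose F (p : V * R) := (p.2 <= p.1 ord0 k)%R%:R * marginal k.+1 (upd p.1 k p.2).
have tF : tameV1 F.
  have tm : tameV1 (fun p => marginal k.+1 (upd p.1 k p.2)) by exact: (tame_updF k (tame_marginal k.+1)).
  apply: (tame_bound _ tm) => [|p].
    apply: measurable_funM; last by case: tm.
    rewrite (_ : (fun p => _) = (fun p : V * R => if p.2 <= p.1 ord0 k then 1 else 0)); last by apply/funext => p; case: ifP.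
    apply: measurable_fun_ifT => //; apply: measurable_fun_ler; first exact: measurable_snd.
    exact: (measurableT_comp (measurable_coord k) measurable_fst).
  by rewrite /F normrM ler_piMl//; case: (p.2 <= _)%R; rewrite ?normr1 ?normr0.
have tI := @tame_fubini_F _ _ V (measurableTypeR R) R (fun y : V => `|y|) (fun z : R => `|z|) (@measurable_norm1 R) (fun z => normr_ge0 z) N01 (@gauss1_exp R) _ tF.
have pE y : cdfm (fun w => cond k y w * phi w) (y ord0 k) = (\int[N01]_z F (y, z)) / marginal k y.
  have tFy : tame1 (fun z => F (y, z)) by exact: (@tame_section _ _ V (measurableTypeR R) R (fun y : V => `|y|) (fun z : R => `|z|) (fun z => normr_ge0 z) _ tF y).
  rewrite mulrC -gauss1_intZl// RintegralN01; last by apply: measurable_funM => //; case: tFy.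
  rewrite /cdfm Rintegral_mkcond; apply: eq_Rintegral => z _.
  rewrite patchE (_ : (z \in _) = (z <= y ord0 k)%R); last by apply/idP/idP; rewrite inE /= in_itv.
  rewrite /F /cond /=.
  by case: (z <= y ord0 k); rewrite ?mul1r ?mul0r ?mulr0 ?mul0r// (mulrC (_^-1)).
rewrite (_ : (fun y => _) = (fun y => quant phi (cdfm (fun w => cond k y w * phi w) (y ord0 k)))); last first.
  by apply/funext => y; rewrite knotheE.
apply: (measurable_quant (@phi_gt0 R) (@phi_continuous R)).
- exact: integrable_normal_pdf.
- by rewrite /Rintegral integral_normal_pdf.
(* The reciprocal is written as e^(- ln), which reduces its measurability to that of the
   logarithm. *)
- rewrite (_ : (fun y => _) = (fun y => (\int[N01]_z F (y, z)) * expR (- ln (marginal k y)))).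
    apply: measurable_funM; first by case: tI.
    apply: measurableT_comp => //; apply: measurableT_comp => //; apply: measurableT_comp; first exact: measurable_ln.
    by case: (tame_marginal k).
  by apply/funext => y; rewrite pE expRN lnK// posrE marginal_gt0.
- by move=> y; apply: (cdfm_density01 cM0) => //.
Qed.

Let cond_transport_meas k y : measurable_fun setT (transport (cond k y)).
Proof.
apply: continuous_measurable_fun; apply: is_derive_continuous => z.
by apply: (transport_derive cM0) => //; exact: cond_lip.
Qed.

Let cond_law k y (B : set R) : measurable B ->
  (\int[N01]_z (\1_B (transport (cond k y) z) * cond k y z)%:E = N01 B)%E.
Proof.
move=> mB; apply: (transport_law cM0) => //.
Qed.

(** Induction on the number of coordinates. The factors of index below j and the marginal of order j
    do not see the coordinate j; integrating that coordinate against its conditional density turns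
    its indicator into the Gaussian mass of [A j]. *)
Let knothe_box (A : 'I_n -> set R) : (forall i, measurable (A i)) -> forall j, (j <= n)%N ->
  (\int[gamma]_y (\prod_(i < n | (i < j)%N) \1_(A i) (knothe y ord0 i) * marginal j y)%:E =
   \prod_(i < n | (i < j)%N) N01 (A i))%E.
Proof.
move=> mA.
pose P j y : R := \prod_(i < n | (i < j)%N) \1_(A i) (knothe y ord0 i).
have P0 j y : 0 <= P j y by apply: prodr_ge0.
have mK i : measurable_fun setT (fun y => knothe y ord0 i) by move/measurable_rowP : measurable_knothe; apply.
have mP j : measurable_fun setT (P j).
  rewrite (_ : P j = fun y => \prod_(i < n) (if (i < j)%N then \1_(A i) (knothe y ord0 i) else 1)); last first.
    by apply/funext => y; rewrite /P big_mkcond.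
  apply: measurable_prod => i _; case: (i < j)%N => //.
  by apply: (measurableT_comp (measurable_indic (mA i))); exact: mK.
elim=> [|j ih] jn.
  rewrite big_pred0; last by move=> i; rewrite ltn0.
  under eq_integral do rewrite big_pred0 ?mul1r ?marginal0//.
  by rewrite integral_cst//= probability_setT mule1.
pose J := Ordinal jn.
have PS y : P j.+1 y = \1_(A J) (knothe y ord0 J) * P j y.
  rewrite /P (bigD1 J)//=; congr (_ * _); apply: eq_bigl => i.
  by rewrite ltnS [(i < j)%N]ltn_neqAle andbC.
have mm k : measurable_fun setT (marginal k) by case: (tame_marginal k).
rewrite -(ge0_gauss_upd hgamma J); last 2 first.
- by apply/measurable_EFinP; apply: measurable_funM; [exact: mP|exact: mm].
- by move=> y; rewrite lee_fin mulr_ge0 ?P0// ltW// marginal_gt0.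
have -> : (\prod_(i < n | (i < j.+1)%N) N01 (A i) = N01 (A J) * \prod_(i < n | (i < j)%N) N01 (A i))%E.
  rewrite (bigD1 J)//=; congr (_ * _)%E; apply: eq_bigl => i.
  by rewrite ltnS [(i < j)%N]ltn_neqAle andbC.
rewrite -ih ?(ltnW jn)// -ge0_integralZl//; last 2 first.
- by apply/measurable_EFinP; apply: measurable_funM; [exact: mP|exact: mm].
- by move=> y _; rewrite lee_fin mulr_ge0 ?P0// ltW// marginal_gt0.
apply: eq_integral => y _.
have PJ z : P j (upd y J z) = P j y.
  apply: eq_bigr => i ij.
  have e : knothe (upd y J z) ord0 i = knothe y ord0 i.
    exact: (@knothe_agree i (upd y J z) y (@agree_upd_ge i.+1 J y z ij)).
  by rewrite e.
transitivity (\int[N01]_z ((P j y * marginal j y)%:E * (\1_(A J) (transport (cond J y) z) * cond J y z)%:E))%E.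
  apply: eq_integral => z _; rewrite -EFinM; congr EFin.
  rewrite -/(P j.+1 (upd y J z)) PS PJ knothe_upd /cond.
  by field; rewrite gt_eqF// marginal_gt0.
rewrite ge0_integralZl//; last 3 first.
- apply/measurable_EFinP; apply: measurable_funM; last exact: cond_ge0_meas.
  by apply: (measurableT_comp (measurable_indic (mA J))); exact: cond_transport_meas.
- by move=> z _; rewrite lee_fin mulr_ge0// ltW.
- by rewrite lee_fin mulr_ge0 ?P0// ltW// marginal_gt0.
by rewrite cond_law// muleC.
Qed.

Lemma knothe_law (B : set V) : measurable B ->
  (\int[gamma]_y (\1_B (knothe y) * expR (f y))%:E = gamma B)%E.
Proof.
move=> mB.
have mE : measurable_fun setT (fun y => expR (f y)) by case: tE.
have [nu nuE] := exists_density gamma mE (fun y => expR_ge0 (f y)).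
have nuI (C : set V) : measurable C -> nu (knothe @^-1` C) = (\int[gamma]_y (\1_C (knothe y) * expR (f y))%:E)%E.
  move=> mC; rewrite nuE integral_mkcond; apply: eq_integral => y _.
  rewrite /patch indicE; have -> : (y \in knothe @^-1` C) = (knothe y \in C) by apply/idP/idP; rewrite !inE.
  by case: ifP; rewrite ?mul1r ?mul0r.
rewrite -nuI//; apply: (law_transfer measurable_knothe) => // A mA.
rewrite nuI; last exact: box_measurable.
rewrite hgamma//.
have := knothe_box mA (leqnn n).
rewrite (eq_bigl predT) => [<-|i]; last by rewrite ltn_ord.
apply: eq_integral => y _; congr (_ * _)%:E; last first.
  rewrite /marginal (_ : (fun w => _) = fun=> expR (f y)) ?gauss_cst//.
  by apply/funext => w; congr (expR (f _)); apply/rowP => i; rewrite mxE /first ltn_ord.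
rewrite (eq_bigl predT) => [|i]; last by rewrite ltn_ord.
rewrite indicE; case: (boolP (_ \in _)) => [|h].
  by rewrite inE /= => h; rewrite big1// => i _; rewrite indicE mem_set.
have [i hi] : exists i, ~ A i (knothe y ord0 i).
  by apply/existsNP => h'; move: h; rewrite notin_setE /=; apply.
by rewrite (bigD1 i)//= indicE memNset// mul0r.
Qed.

Variable u : V.

Let resid (k : 'I_n) (y : V) := (y ord0 k - u ord0 k - knothe y ord0 k) ^+ 2.

Let mresid k : measurable_fun setT (resid k).
Proof.
apply: measurable_funX; apply: measurable_funB.
  by apply: measurable_funB => //; exact: measurable_coord.
by move/measurable_rowP : measurable_knothe; apply.
Qed.

Let mmarg k : measurable_fun setT (marginal k). Proof. by case: (tame_marginal k). Qed.

Let tdmarg k : tameV (dmarginal k).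
Proof.
exact: (tame_fubini_F measurable_normv (fun y : V => normr_ge0 y) (gauss_exp hgamma) (tame_mixF (first k.+1) (tEg k))).
Qed.

(** The marginal density times the squared difference between its score in direction k and
    [u ord0 k]: the integrand of a relative Fisher information of the marginal. *)
Let ratio k y := (dmarginal k y - u ord0 k * marginal k.+1 y) ^+ 2 / marginal k.+1 y.

Let mratio k : measurable_fun setT (ratio k).
Proof.
rewrite (_ : ratio k = fun y => (dmarginal k y - u ord0 k * marginal k.+1 y) ^+ 2 * expR (- ln (marginal k.+1 y))).
  apply: measurable_funM.
    by apply: measurable_funX; apply: measurable_funB; [case: (tdmarg k)|exact: measurable_funM].
  by apply: measurableT_comp => //; apply: measurableT_comp => //; apply: measurableT_comp; first exact: measurable_ln.
by apply/funext => y; rewrite /ratio expRN lnK// posrE marginal_gt0.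
Qed.

(** Fisher information does not increase under marginals: the score of the marginal is the
    conditional mean of the score, and the integral of e^f (h - d/m)^2 is nonnegative. *)
Let cauchy_schwarz k y : ratio k y <=
  \int[gamma]_w (expR (f (mix (first k.+1) y w)) * (g (mix (first k.+1) y w) ord0 k - u ord0 k) ^+ 2).
Proof.
pose e w := expR (f (mix (first k.+1) y w)); pose h w := g (mix (first k.+1) y w) ord0 k - u ord0 k.
have te : tameV e by exact: tmix.
have th : tameV h.
  apply: tameB => //; last exact: tame_cst.
  exact: (tame_section_mix (first k.+1) y (tg k)).
have teh : tameV (fun w => e w * h w) by exact: tameM.
have teh2 : tameV (fun w => e w * h w ^+ 2) by apply: tameM => //; exact: tameX.
pose m := marginal k.+1 y; have m0 : 0 < m by exact: marginal_gt0.
have mE : \int[gamma]_w e w = m by [].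
pose d := \int[gamma]_w (e w * h w).
have dE : dmarginal k y - u ord0 k * m = d.
  rewrite /d /h; under [in RHS]eq_Rintegral do rewrite mulrBr.
  rewrite (gauss_intB hgamma); last 2 first.
  - exact: (tame_section_mix (first k.+1) y (tEg k)).
  - by apply: tameM => //; exact: tame_cst.
  by rewrite (gauss_intZr hgamma)// mE mulrC.
rewrite /ratio -/m dE -/(e _).
have : 0 <= \int[gamma]_w (e w * h w ^+ 2 - 2 * (d / m) * (e w * h w) + (d / m) ^+ 2 * e w).
  apply: Rintegral_ge0 => w _; rewrite (_ : _ + _ = e w * (h w - d / m) ^+ 2); last by ring.
  by rewrite mulr_ge0 ?sqr_ge0// expR_ge0.
rewrite (gauss_intD hgamma); [|apply: tameB => //; exact: tame_cstM|exact: tame_cstM].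
rewrite (gauss_intB hgamma)//; last exact: tame_cstM.
rewrite !(gauss_intZl hgamma)// mE -/d => h1.
rewrite -subr_ge0; apply: le_trans h1 _; rewrite le_eqVlt; apply/orP; left; apply/eqP.
by rewrite /e /h; field; rewrite gt_eqF.
Qed.

(** The residual reads only the coordinates up to k, so the later ones are integrated out of e^f.
    For fixed earlier coordinates the claim is [transport_cost] for the conditional density,
    multiplied by the marginal, and [cauchy_schwarz] returns from the marginal score to the full
    gradient. *)
Let coord_cost k : (\int[gamma]_y (resid k y * expR (f y))%:E <=
  \int[gamma]_y (expR (f y) * (g y ord0 k - u ord0 k) ^+ 2)%:E)%E.
Proof.
have mE : measurable_fun setT (fun y => expR (f y)) by case: tE.
have m0 y : 0 < marginal k.+1 y by exact: marginal_gt0.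
have r0 y : 0 <= resid k y by exact: sqr_ge0.
have q0 y : 0 <= ratio k y by rewrite divr_ge0 ?sqr_ge0// ltW.
have -> : (\int[gamma]_y (resid k y * expR (f y))%:E = \int[gamma]_y (resid k y * marginal k.+1 y)%:E)%E.
  rewrite -(ge0_gauss_mix hgamma (first k.+1)); last 2 first.
  - by apply/measurable_EFinP; exact: measurable_funM.
  - by move=> y; rewrite lee_fin mulr_ge0// expR_ge0.
  apply: eq_integral => y _.
  transitivity (\int[gamma]_w ((resid k y)%:E * (expR (f (mix (first k.+1) y w)))%:E))%E.
    apply: eq_integral => w _; rewrite -EFinM /resid.
    have e : knothe (mix (first k.+1) y w) ord0 k = knothe y ord0 k.
      exact: (@knothe_agree k _ y (@agree_mix k.+1 y w)).
    rewrite e.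
    by rewrite mxE /first ltnSn.
  rewrite ge0_integralZl//; last 2 first.
  - by apply/measurable_EFinP; case: (tmix k.+1 y).
  - by rewrite lee_fin.
  by rewrite (tame_fin measurable_normv (gauss_exp hgamma) (tmix k.+1 y)) -EFinM.
apply: (@le_trans _ _ (\int[gamma]_y (ratio k y)%:E)%E); last first.
  rewrite -[leRHS](ge0_gauss_mix hgamma (first k.+1)); last 2 first.
  - apply/measurable_EFinP; apply: measurable_funM => //; apply: measurable_funX; apply: measurable_funB => //.
    by case: (tg k).
  - by move=> y; rewrite lee_fin mulr_ge0 ?expR_ge0 ?sqr_ge0.
  have tI : tameV (fun y => expR (f y) * (g y ord0 k - u ord0 k) ^+ 2).
    by apply: tameM => //; apply: tameX => //; apply: tameB => //; exact: tame_cst.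
  apply: ge0_le_integral => //.
  - by move=> y _; rewrite lee_fin.
  - exact/measurable_EFinP.
  - apply: (@measurable_integral_snd _ _ V V R gamma (fun p => (expR (f (mix (first k.+1) p.1 p.2)) * (g (mix (first k.+1) p.1 p.2) ord0 k - u ord0 k) ^+ 2)%:E)).
      by apply/measurable_EFinP; case: (tame_mixF (first k.+1) tI).
    by move=> p; rewrite lee_fin mulr_ge0 ?expR_ge0 ?sqr_ge0.
  - move=> y _; rewrite (tame_fin measurable_normv (gauss_exp hgamma) (tame_section_mix (first k.+1) y tI)) lee_fin.
    exact: cauchy_schwarz.
rewrite -(ge0_gauss_upd hgamma k); last 2 first.
- by apply/measurable_EFinP; exact: measurable_funM.
- by move=> y; rewrite lee_fin mulr_ge0// ltW.
rewrite -[leRHS](ge0_gauss_upd hgamma k); last 2 first.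
- exact/measurable_EFinP.
- by move=> y; rewrite lee_fin.
have mupd (F : V -> R) : measurable_fun setT F -> (forall y, 0 <= F y) ->
    measurable_fun setT (fun y => \int[N01]_z (F (upd y k z))%:E)%E.
  move=> mF F0; apply: (@measurable_integral_snd _ _ V (measurableTypeR R) R N01 (fun p : V * R => (F (upd p.1 k p.2))%:E)).
    by apply/measurable_EFinP; exact: (measurableT_comp mF (measurable_upd k)).
  by move=> p; rewrite lee_fin.
apply: ge0_le_integral => //.
- by move=> y _; apply: integral_ge0 => z _; rewrite lee_fin mulr_ge0// ltW.
- by apply: (mupd (fun y => resid k y * marginal k.+1 y)) => [|y]; [exact: measurable_funM|rewrite mulr_ge0// ltW].
- exact: mupd.
move=> y _.
have my : 0 < marginal k y by exact: marginal_gt0.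
have hc := transport_cost cM0 (cond_gt0 k y) (dcondE k y) (@cdcond k y) (dcond_le k y) (cond_lip k y) (cond1 k y) (u ord0 k).
have -> : (\int[N01]_z (resid k (upd y k z) * marginal k.+1 (upd y k z))%:E =
   (marginal k y)%:E * \int[N01]_z ((z - u ord0 k - transport (cond k y) z) ^+ 2 * cond k y z)%:E)%E.
  rewrite -ge0_integralZl//; last 3 first.
  - apply/measurable_EFinP; apply: measurable_funM; last exact: cond_ge0_meas.
    apply: measurable_funX; apply: measurable_funB; last exact: cond_transport_meas.
    exact: measurable_funB.
  - by move=> z _; rewrite lee_fin mulr_ge0 ?sqr_ge0// ltW.
  - by rewrite lee_fin ltW.
  apply: eq_integral => z _; rewrite -EFinM; congr EFin.
  rewrite /resid knothe_upd mxE eqxx /cond; field; rewrite gt_eqF//.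
have -> : (\int[N01]_z (ratio k (upd y k z))%:E =
   (marginal k y)%:E * \int[N01]_z ((dcond k y z - u ord0 k * cond k y z) ^+ 2 / cond k y z)%:E)%E.
  have E z : ratio k (upd y k z) = marginal k y * ((dcond k y z - u ord0 k * cond k y z) ^+ 2 / cond k y z).
    by rewrite /ratio /dcond /cond; field; rewrite !gt_eqF.
  rewrite -ge0_integralZl//; last 3 first.
  - apply/measurable_EFinP.
    rewrite (_ : (fun z => _) = fun z => (marginal k y)^-1 * ratio k (upd y k z)); last first.
      by apply/funext => z; rewrite E mulKf// gt_eqF.
    apply: measurable_funM => //; apply: (measurableT_comp (mratio k)).
    apply/measurable_rowP => i; rewrite (_ : (fun z => _) = fun z => if i == k then z else y ord0 i); last first.
      by apply/funext => z; rewrite mxE.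
    by case: (i == k).
  - by move=> z _; rewrite lee_fin divr_ge0 ?sqr_ge0// ltW.
  - by rewrite lee_fin ltW.
  by apply: eq_integral => z _; rewrite -EFinM E.
by rewrite lee_pmul2l// ?lte_fin.
Qed.

Lemma knothe_cost :
  (\int[gamma]_y (dotv (y - u - knothe y) (y - u - knothe y) * expR (f y))%:E <=
   \int[gamma]_y (expR (f y) * dotv (g y - u) (g y - u))%:E)%E.
Proof.
have mE : measurable_fun setT (fun y => expR (f y)) by case: tE.
have -> : (\int[gamma]_y (dotv (y - u - knothe y) (y - u - knothe y) * expR (f y))%:E =
   \sum_(k < n) \int[gamma]_y (resid k y * expR (f y))%:E)%E.
  rewrite -ge0_integral_sum//; last 2 first.
  - by move=> k; apply/measurable_EFinP; exact: measurable_funM.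
  - by move=> k y _; rewrite lee_fin mulr_ge0 ?sqr_ge0// expR_ge0.
  apply: eq_integral => y _; rewrite sumEFin; congr EFin.
  by rewrite /dotv mulr_suml; apply: eq_bigr => k _; rewrite /resid !mxE expr2.
have -> : (\int[gamma]_y (expR (f y) * dotv (g y - u) (g y - u))%:E =
   \sum_(k < n) \int[gamma]_y (expR (f y) * (g y ord0 k - u ord0 k) ^+ 2)%:E)%E.
  rewrite -ge0_integral_sum//; last 2 first.
  - move=> k; apply/measurable_EFinP; apply: measurable_funM => //; apply: measurable_funX; apply: measurable_funB => //.
    by case: (tg k).
  - by move=> k y _; rewrite lee_fin mulr_ge0 ?expR_ge0 ?sqr_ge0.
  apply: eq_integral => y _; rewrite sumEFin; congr EFin.
  by rewrite /dotv mulr_sumr; apply: eq_bigr => k _; rewrite !mxE expr2.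
by apply: lee_sum => k _; exact: coord_cost.
Qed.

End knothe.

(** * Laplace transforms of tilts and their barycentres *)

Section laplace.
Context {R : realType} {n : nat}.
Local Notation V := 'rV[R]_n.
Local Notation N01 := (normal_prob (0:R) 1).
Local Notation mu := (@lebesgue_measure R).
Local Notation phi := (normal_pdf (0:R) 1).
Variable gamma : probability V R.
Hypothesis hgamma : std_gaussian gamma.
Local Notation tameV := (tame (fun y : V => `|y|)).
Local Notation tame1 := (tame (fun z : R => `|z|)).
Variables (f : V -> R) (g : V -> V) (M : R).
Hypothesis hg : has_gradient f g.
Hypothesis gM : forall y, `|g y| <= M.

Definition tiltf (x : V) : V -> R := fun y => f y + dotv x y.

Lemma tilt_gradient x : has_gradient (tiltf x) (fun y => g y + x).
Proof.
have [cg dg] := hg; split; first by move=> y; have h := cvgD (@cg y) (cvg_cst x); exact: h.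
move=> y v t; rewrite dotvDl.
have d0 : is_derive t 1 (fun s : R => dotv x (y + s *: v)) (dotv x v).
  have h := @is_deriveD R R^o R^o _ _ t 1 _ _ (is_derive_cst (dotv x y) t 1)
    (@is_deriveM R R^o id (fun=> dotv x v) t 1 _ _ (is_derive_id t 1) (is_derive_cst _ _ _)).
  apply: (is_derive_ext h) => [s|]; first by rewrite !dotvE.
  by rewrite /GRing.scale /= mulr0 mulr1 !add0r.
exact: (@is_deriveD R R^o R^o _ _ t 1 _ _ (dg y v t) d0).
Qed.

Lemma tilt_gradient_le x y : `|g y + x| <= M + `|x|.
Proof. by apply: le_trans (ler_normD _ _) _; rewrite lerD2r. Qed.

Let tE x : tameV (fun y => expR (tiltf x y)) := tame_exp_potential (tilt_gradient x) (tilt_gradient_le x).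

Let tg : forall i, tameV (fun y => g y ord0 i) := tame_gradient_coord hg gM.
Let M0 : 0 <= M := gradient_bound_ge0 gM.

(** The unnormalised mean of P under the tilt by x; at P = 1 it is the Laplace transform of e^f
    gamma. *)
Definition lap (P : V -> R) (x : V) : R := \int[gamma]_y (P y * expR (tiltf x y)).

Lemma lap_gt0 x : 0 < lap (fun=> 1) x.
Proof.
rewrite /lap; under eq_Rintegral do rewrite mul1r.
by apply: (gauss_exp_gt0 hgamma) => //; exact: tame_potential (tilt_gradient x) (tilt_gradient_le x).
Qed.

Lemma tame_lapF P x : tameV P -> tameV (fun y => P y * expR (tiltf x y)).
Proof. by move=> tP; apply: tameM. Qed.

Lemma tiltf_upd x i z y : tiltf (upd x i z) y = tiltf (upd x i 0) y + z * y ord0 i.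
Proof.
rewrite /tiltf -addrA; congr (_ + _); rewrite /dotv [LHS](bigD1 i)// [in RHS](bigD1 i)//= !mxE eqxx mul0r add0r addrC.
by congr (_ + _); apply: eq_bigr => j ji; rewrite !mxE (negbTE ji).
Qed.

Lemma lap_derive P x i (z : R) : tameV P ->
  is_derive z 1 (fun z => lap P (upd x i z)) (lap (fun y => P y * y ord0 i) (upd x i z)).
Proof.
move=> tP.
have tn : tameV (fun y : V => expR (1 * `|y|)).
  by apply: (@tame_expR _ _ _ _ _ 0 1) => //= [|y]; [apply: measurable_funM => //; exact: measurable_normv|rewrite add0r].
(* Moving the i-th coordinate of the tilt by less than 1 changes the exponent by at most [|y|],
   hence the extra factor of the dominating function. *)
apply: (@is_derive_Rintegral R _ _ gamma (fun z y => P y * expR (tiltf (upd x i z) y))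
  (fun z y => P y * y ord0 i * expR (tiltf (upd x i z) y)) z
  (fun y => `|P y| * `|y| * (expR (tiltf (upd x i z) y) * expR (1 * `|y|)))).
- move=> t y.
  have d1 : is_derive t 1 (fun z => tiltf (upd x i z) y) (y ord0 i).
    have h := @is_deriveD R R^o R^o _ _ t 1 _ _ (is_derive_cst (tiltf (upd x i 0) y) t 1)
      (@is_deriveM R R^o id (fun=> y ord0 i) t 1 _ _ (is_derive_id t 1) (is_derive_cst _ _ _)).
    apply: (is_derive_ext h) => [s|]; first by rewrite (tiltf_upd x i s y).
    by rewrite /GRing.scale /= mulr0 mulr1 !add0r.
  have d2 := @is_derive1_comp R expR _ t _ _ (is_derive_expR _) d1.
  have d3 := @is_deriveZ R R^o R^o _ (P y) t 1 _ d2.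
  apply: (is_derive_ext d3) => //; rewrite /GRing.scale /=; ring.
- by move=> t; apply: (gauss_integrable hgamma); exact: tame_lapF.
- by move=> y; rewrite !mulr_ge0 ?expR_ge0.
- apply: (gauss_integrable hgamma); apply: tameM => //; first by apply: tameM => //; [exact: tame_norm|exact: tame_normV].
  exact: tameM.
- move=> t y; rewrite /= in_itv /= => /andP[zt tz].
  rewrite !normrM; apply: ler_pM => //.
    by rewrite ler_wpM2l// coord_le_normv.
  rewrite ger0_norm ?expR_ge0// -expRD ler_expR (tiltf_upd x i t) (tiltf_upd x i z) mul1r.
  suff : t * y ord0 i <= z * y ord0 i + `|y| by lra.
  rewrite -lerBlDl -mulrBl.
  apply: le_trans (ler_norm _) _; rewrite normrM.
  apply: le_trans (ler_wpM2l (normr_ge0 _) (coord_le_normv y i)) _.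
  rewrite ler_piMl// ler_norml; apply/andP; split; lra.
Qed.

Lemma measurable_lap P : tameV P -> (forall y, 0 <= P y) -> measurable_fun setT (lap P).
Proof.
move=> [mP _] P0.
have mF : measurable_fun setT (fun p : V * V => (P p.2 * expR (tiltf p.1 p.2))%:E).
  apply/measurable_EFinP; apply: measurable_funM; first exact: (measurableT_comp mP measurable_snd).
  apply: measurableT_comp => //; apply: measurable_funD.
    exact: (measurableT_comp (continuous_measurable_rV (gradient_cont hg gM)) measurable_snd).
  by apply: measurable_dotv; [exact: measurable_fst|exact: measurable_snd].
have h := @measurable_integral_snd _ _ V V R gamma _ mF (fun p => _).
have h' : measurable_fun setT (fun x => \int[gamma]_y (P y * expR (tiltf x y))%:E)%E.
  by apply: h => p; rewrite lee_fin mulr_ge0 ?expR_ge0.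
by apply: (measurableT_comp _ h'); exact: fine_measurable.
Qed.

Lemma measurable_lap_coord i : measurable_fun setT (lap (fun y => g y ord0 i)).
Proof.
have tc : tameV (fun _ : V => M) by exact: tame_cst.
have t1 : tameV (fun _ : V => 1) by exact: tame_cst.
(* Adding M makes the integrand nonnegative, as [measurable_lap] requires. *)
have -> : lap (fun y => g y ord0 i) = fun x => lap (fun y => g y ord0 i + M) x - M * lap (fun=> 1) x.
  apply/funext => x; rewrite /lap -(gauss_intZl hgamma); last exact: tame_lapF.
  rewrite -(gauss_intB hgamma); last 2 first.
  - by apply: tame_lapF; exact: tameD.
  - by apply: tame_cstM; exact: tame_lapF.
  by apply: eq_Rintegral => y _; ring.
apply: measurable_funB.
  apply: measurable_lap; first exact: tameD.
  move=> y; have := le_trans (coord_le_normv (g y) i) (gM y).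
  by rewrite ler_norml => /andP[]; lra.
by apply: measurable_funM => //; apply: measurable_lap.
Qed.

(** Gaussian integration by parts in the coordinate i, applied to e^(f + <x, y>), whose logarithmic
    gradient is g + x. After division it says that the mean of g under the tilt is the centroid
    minus x. *)
Lemma lap_ibp x i : lap (fun y => y ord0 i) x = lap (fun y => g y ord0 i) x + x ord0 i * lap (fun=> 1) x.
Proof.
have tc := @tame_coord R n i.
have t1 : tameV (fun _ : V => 1) by exact: tame_cst.
have tG : tameV (fun y => expR (tiltf x y) * (g y + x) ord0 i).
  by apply: tameM => //; exact: (tame_gradient_coord (tilt_gradient x) (tilt_gradient_le x)).
have : \int[gamma]_y (expR (tiltf x y) * (g y + x) ord0 i - y ord0 i * expR (tiltf x y)) = 0.
  rewrite -(tame_gauss_upd hgamma i); last by apply: tameB => //; exact: tameM.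
  rewrite (_ : (fun y => _) = fun=> 0) ?gauss_cst//; apply/funext => y.
  have E z : tiltf x (upd y i z) = tiltf x (upd y i 0 + z *: evec i).
    congr tiltf; apply/rowP => j; rewrite !mxE; case: (eqVneq j i) => _.
      by rewrite add0r mulr1.
    by rewrite mulr0 addr0.
  have dd (z : R) : is_derive z 1 (fun z => expR (tiltf x (upd y i z)))
      (expR (tiltf x (upd y i z)) * (g (upd y i z) + x) ord0 i).
    have d1 := (tilt_gradient x).2 (upd y i 0) (evec i) z.
    have d2 := @is_derive1_comp R expR _ z _ _ (is_derive_expR _) d1.
    apply: (is_derive_ext d2) => [z1|]; first by rewrite /= E.
    rewrite E; congr (_ * _).
    have -> : upd y i 0 + z *: evec i = upd y i z.
      apply/rowP => j; rewrite !mxE; case: (eqVneq j i) => _; first by rewrite add0r mulr1.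
      by rewrite mulr0 addr0.
    rewrite /dotv (bigD1 i)//= big1 => [|j ji]; first by rewrite [evec i _ _]mxE eqxx mulr1 addr0.
    by rewrite [evec i _ _]mxE (negbTE ji) mulr0.
  under eq_Rintegral => z _ do rewrite [upd y i z ord0 i]mxE eqxx.
  apply: (gauss1_ibp dd).
    - move=> z; apply: cvgM; first exact: (is_derive_continuous dd).
      apply: (cvg_comp (fun z => g (upd y i z) + x) (fun v : V => v ord0 i)); last exact: continuous_coord.
      apply: cvgD; last exact: cvg_cst.
      apply: (cvg_comp (fun z => upd y i z) g); last exact: hg.1.
      rewrite (_ : upd y i = fun z => upd y i 0 + z *: evec i).
        by apply: cvgD; [exact: cvg_cst|apply: cvgZr_tmp; exact: cvg_id].
      apply/funext => t; apply/rowP => j; rewrite !mxE; case: (eqVneq j i) => _; first by rewrite add0r mulr1.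
      by rewrite mulr0 addr0.
    - exact: (tame_section_upd i y (tE x)).
    - exact: (tame_section_upd i y tG).
rewrite (gauss_intB hgamma)//; last exact: tameM.
move=> /eqP; rewrite subr_eq0 => /eqP h.
rewrite {1}/lap -h /lap -(gauss_intZl hgamma); last exact: tame_lapF.
rewrite -(gauss_intD hgamma); last 2 first.
- exact: tame_lapF.
- by apply: tame_cstM; exact: tame_lapF.
by apply: eq_Rintegral => y _; rewrite mxE; ring.
Qed.

(* By [baryE] and [bary_derive], excess i is the variance of the i-th coordinate minus one, and the
   i-th partial derivative of bary i. *)
Definition bary i x := lap (fun y => g y ord0 i) x / lap (fun=> 1) x.
Definition excess i x := lap (fun y => y ord0 i * y ord0 i) x / lap (fun=> 1) x
  - (lap (fun y => y ord0 i) x / lap (fun=> 1) x) ^+ 2 - 1.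

Lemma baryE i x : bary i x = lap (fun y => y ord0 i) x / lap (fun=> 1) x - x ord0 i.
Proof. by rewrite /bary lap_ibp; field; rewrite gt_eqF// lap_gt0. Qed.

Lemma bary_derive x i (z : R) :
  is_derive z 1 (fun z => bary i (upd x i z)) (excess i (upd x i z)).
Proof.
have t1 : tameV (fun _ : V => 1) by exact: tame_cst.
have d1 := lap_derive x i z (tame_coord i).
have d0 := lap_derive x i z t1.
have p0 : lap (fun=> 1) (upd x i z) != 0 by rewrite gt_eqF// lap_gt0.
have dV := @is_deriveV R (fun z => lap (fun=> 1) (upd x i z)) z _ 1 p0 d0.
have dM := @is_deriveM R R^o _ _ z 1 _ _ d1 dV.
have dB := @is_deriveB R R^o R^o _ _ z 1 _ _ dM (is_derive_id z 1).
apply: (is_derive_ext dB) => [s|]; first by rewrite baryE mxE eqxx.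
rewrite /excess /GRing.scale /= (_ : (fun y : V => 1 * y ord0 i) = fun y => y ord0 i); last by apply/funext => y; rewrite mul1r.
by field.
Qed.

Lemma excess_continuous x i : continuous (fun z => excess i (upd x i z)).
Proof.
have t1 : tameV (fun _ : V => 1) by exact: tame_cst.
have tc := @tame_coord R n i.
have c (P : V -> R) : tameV P -> continuous (fun z => lap P (upd x i z)).
  by move=> tP; exact: (is_derive_continuous (fun z => lap_derive x i z tP)).
have cV z : (lap (fun=> 1) (upd x i w))^-1 @[w --> z] --> (lap (fun=> 1) (upd x i z))^-1.
  by apply: cvgV; [rewrite gt_eqF// lap_gt0|exact: c].
have cr (P : V -> R) : tameV P -> continuous (fun z => lap P (upd x i z) / lap (fun=> 1) (upd x i z)).
  by move=> tP z; apply: cvgM; [exact: c|exact: cV].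
move=> z; apply: cvgB; last exact: cvg_cst.
apply: cvgB; first by apply: (cr (fun y => y ord0 i * y ord0 i)); exact: tameM.
by apply: cvgM; exact: (cr (fun y => y ord0 i)).
Qed.

End laplace.

(** * The divergence identity on a ball *)

Section ball.
Context {R : realType} {n : nat}.
Local Notation V := 'rV[R]_n.
Local Notation N01 := (normal_prob (0:R) 1).
Local Notation mu := (@lebesgue_measure R).
Local Notation phi := (normal_pdf (0:R) 1).
Variable gamma : probability V R.
Hypothesis hgamma : std_gaussian gamma.
Local Notation tameV := (tame (fun y : V => `|y|)).
Local Notation tame1 := (tame (fun z : R => `|z|)).
Variables (f : V -> R) (g : V -> V) (M : R).
Hypothesis hg : has_gradient f g.
Hypothesis gM : forall y, `|g y| <= M.

Local Notation lap := (lap gamma f).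
Local Notation bary := (bary gamma f g).
Local Notation excess := (excess gamma f).

Let M0 : 0 <= M := gradient_bound_ge0 gM.
Let tE x : tameV (fun y => expR (tiltf f x y)) := tame_exp_potential (tilt_gradient hg x) (tilt_gradient_le gM x).
Let tg : forall i, tameV (fun y => g y ord0 i) := tame_gradient_coord hg gM.
Let tc1 : tameV (fun _ : V => 1). Proof. exact: tame_cst. Qed.
Let l0 x : 0 < lap (fun=> 1) x := lap_gt0 hgamma hg gM x.

Lemma bary_le i x : `|bary i x| <= M.
Proof.
rewrite /bary normrM normfV (gtr0_norm (l0 x)) ler_pdivrMr//.
apply: le_trans (gauss_int_norm hgamma (tame_lapF hg gM x (tg i))) _.
rewrite /lap -(gauss_intZl hgamma); last exact: (tame_lapF hg gM x tc1).
apply: (gauss_int_le hgamma).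
- by apply: tame_norm; exact: (tame_lapF hg gM x (tg i)).
- by apply: tame_cstM; exact: (tame_lapF hg gM x tc1).
move=> y; rewrite normrM mul1r (ger0_norm (expR_ge0 _)) ler_wpM2r ?expR_ge0//.
by apply: le_trans (coord_le_normv _ _) _; exact: gM.
Qed.

(** For x in the ball the weight lies between e^(f - c |y|) and e^(f + c |y|), which bounds the
    denominator from below and the numerator from above. The estimate is crude and serves the
    integrability of the ball terms. *)
Lemma excess_bounded i rho : 0 <= rho -> exists C, forall x : V, `|x| <= rho -> `|excess i x| <= C.
Proof.
move=> rho0; pose c := n%:R * rho; have c0 : 0 <= c by exact: mulr_ge0.
have dot_le (x y : V) : `|x| <= rho -> `|dotv x y| <= c * `|y|.
  move=> xr; apply: (@le_trans _ _ (n%:R * (rho * `|y|))); last by rewrite /c mulrA.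
  by apply: le_trans (normv_sum _ _) _; apply: ler_wpM2l => //; exact: ler_wpM2r.
have tcn (a : R) : tameV (fun y : V => a * `|y|) by apply: tame_cstM; exact: tame_normV.
have tcp : tameV (fun y => expR (f y + c * `|y|)).
  rewrite (_ : (fun y : V => expR (f y + c * `|y|)) = (fun y => expR (f y) * expR (c * `|y|))); last by apply/funext => y; rewrite expRD.
  apply: tameM => //; first exact: (tame_exp_potential hg gM).
  apply: (@tame_expR _ _ _ _ _ 0 c) => //; first by case: (tcn c).
  by move=> y; rewrite add0r.
have tcm : tameV (fun y => expR (f y - c * `|y|)).
  apply: (tame_bound _ tcp) => [|y].
    apply: measurableT_comp => //; apply: measurable_funB; last by case: (tcn c).
    by case: (tame_potential hg gM).
  rewrite !ger0_norm ?expR_ge0// ler_expR.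
  by have := mulr_ge0 c0 (normr_ge0 y); lra.
have tfc : tameV (fun y => f y - c * `|y|) by apply: tameB => //; exact: tame_potential hg gM.
have m0 := gauss_exp_gt0 hgamma tfc tcm.
set m := \int[gamma]_y expR _ in m0.
have t2 : tameV (fun y => y ord0 i * y ord0 i) by apply: tameM => //; exact: tame_coord.
pose A := \int[gamma]_y (y ord0 i * y ord0 i * expR (f y + c * `|y|)).
exists (A / m + (M + rho) ^+ 2 + 1) => x xr.
have lm : m <= lap (fun=> 1) x.
  apply: (gauss_int_le hgamma) => //; first exact: (tame_lapF hg gM x tc1).
  move=> y; rewrite mul1r ler_expR /tiltf lerD2l.
  by have := dot_le x y xr; rewrite ler_norml => /andP[].
have l2 : 0 <= lap (fun y => y ord0 i * y ord0 i) x <= A.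
  apply/andP; split.
    by apply: Rintegral_ge0 => y _; rewrite mulr_ge0 ?expR_ge0// -expr2 sqr_ge0.
  apply: (gauss_int_le hgamma); [exact: (tame_lapF hg gM x t2)|exact: tameM|].
  move=> y; rewrite ler_wpM2l -?expr2 ?sqr_ge0// ler_expR /tiltf lerD2l.
  by have := dot_le x y xr; rewrite ler_norml => /andP[].
have aux (p q a b : R) : 0 < p -> p <= q -> 0 <= a <= b -> `|a / q| <= b / p.
  move=> p0 pq /andP[a0 ab]; have q0 := lt_le_trans p0 pq.
  rewrite ger0_norm ?divr_ge0// ?(ltW q0)//; apply: ler_pM => //; first by rewrite invr_ge0 ltW.
  by rewrite lef_pV2 ?posrE.
rewrite /excess; apply: le_trans (ler_normB _ _) _; rewrite normr1 lerD2r.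
apply: le_trans (ler_normB _ _) _; apply: lerD.
  exact: aux m0 lm l2.
have -> : lap (fun y => y ord0 i) x / lap (fun=> 1) x = bary i x + x ord0 i.
  by rewrite (baryE hgamma hg gM) subrK.
rewrite normrX ler_pXn2r// ?nnegrE ?addr_ge0//.
apply: le_trans (ler_normD _ _) _; apply: lerD; first exact: bary_le.
by apply: le_trans (coord_le_normv _ _) xr.
Qed.

Let mlap2 i : measurable_fun setT (lap (fun y => y ord0 i * y ord0 i)).
Proof.
apply: (measurable_lap gamma hg gM); first by apply: tameM => //; exact: tame_coord.
by move=> y; rewrite -expr2 sqr_ge0.
Qed.

Let mlap1V : measurable_fun setT (fun x => (lap (fun=> 1) x)^-1).
Proof.
rewrite (_ : (fun x => (lap (fun=> 1) x)^-1) = fun x => expR (- ln (lap (fun=> 1) x))).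
  apply: measurableT_comp => //; apply: measurableT_comp => //; apply: measurableT_comp; first exact: measurable_ln.
  exact: (measurable_lap gamma hg gM).
by apply/funext => x; rewrite expRN lnK// posrE.
Qed.

Lemma measurable_bary i : measurable_fun setT (bary i).
Proof. exact: (measurable_funM (measurable_lap_coord hgamma hg gM i) mlap1V). Qed.

Lemma measurable_excess i : measurable_fun setT (excess i).
Proof.
rewrite (_ : excess i = fun x => lap (fun y => y ord0 i * y ord0 i) x * (lap (fun=> 1) x)^-1 - (bary i x + x ord0 i) ^+ 2 - 1).
  apply: measurable_funB => //; apply: measurable_funB; first exact: measurable_funM.
  by apply: measurable_funX; apply: measurable_funD; [exact: measurable_bary|exact: measurable_coord].
by apply/funext => x; rewrite (baryE hgamma hg gM) subrK.
Qed.

Variables (r t : R) (k0 : V).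
Hypotheses (r0 : 0 < r) (t0 : 0 < t).
Let s := r / t.
Let s0 : 0 < s. Proof. exact: divr_gt0. Qed.
Let Q (y : V) := dotv y y.
Definition ball_ind (y : V) : R := (dotv y y <= t ^+ 2)%R%:R.

(** The i-th summand of the divergence of (t^8 - |y|^8) (b(s y) - k0) on the ball of radius t, with
    s = r / t. The factor [wt] turns the Gaussian integral into a Lebesgue one, and subtracting k0
    leaves the divergence of b unchanged. *)
Definition ball_term i (y : V) := ball_ind y * ((t ^+ 8 - dotv y y ^+ 4) * (s * excess i (s *: y))
   - 8 * dotv y y ^+ 3 * y ord0 i * (bary i (s *: y) - k0 ord0 i)) * wt y.

Let mQ : measurable_fun setT Q. Proof. by apply: measurable_dotv; exact: measurable_idV. Qed.

Lemma measurable_ball_ind : measurable_fun setT ball_ind.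
Proof.
rewrite (_ : ball_ind = fun y => if Q y <= t ^+ 2 then 1 else 0); last by apply/funext => y; rewrite /ball_ind; case: ifP.
by apply: measurable_fun_ifT => //; exact: measurable_fun_ler.
Qed.

Lemma ball_norm_le y : Q y <= t ^+ 2 -> `|y| <= t.
Proof.
move=> Qy; apply/normv_leP => [|i]; first exact: ltW.
rewrite -(ler_pXn2r (n := 2)) ?nnegrE ?(ltW t0)// real_normK ?num_real//.
apply: le_trans Qy; rewrite /Q /dotv (bigD1 i)//= -expr2 lerDl sumr_ge0// => j _.
by rewrite -expr2 sqr_ge0.
Qed.

Lemma tame_ball (F : V -> R) C : measurable_fun setT F -> (forall y, Q y <= t ^+ 2 -> `|F y| <= C) ->
  tameV (fun y => ball_ind y * F y).
Proof.
move=> mF FC; have tC : tameV (fun _ : V => C) by exact: tame_cst.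
apply: (tame_bound _ tC) => [|y]; first by apply: measurable_funM => //; exact: measurable_ball_ind.
rewrite /ball_ind; case: (boolP (dotv y y <= t ^+ 2)) => [h|_]; rewrite ?mul1r ?mul0r ?normr0//.
by apply: le_trans (FC _ h) (ler_norm _).
Qed.

Let mscale (F : V -> R) : measurable_fun setT F -> measurable_fun setT (fun y : V => F (s *: y) : R).
Proof.
move=> mF; apply: (measurableT_comp mF).
apply/measurable_rowP => i; rewrite [X in measurable_fun _ X](_ : _ = fun y : V => s * y ord0 i); last by apply/funext => y; rewrite mxE.
by apply: measurable_funM => //; exact: measurable_coord.
Qed.

Let wt_le y : Q y <= t ^+ 2 -> wt y <= expR (t ^+ 2 / 2).
Proof. by move=> h; rewrite ler_expR ler_wpM2r. Qed.

Let Q0 y : 0 <= Q y := dotvv_ge0 y.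

Let scale_le y : Q y <= t ^+ 2 -> `|s *: y| <= r.
Proof.
move=> h; rewrite normrZ (gtr0_norm s0); apply: le_trans (ler_wpM2l (ltW s0) (ball_norm_le h)) _.
by rewrite /s divfK// gt_eqF.
Qed.

Lemma tame_ball_term i : tameV (ball_term i).
Proof.
have [C hC] := excess_bounded i (ltW r0).
have mk : measurable_fun setT (fun y : V => (t ^+ 8 - Q y ^+ 4) * (s * excess i (s *: y)) - 8 * Q y ^+ 3 * y ord0 i * (bary i (s *: y) - k0 ord0 i)).
  have mQX k : measurable_fun setT (fun y => Q y ^+ k) by exact: measurable_funX.
  apply: measurable_funB.
    apply: measurable_funM; first exact: measurable_funB.
    by apply: measurable_funM => //; apply: mscale; exact: measurable_excess.
  apply: measurable_funM.
    by apply: measurable_funM; [exact: measurable_funM|exact: measurable_coord].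
  by apply: measurable_funB => //; apply: mscale; exact: measurable_bary.
rewrite (_ : ball_term i = fun y => ball_ind y * (((t ^+ 8 - Q y ^+ 4) * (s * excess i (s *: y)) - 8 * Q y ^+ 3 * y ord0 i * (bary i (s *: y) - k0 ord0 i)) * wt y)); last first.
  by apply/funext => y; rewrite mulrA.
apply: (@tame_ball _ ((t ^+ 8 * (s * C) + 8 * t ^+ 6 * t * (M + `|k0 ord0 i|)) * expR (t ^+ 2 / 2))).
  by apply: measurable_funM => //; exact: measurable_wt.
move=> y Qy; rewrite normrM; apply: ler_pM => //; last first.
  by rewrite ger0_norm ?expR_ge0//; exact: wt_le.
have Q4 : Q y ^+ 4 <= t ^+ 8.
  rewrite (_ : t ^+ 8 = (t ^+ 2) ^+ 4); last by rewrite -exprM.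
  by apply: lerXn2r; rewrite // nnegrE ?exprn_ge0// ltW.
have Q3 : Q y ^+ 3 <= t ^+ 6.
  rewrite (_ : t ^+ 6 = (t ^+ 2) ^+ 3); last by rewrite -exprM.
  by apply: lerXn2r; rewrite // nnegrE ?exprn_ge0// ltW.
have Q40 : 0 <= Q y ^+ 4 by rewrite exprn_ge0.
apply: le_trans (ler_normB _ _) _; apply: lerD.
  rewrite normrM; apply: ler_pM => //.
    by rewrite ger0_norm ?subr_ge0// gerBl.
  by rewrite normrM (gtr0_norm s0) ler_wpM2l ?(ltW s0)//; apply: hC; exact: scale_le.
rewrite !normrM; apply: ler_pM => //; rewrite ?mulr_ge0//.
  apply: ler_pM => //; rewrite ?mulr_ge0//.
    by rewrite (gtr0_norm (ltr0n _ 8)) ler_wpM2l// ger0_norm// exprn_ge0.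
  by apply: le_trans (coord_le_normv _ _) _; exact: ball_norm_le.
by apply: le_trans (ler_normB _ _) _; rewrite lerD2r bary_le.
Qed.

(** A line parallel to the i-th axis either misses the ball or meets it in an interval, at whose
    ends t^8 - |y|^8 vanishes. The Gaussian density cancels the i-th factor of [wt], and the
    fundamental theorem of calculus gives zero. *)
Let ball_section i y : \int[N01]_z ball_term i (upd y i z) = 0.
Proof.
pose rho := \sum_(j < n | j != i) y ord0 j ^+ 2.
have Qu z : dotv (upd y i z) (upd y i z) = rho + z ^+ 2.
  rewrite /dotv (bigD1 i)//= !mxE eqxx -expr2 addrC; congr (_ + _).
  by apply: eq_bigr => j ji; rewrite !mxE (negbTE ji) expr2.
have tB : tame1 (fun z => ball_term i (upd y i z)) by exact: (tame_section_upd i y (tame_ball_term i)).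
have [h|h] := ltP (t ^+ 2) rho.
  rewrite (_ : (fun z => _) = fun=> 0) ?gauss1_cst//; apply/funext => z.
  rewrite /ball_term /ball_ind Qu (_ : (_ <= _)%R = false) ?mul0r//.
  by apply/negbTE; rewrite -ltNge; apply: lt_le_trans h _; rewrite lerDl sqr_ge0.
rewrite RintegralN01; last by case: tB.
pose a := Num.sqrt (t ^+ 2 - rho).
have a0 : 0 <= a by exact: sqrtr_ge0.
have a2 : a ^+ 2 = t ^+ 2 - rho by rewrite sqr_sqrtr// subr_ge0.
pose K := expR (rho / 2) * phi 0.
pose G z := bary i (s *: upd y i z) - k0 ord0 i.
have su z : s *: upd y i z = upd (s *: y) i (s * z).
  by apply/rowP => j; rewrite !mxE; case: ifP.
pose H z := K * ((t ^+ 8 - (rho + z ^+ 2) ^+ 4) * G z).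
pose H' z := K * ((t ^+ 8 - (rho + z ^+ 2) ^+ 4) * (s * excess i (s *: upd y i z)) - 8 * (rho + z ^+ 2) ^+ 3 * z * G z).
have dG (z : R) : is_derive z 1 G (s * excess i (s *: upd y i z)).
  have ds : is_derive z 1 (fun z : R => s * z) s.
    have d := @is_deriveZ R R^o R^o _ s z 1 _ (is_derive_id z 1).
    by apply: (is_derive_ext d) => //; rewrite /GRing.scale /= mulr1.
  have d1 := @is_derive1_comp R _ _ z _ _ (bary_derive hgamma hg gM (s *: y) i (s * z)) ds.
  have d2 := @is_deriveB R R^o R^o _ _ z 1 _ _ d1 (is_derive_cst (k0 ord0 i) z 1).
  apply: (is_derive_ext d2) => [w|]; first by rewrite /G su.
  by rewrite subr0 mulrC su.
have dq (z : R) : is_derive z 1 (fun z : R => t ^+ 8 - (rho + z ^+ 2) ^+ 4) (- (8 * (rho + z ^+ 2) ^+ 3 * z)).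
  have dz := @is_deriveM R R^o id id z 1 _ _ (is_derive_id z 1) (is_derive_id z 1).
  have dr := @is_deriveD R R^o R^o _ _ z 1 _ _ (is_derive_cst rho z 1) dz.
  have dr2 := @is_deriveM R R^o _ _ z 1 _ _ dr dr.
  have dr4 := @is_deriveM R R^o _ _ z 1 _ _ dr2 dr2.
  have d := @is_deriveB R R^o R^o _ _ z 1 _ _ (is_derive_cst (t ^+ 8) z 1) dr4.
  apply: (is_derive_ext d) => [w|].
    rewrite (_ : (rho + w ^+ 2) ^+ 4 = (rho + w * w) * (rho + w * w) * ((rho + w * w) * (rho + w * w))) //.
    by ring.
  rewrite /GRing.scale /= !fctE /GRing.scale /=; ring.
have dH (z : R) : is_derive z 1 H (H' z).
  have d1 := @is_deriveM R R^o _ _ z 1 _ _ (dq z) (dG z).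
  have d := @is_deriveZ R R^o R^o _ K z 1 _ d1.
  apply: (is_derive_ext d) => //; rewrite /H' /GRing.scale /=; ring.
have cH' : continuous H'.
  have cid : continuous (fun z : R => z) by move=> z; exact: cvg_id.
  have cM (p q : R -> R) : continuous p -> continuous q -> continuous (fun z => p z * q z).
    by move=> cp cq z; apply: cvgM; [exact: cp|exact: cq].
  have cD (p q : R -> R) : continuous p -> continuous q -> continuous (fun z => p z + q z).
    by move=> cp cq z; apply: cvgD; [exact: cp|exact: cq].
  have cN (p : R -> R) : continuous p -> continuous (fun z => - p z).
    by move=> cp z; apply: cvgN; exact: cp.
  have c1 (c : R) : continuous (fun _ : R => c) by move=> z; exact: cvg_cst.
  have cr : continuous (fun z : R => rho + z ^+ 2) by apply: (cD) => //; apply: (cM).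
  have cX (p : R -> R) k : continuous p -> continuous (fun z => p z ^+ k).
    move=> cp; elim: k => [|k ih]; first by under eq_fun do rewrite expr0; exact: c1.
    by under eq_fun do rewrite exprS; exact: cM.
  apply: (cM) => //; apply: (cD).
    apply: (cM); first by apply: (cD) => //; apply: cN; exact: cX.
    apply: (cM) => //; rewrite (_ : (fun z => _) = (fun z => excess i (upd (s *: y) i (s * z)))); last by apply/funext => z; rewrite su.
    move=> z; apply: (cvg_comp (fun z : R => s * z) (fun z => excess i (upd (s *: y) i z))).
      by apply: cvgM; [exact: cvg_cst|exact: cvg_id].
    exact: (excess_continuous hgamma hg gM).
  apply: cN; apply: (cM); last exact: (is_derive_continuous dG).
  by apply: (cM) => //; apply: (cM) => //; exact: cX.
transitivity (\int[mu]_(z in `[- a, a]) H' z).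
  rewrite [RHS]Rintegral_mkcond; apply: eq_Rintegral => z _.
  rewrite patchE (_ : (z \in _) = (rho + z ^+ 2 <= t ^+ 2)); last first.
    rewrite -lerBrDl -a2; apply/idP/idP; rewrite inE /= in_itv /= -ler_norml.
      by move=> za; rewrite -real_normK ?num_real// ler_pXn2r ?nnegrE.
    by rewrite -real_normK ?num_real// ler_pXn2r ?nnegrE.
  rewrite /ball_term /ball_ind Qu; case: ifP => _; last by rewrite !mul0r.
  rewrite mul1r wt_upd -/rho (phiE z) mxE eqxx.
  rewrite (_ : _ * _ * _ = H' z * (expR (z ^+ 2 / 2) * expR (- (z ^+ 2 / 2)))); last by rewrite /H' /K /G; ring.
  by rewrite -expRD subrr expR0 mulr1.
rewrite (FTC2 _ cH' dH); last by rewrite ge0_cp.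
have e : rho + a ^+ 2 = t ^+ 2 by rewrite a2 addrC subrK.
have e4 : t ^+ 8 - (rho + a ^+ 2) ^+ 4 = 0 by rewrite e -exprM subrr.
have eN : t ^+ 8 - (rho + (- a) ^+ 2) ^+ 4 = 0 by rewrite (sqrrN a) e4.
rewrite /H; move: (G a) (G (- a)) => Ga Gb.
by rewrite e4 eN !mul0r mulr0 subrr.
Qed.

Lemma ball_term_int i : \int[gamma]_y ball_term i y = 0.
Proof.
rewrite -(tame_gauss_upd hgamma i (tame_ball_term i)).
under eq_Rintegral do rewrite ball_section.
by rewrite gauss_cst.
Qed.

End ball.

(** * Averaging over the radius *)

Section radial.
Context {R : realType}.
Local Notation mu := (@lebesgue_measure R).

Lemma is_deriveMr (f g : R -> R) (x a b : R) : is_derive x 1 f a -> is_derive x 1 g b ->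
  is_derive x 1 (fun t => f t * g t) (a * g x + f x * b).
Proof.
move=> df dg; apply: (is_derive_ext (@is_deriveM R R^o f g x 1 a b df dg)) => //.
by rewrite /GRing.scale /= addrC; congr (_ + _); rewrite mulrC.
Qed.

Lemma is_deriveDr (f g : R -> R) (x a b : R) : is_derive x 1 f a -> is_derive x 1 g b ->
  is_derive x 1 (fun t => f t + g t) (a + b).
Proof. exact: (@is_deriveD R R^o R^o f g x 1 a b). Qed.

Lemma is_deriveXr (f : R -> R) (x a : R) k : is_derive x 1 f a ->
  is_derive x 1 (fun t => f t ^+ k) (k%:R * f x ^+ k.-1 * a).
Proof.
move=> df; elim: k => [|k ih].
  by rewrite !mul0r; exact: (is_derive_cst (1 : R) x 1).
apply: (is_derive_ext (is_deriveMr df ih)) => [t|]; first by rewrite exprS.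
case: k ih => [_|k _] /=; first by rewrite !expr0; ring.
by rewrite -[k.+2]addn1 natrD !exprS; ring.
Qed.

Lemma is_deriveCr (c : R) (f : R -> R) (x a : R) : is_derive x 1 f a -> is_derive x 1 (fun t => c * f t) (c * a).
Proof. by move=> df; apply: (is_derive_ext (is_deriveMr (is_derive_cst c x 1) df)) => //; rewrite mul0r add0r. Qed.

Let T (u : R) := expR u.
Let S (u : R) := expR (- u).
Definition egauss (u : R) := expR (- (expR u ^+ 2 / 2)).
Let E := egauss.

(* This is w(t) dt for t = e^u, where w(t) = (6 t^-7 + t^-5) e^(-t^2/2) / 8 has the antiderivative
   - t^-6 e^(-t^2/2) / 8. *)
Definition radial_weight (u : R) := (6 * expR (- u) ^+ 6 + expR (- u) ^+ 4) * egauss u / 8.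

Let TS u : T u * S u = 1. Proof. by rewrite /T /S -expRD subrr expR0. Qed.

Let dT (u : R) : is_derive u 1 T (T u). Proof. exact: is_derive_expR. Qed.

Let dS (u : R) : is_derive u 1 S (- S u).
Proof.
have dN : is_derive u 1 (fun u : R => - u) (- 1) by exact: (is_deriveN (is_derive_id u 1)).
have := @is_derive1_comp R expR _ u _ _ (is_derive_expR _) dN.
by move=> d; apply: (is_derive_ext d) => //; rewrite mulrN1.
Qed.

Let dE (u : R) : is_derive u 1 E (- (T u ^+ 2 * E u)).
Proof.
have d := @is_derive1_comp R expR _ u _ _ (is_derive_expR _) (is_deriveCr (- 2^-1) (is_deriveXr 2 (dT u))).
apply: (is_derive_ext d) => [t|]; first by rewrite /E /egauss /= mulNr (mulrC 2^-1).
rewrite /= (_ : - 2^-1 * T u ^+ 2 = - (expR u ^+ 2 / 2)); last by rewrite /T; ring.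
by rewrite -/(egauss u) -/(E u) expr1; field.
Qed.

Let cT : continuous T. Proof. exact: is_derive_continuous dT. Qed.
Let cS : continuous S. Proof. exact: is_derive_continuous dS. Qed.

Let Fw u := - 8^-1 * (S u ^+ 6 * E u).
Let dFw (u : R) : is_derive u 1 Fw (radial_weight u).
Proof.
apply: (is_derive_ext (is_deriveCr (- 8^-1) (is_deriveMr (is_deriveXr 6 (dS u)) (dE u)))) => //.
rewrite /radial_weight -/(E u) -/(S u) /=.
have e : S u ^+ 6 * T u ^+ 2 = S u ^+ 4.
  by rewrite -[RHS]mulr1 -(expr1n R 2) -(TS u); ring.
by rewrite -e; field.
Qed.

Lemma radial_weight_continuous : continuous radial_weight.
Proof.
have d u := is_deriveCr 8^-1 (is_deriveMr (is_deriveDr (is_deriveCr 6 (is_deriveXr 6 (dS u))) (is_deriveXr 4 (dS u))) (dE u)).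
have c := is_derive_continuous d.
by rewrite (_ : radial_weight = fun t => 8^-1 * ((6 * S t ^+ 6 + S t ^+ 4) * E t))//; apply/funext => t; rewrite mulrC.
Qed.

Lemma radial_weight_ge0 u : 0 <= radial_weight u.
Proof. by rewrite /radial_weight divr_ge0// mulr_ge0 ?expR_ge0// addr_ge0// ?mulr_ge0// exprn_ge0// expR_ge0. Qed.

Lemma radial_weight_tail l :
  (\int[mu]_(u in `[l, +oo[) (radial_weight u)%:E = (8^-1 * (expR (- l) ^+ 6 * egauss l))%:E)%E.
Proof.
have F0 : Fw u @[u --> +oo%R] --> 0.
  have h0 : (fun u => - expR (- u)) @ +oo%R --> (0:R).
    by rewrite -oppr0; apply: cvgN; exact: cvgr_expR.
  apply: (@squeeze_cvgr _ _ _ _ (fun u => - expR (- u)) (fun=> 0)) => //; last exact: cvg_cst.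
  near=> u; have u0 : 0 <= u by near: u; exact: nbhs_pinfty_ge.
  have s1 : S u <= 1 by rewrite /S -expR0 ler_expR; lra.
  have e1 : E u <= 1 by rewrite /E /egauss -expR0 ler_expR oppr_le0 divr_ge0// sqr_ge0.
  have s0 : 0 <= S u by exact: expR_ge0.
  have e0 : 0 <= E u by exact: expR_ge0.
  have h6 : S u ^+ 6 <= S u by rewrite exprS ler_piMr// exprn_ile1.
  have h60 : 0 <= S u ^+ 6 by exact: exprn_ge0.
  have h : 0 <= S u ^+ 6 * E u <= S u.
    by rewrite mulr_ge0//=; apply: le_trans h6; rewrite ler_piMr.
  rewrite /Fw -/(S u); lra.
have cF := is_derive_continuous dFw.
rewrite (@ge0_continuous_FTC2y _ radial_weight Fw l 0).
- by rewrite -EFinB /Fw; congr EFin; rewrite sub0r mulNr opprK.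
- by move=> x _; exact: radial_weight_ge0.
- by apply: continuous_subspaceT; exact: radial_weight_continuous.
- exact: F0.
- by move=> x _; exact: (@ex_derive _ _ _ _ _ _ _ (dFw x)).
- by apply: cvg_at_right_filter; exact: cF.
- by move=> x _; rewrite derive1E; exact: (@derive_val _ _ _ _ _ _ _ (dFw x)).
Unshelve. all: by end_near. Qed.

Variables (Q b : R).
Hypotheses (Q0 : 0 <= Q) (b0 : 0 < b).

(** With t = e^u and Q = |y|^2 this is w(t) (t^8 - |y|^8) / t on the radii t >= |y|: the weight with
    which the point y enters the averaged lower bound. The 1 / t comes from the factor r / t of the
    divergence. *)
Definition radial_profile (u : R) : R :=
  if Q <= expR u ^+ 2 then radial_weight u * expR (- u) * (expR u ^+ 8 - Q ^+ 4) else 0.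

Let I u := radial_weight u * S u * (T u ^+ 8 - Q ^+ 4).
(* The tangent at b^2 of the convex function w |-> w^(-1/2), evaluated at w = T u ^ 2 + 2. *)
Let p u := (3 * b ^+ 2 - 2 - T u ^+ 2) / (2 * b ^+ 3).
(** The first term comes from integrating t^2 e^(-t^2/2) by parts, t = T u; it vanishes at t^2 = Q
    and leaves at least 7/8 e^(-t^2/2). The second bounds the remaining Gaussian tail from below,
    because the derivative of p e^(-t^2/2) in t is at least - e^(-t^2/2). *)
Let W u := 8^-1 * ((T u - Q ^+ 4 * S u ^+ 7) * E u) + 7 / 8 * (p u * E u).
Let W' u := 8^-1 * ((T u + 7 * (Q ^+ 4 * S u ^+ 7)) * E u - (T u ^+ 3 - Q ^+ 4 * S u ^+ 5) * E u)
  - 7 / 8 * ((T u ^+ 2 / b ^+ 3 + p u * T u ^+ 2) * E u).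

Let dW (u : R) : is_derive u 1 W (W' u).
Proof.
have d1 := is_deriveMr (is_deriveDr (dT u) (is_deriveCr (- Q ^+ 4) (is_deriveXr 7 (dS u)))) (dE u).
have d2 := is_deriveMr (is_deriveCr ((2 * b ^+ 3)^-1) (is_deriveDr (is_derive_cst (3 * b ^+ 2 - 2) u 1) (is_deriveCr (- 1) (is_deriveXr 2 (dT u))))) (dE u).
have d := is_deriveDr (is_deriveCr 8^-1 d1) (is_deriveCr (7 / 8) d2).
have bn : b != 0 by rewrite gt_eqF.
apply: (is_derive_ext d) => [t|]; first by rewrite /W /p /cst; field.
have e : S u ^+ 7 * T u ^+ 2 = S u ^+ 5.
  by rewrite -[RHS]mulr1 -(expr1n R 2) -(TS u); ring.
by rewrite /W' /p /cst /= -e; field.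
Qed.

Let IW u : - W' u <= I u.
Proof.
have Tp : 0 < T u by exact: expR_gt0.
have Ep : 0 < E u by exact: expR_gt0.
have e6 : S u ^+ 7 * T u ^+ 8 = T u.
  by rewrite -[RHS]mul1r -(expr1n R 7) -(TS u); ring.
have e4 : S u ^+ 5 * T u ^+ 8 = T u ^+ 3.
  by rewrite -[RHS]mul1r -(expr1n R 5) -(TS u); ring.
rewrite -subr_ge0 opprK.
have -> : I u + W' u = E u / 8 * (7 * T u + Q ^+ 4 * S u ^+ 7)
   - 7 / 8 * ((T u ^+ 2 / b ^+ 3 + p u * T u ^+ 2) * E u).
  have -> : I u = 8^-1 * E u * (6 * (S u ^+ 7 * T u ^+ 8) + S u ^+ 5 * T u ^+ 8 - Q ^+ 4 * (6 * S u ^+ 7 + S u ^+ 5)).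
    by rewrite /I /radial_weight -/(S u) -/(E u); field.
  by rewrite e6 e4 /W'; field; rewrite gt_eqF.
(* Cleared of denominators, with t = T u, this is (t - b)^2 (t + 2 b) >= 0. *)
have key : T u ^+ 2 / b ^+ 3 + p u * T u ^+ 2 <= T u.
  have -> : T u ^+ 2 / b ^+ 3 + p u * T u ^+ 2 = T u * (T u * (3 * b ^+ 2 - T u ^+ 2) / (2 * b ^+ 3)).
    by rewrite /p; field; rewrite gt_eqF.
  rewrite ler_piMr ?(ltW Tp)// ler_pdivrMr ?mulr_gt0 ?exprn_gt0// mul1r -subr_ge0.
  have -> : 2 * b ^+ 3 - T u * (3 * b ^+ 2 - T u ^+ 2) = (T u - b) ^+ 2 * (T u + 2 * b) by ring.
  by rewrite mulr_ge0 ?sqr_ge0// addr_ge0 ?mulr_ge0 ?ltW.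
have q0 : 0 <= E u / 8 * (Q ^+ 4 * S u ^+ 7).
  by rewrite !mulr_ge0 ?exprn_ge0 ?expR_ge0// ltW.
have := ler_wpM2r (ltW Ep) key.
rewrite mulrDr; move: q0; set X := E u / 8 * (Q ^+ 4 * _); nra.
Qed.

Let cW' : continuous W'.
Proof.
have bn : b != 0 by rewrite gt_eqF.
have d u := is_deriveDr (is_deriveCr 8^-1 (is_deriveMr (is_deriveDr (is_deriveDr (dT u) (is_deriveCr (7 * Q ^+ 4) (is_deriveXr 7 (dS u))))
   (is_deriveCr (- 1) (is_deriveDr (is_deriveXr 3 (dT u)) (is_deriveCr (- Q ^+ 4) (is_deriveXr 5 (dS u)))))) (dE u)))
  (is_deriveCr (- (7 / 8) / (2 * b ^+ 3)) (is_deriveMr (is_deriveDr (is_deriveCr 2 (is_deriveXr 2 (dT u)))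
     (is_deriveMr (is_deriveDr (is_derive_cst (3 * b ^+ 2 - 2) u 1) (is_deriveCr (- 1) (is_deriveXr 2 (dT u)))) (is_deriveXr 2 (dT u)))) (dE u))).
have c := is_derive_continuous d.
rewrite (_ : W' = fun t => 8^-1 * ((T t + 7 * Q ^+ 4 * S t ^+ 7 + -1 * (T t ^+ 3 + - Q ^+ 4 * S t ^+ 5)) * E t) +
  - (7 / 8) / (2 * b ^+ 3) * ((2 * T t ^+ 2 + (3 * b ^+ 2 - 2 + -1 * T t ^+ 2) * T t ^+ 2) * E t)); first exact: c.
by apply/funext => t; rewrite /W' /p; field.
Qed.

Let cI : continuous I.
Proof.
have d u := is_deriveDr (is_deriveXr 8 (dT u)) (is_derive_cst (- Q ^+ 4) u 1).
have c := is_derive_continuous d.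
move=> u; apply: cvgM; last exact: c.
by apply: cvgM; [exact: radial_weight_continuous|exact: cS].
Qed.

Lemma radial_profile_ge0 u : 0 <= radial_profile u.
Proof.
rewrite /radial_profile; case: ifP => // Qu.
rewrite mulr_ge0// ?mulr_ge0 ?radial_weight_ge0 ?expR_ge0// subr_ge0.
rewrite (_ : expR u ^+ 8 = (expR u ^+ 2) ^+ 4); last by rewrite -exprM.
by apply: lerXn2r; rewrite // nnegrE ?exprn_ge0 ?expR_ge0.
Qed.

Lemma measurable_radial_profile : measurable_fun setT radial_profile.
Proof.
apply: (@measurable_fun_ifT _ _ (measurableTypeR R) R).
- apply: measurable_fun_ler => //; apply: continuous_measurable_fun; exact: (is_derive_continuous (fun u => is_deriveXr 2 (dT u))).
- exact: continuous_measurable_fun cI.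
- exact: measurable_cst.
Qed.

Let interval_bound a c : a <= c -> Q <= T a ^+ 2 ->
  ((W a - W c)%:E <= \int[mu]_u (radial_profile u)%:E)%E.
Proof.
move=> ac Qa.
have iI : mu.-integrable `[a, c] (EFin \o I).
  by apply: continuous_compact_integrable; [exact: segment_compact|exact: continuous_subspaceT].
have cN : continuous (fun u => - W' u) by move=> u; apply: cvgN; exact: cW'.
have iW : mu.-integrable `[a, c] (EFin \o (fun u => - W' u)).
  by apply: continuous_compact_integrable; [exact: segment_compact|exact: continuous_subspaceT].
have dN (u : R) : is_derive u 1 (fun u => - W u) (- W' u) by exact: (is_deriveN (dW u)).
have := FTC2 ac cN dN; rewrite opprK addrC => e.
apply: (@le_trans _ _ (\int[mu]_(u in `[a, c]) (radial_profile u)%:E)%E); last first.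
  apply: ge0_subset_integral => //.
  - by apply/measurable_EFinP; exact: measurable_radial_profile.
  - by move=> u _; rewrite lee_fin radial_profile_ge0.
have -> : (\int[mu]_(u in `[a, c]) (radial_profile u)%:E = \int[mu]_(u in `[a, c]) (I u)%:E)%E.
  apply: eq_integral => u; rewrite inE /= in_itv /= => /andP[au _].
  rewrite /radial_profile (_ : (Q <= _)%R)//; apply: le_trans Qa _.
  by apply: lerXn2r; rewrite ?nnegrE ?expR_ge0// ler_expR.
rewrite -e -[leRHS](@fineK _)//; last exact: integrable_fin_num.
by rewrite lee_fin; apply: le_Rintegral => // u _; exact: IW.
Qed.

Lemma radial_lower :
  ((7 / 8 * ((3 * b ^+ 2 - 2 - Q) / (2 * b ^+ 3) * expR (- (Q / 2))))%:E
   <= \int[mu]_u (radial_profile u)%:E)%E.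
Proof.
(* The lower end ln(Q) / 2 of the integration is meaningless for Q = 0, so Q is replaced by Q + e;
   the final - e pays for the boundary value at the upper end. Then e tends to 0. *)
pose psi e := 7 / 8 * ((3 * b ^+ 2 - 2 - (Q + e)) / (2 * b ^+ 3) * expR (- ((Q + e) / 2))) - e.
have lower e : 0 < e -> ((psi e)%:E <= \int[mu]_u (radial_profile u)%:E)%E.
  move=> e0; have qe0 : 0 < Q + e by exact: ltr_wpDl.
  pose a := ln (Q + e) / 2.
  have Ta : T a ^+ 2 = Q + e by rewrite /T /a -expRM_natl mulrC divfK// lnK.
  (* The summand Q + e gives a <= c, 3 b^2 makes p c nonpositive, and e^-1 yields e T(c) >= 1, which
     bounds what is left of W c by e. *)
  pose c := Q + e + 3 * b ^+ 2 + e^-1.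
  have b2 : 0 <= 3 * b ^+ 2 by rewrite mulr_ge0// sqr_ge0.
  have eV : 0 < e^-1 by rewrite invr_gt0.
  have Tc : 1 + c <= T c by exact: expR_ge1Dx.
  have ac : a <= c.
    have := expR_ge1Dx (ln (Q + e)); rewrite lnK ?posrE// => hl.
    rewrite /a /c; lra.
  apply: le_trans (interval_bound ac _); last by rewrite Ta; lra.
  rewrite lee_fin /psi.
  have Ep : 0 < E a by exact: expR_gt0.
  have Ec : 0 < E c by exact: expR_gt0.
  have Wa : 7 / 8 * (p a * E a) <= W a.
    rewrite /W lerDr mulr_ge0// mulr_ge0 ?(ltW Ep)// subr_ge0.
    have T1 : T a ^+ 7 * S a ^+ 7 = 1 by rewrite -exprMn TS expr1n.
    rewrite -[leRHS]mulr1 -T1 mulrA ler_wpM2r ?exprn_ge0 ?expR_ge0// -exprS.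
    rewrite (_ : T a ^+ 8 = (T a ^+ 2) ^+ 4); last by rewrite -exprM.
    by apply: lerXn2r; rewrite ?nnegrE ?Ta ?(ltW qe0)//; lra.
  have Wc : W c <= e.
    have Tp : 1 <= T c by rewrite /c in Tc *; lra.
    have T2 : T c <= T c ^+ 2 by rewrite expr2 ler_peMl// (le_trans _ Tp).
    have pc : p c * E c <= 0.
      rewrite mulr_le0_ge0// ?(ltW Ec)// /p ler_pdivrMr ?mulr_gt0 ?exprn_gt0// mul0r.
      by rewrite /c in Tc T2 *; lra.
    have Et : E c * T c ^+ 2 <= 2.
      have := expR_ge1Dx (T c ^+ 2 / 2); rewrite -(ler_pM2l Ec) -[E c * expR _]expRD addNr expR0; lra.
    have Te : 1 <= T c * e.
      rewrite -ler_pdivrMr// mul1r; apply: le_trans Tc; rewrite /c; lra.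
    have TE : E c * T c <= 2 * e.
      apply: (@le_trans _ _ (E c * T c * (T c * e))); first by rewrite ler_peMr// mulr_ge0 ?expR_ge0// ltW.
      by rewrite mulrA -(mulrA (E c)) -expr2 ler_pM2r.
    have QE : 0 <= Q ^+ 4 * S c ^+ 7 * E c by rewrite !mulr_ge0 ?exprn_ge0 ?expR_ge0.
    rewrite /W mulrBl; lra.
  have -> : expR (- ((Q + e) / 2)) = E a by rewrite /E /egauss -/(T a) Ta.
  rewrite -Ta -/(p a); lra.
have cpsi : psi e @[e --> (0:R)] --> psi 0.
  have dl (e : R) := is_deriveCr (- 2^-1) (is_deriveDr (is_derive_cst Q e 1) (is_derive_id e 1)).
  have d (e : R) := is_deriveDr (is_deriveCr (7 / 8) (is_deriveMr (is_deriveCr ((2 * b ^+ 3)^-1)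
     (is_deriveDr (is_derive_cst (3 * b ^+ 2 - 2 - Q) e 1) (is_deriveCr (- 1) (is_derive_id e 1))))
     (@is_derive1_comp R expR _ e _ _ (is_derive_expR _) (dl e)))) (is_deriveCr (- 1) (is_derive_id e 1)).
  have c := is_derive_continuous d.
  rewrite (_ : psi = fun e => 7 / 8 * ((2 * b ^+ 3)^-1 * (3 * b ^+ 2 - 2 - Q + -1 * e) *
     (expR \o (fun t => - 2^-1 * (cst Q t + t))) e) + -1 * e); first exact: c.
  apply/funext => e; rewrite /psi /= (_ : - 2^-1 * (Q + e) = - ((Q + e) / 2)); last by field.
  by field; rewrite gt_eqF.
have -> : 7 / 8 * ((3 * b ^+ 2 - 2 - Q) / (2 * b ^+ 3) * expR (- (Q / 2))) = psi 0 by rewrite /psi addr0 subr0.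
move: lower; set X := (\int[mu]_u _)%E.
case: X => [x||] h; rewrite ?leey//; last by have := h 1 ltr01; rewrite leeNy_eq.
have c0 : psi e @[e --> (0:R)^'+] --> psi 0 by apply: cvg_at_right_filter.
rewrite lee_fin; apply: (cvgr_to_le c0).
by near=> e; rewrite -lee_fin; apply: h; near: e; exact: nbhs_right_gt.
Unshelve. all: by end_near. Qed.

End radial.

Section average.
Context {R : realType} {n : nat}.
Local Notation V := 'rV[R]_n.
Local Notation N01 := (normal_prob (0:R) 1).
Local Notation mu := (@lebesgue_measure R).
Variable gamma : probability V R.
Hypothesis hgamma : std_gaussian gamma.
Local Notation tameV := (tame (fun y : V => `|y|)).
Variables (f : V -> R) (g : V -> V) (M : R).
Hypothesis hg : has_gradient f g.
Hypothesis gM : forall y, `|g y| <= M.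

Local Notation lap := (lap gamma f).
Local Notation bary := (bary gamma f g).
Local Notation excess := (excess gamma f).

Variables (r c : R) (k0 : V) (h : V -> R).
Hypothesis r0 : 0 < r.
Hypothesis c0 : 0 <= c.
Hypothesis th : tameV h.
Hypothesis h0 : forall y, 0 <= h y.
Hypothesis hle : forall x y, dotv y (g x - k0) <= h y.
Hypothesis hc : forall x, dotv x x <= r ^+ 2 -> c <= \sum_(i < n) excess i x.

(** [bary] is a mean of g under a tilt, hence it satisfies every linear bound that g satisfies
    everywhere. *)
Lemma bary_support (x y : V) : \sum_(i < n) y ord0 i * (bary i x - k0 ord0 i) <= h y.
Proof.
have t1 : tameV (fun _ : V => 1) by exact: tame_cst.
have tg i : tameV (fun y => g y ord0 i) := tame_gradient_coord hg gM i.
have tge i : tameV (fun z => y ord0 i * (g z ord0 i * expR (tiltf f x z))).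
  by apply: tame_cstM; exact: (tame_lapF hg gM x (tg i)).
have l0 := lap_gt0 hgamma hg gM x.
have e : \sum_(i < n) y ord0 i * lap (fun z => g z ord0 i) x <= (h y + dotv y k0) * lap (fun=> 1) x.
  rewrite (eq_bigr (fun i => \int[gamma]_z (y ord0 i * (g z ord0 i * expR (tiltf f x z))))); last first.
    by move=> i _; rewrite (gauss_intZl hgamma)//; exact: (tame_lapF hg gM x (tg i)).
  rewrite -(gauss_int_sum hgamma)// -(gauss_intZl hgamma); last exact: (tame_lapF hg gM x t1).
  apply: (gauss_int_le hgamma).
  - by apply: tame_sum => i.
  - by apply: tame_cstM; exact: (tame_lapF hg gM x t1).
  move=> z; under eq_bigr do rewrite mulrA.
  rewrite -mulr_suml mul1r ler_wpM2r ?expR_ge0//.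
  have := hle z y; rewrite dotvDr dotvNr -/(dotv y (g z)); lra.
have -> : \sum_(i < n) y ord0 i * (bary i x - k0 ord0 i)
    = (\sum_(i < n) y ord0 i * lap (fun z => g z ord0 i) x) / lap (fun=> 1) x - dotv y k0.
  rewrite mulr_suml -sumrB; apply: eq_bigr => i _.
  by rewrite mulrBr mulrA.
by rewrite lerBlDr ler_pdivrMr.
Qed.

Let ballL (t : R) (y : V) := ball_ind t y * ((t ^+ 8 - dotv y y ^+ 4) * (r / t * c) * wt y).
Let ballR (t : R) (y : V) := ball_ind t y * (8 * dotv y y ^+ 3 * h y * wt y).

Let mQ k : measurable_fun setT (fun y : V => dotv y y ^+ k).
Proof. by apply: measurable_funX; apply: measurable_dotv; exact: measurable_idV. Qed.

Let QX (t : R) (y : V) k : 0 < t -> dotv y y <= t ^+ 2 -> 0 <= dotv y y ^+ k <= t ^+ (2 * k).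
Proof.
move=> t0 h'; rewrite exprn_ge0 ?dotvv_ge0//= exprM.
by apply: lerXn2r => //; rewrite nnegrE ?dotvv_ge0// exprn_ge0// ltW.
Qed.

Let wtX (t : R) (y : V) : dotv y y <= t ^+ 2 -> `|wt y| <= expR (t ^+ 2 / 2).
Proof. by move=> h'; rewrite ger0_norm ?expR_ge0// ler_expR ler_wpM2r. Qed.

Let tameL t : 0 < t -> tameV (ballL t).
Proof.
move=> t0; apply: (@tame_ball R n t (fun y : V => (t ^+ 8 - dotv y y ^+ 4) * (r / t * c) * wt y) (t ^+ 8 * (r / t * c) * expR (t ^+ 2 / 2))).
  apply: measurable_funM; last exact: measurable_wt.
  by apply: measurable_funM => //; apply: measurable_funB.
move=> y Qy; have /andP[q0 q1] := QX 4 t0 Qy.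
have s0 : 0 <= r / t * c by rewrite mulr_ge0// divr_ge0 ?ltW.
rewrite normrM; apply: ler_pM => //; last exact: wtX.
rewrite normrM (ger0_norm s0); apply: ler_wpM2r => //.
by rewrite ger0_norm ?subr_ge0// gerBl.
Qed.

Let tameR t : 0 < t -> tameV (ballR t).
Proof.
move=> t0; have [mh [C [a [C0 a0 hC]]]] := th.
apply: (@tame_ball R n t (fun y : V => 8 * dotv y y ^+ 3 * h y * wt y) (8 * t ^+ 6 * (C * expR (a * t)) * expR (t ^+ 2 / 2))).
  by apply: measurable_funM; [apply: measurable_funM => //; exact: measurable_funM|exact: measurable_wt].
move=> y Qy; have /andP[q0 q1] := QX 3 t0 Qy.
rewrite normrM; apply: ler_pM => //; last exact: wtX.
rewrite normrM; apply: ler_pM => //.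
  by rewrite normrM (gtr0_norm (ltr0n _ 8)) ler_wpM2l// ger0_norm.
apply: le_trans (hC y) _; rewrite ler_wpM2l// ler_expR ler_wpM2l//.
exact: (ball_norm_le t0).
Qed.

(** The divergence terms integrate to zero, so they may be added on the right. Pointwise on the
    ball, [hc] bounds the sum of the excesses from below and [bary_support] bounds the radial part
    by h. *)
Lemma ball_ineq t : 0 < t -> \int[gamma]_y ballL t y <= \int[gamma]_y ballR t y.
Proof.
move=> t0.
have tT i : tameV (ball_term gamma f g r t k0 i) := tame_ball_term hgamma hg gM k0 r0 t0 i.
have -> : \int[gamma]_y ballR t y = \int[gamma]_y (ballR t y + \sum_(i < n) ball_term gamma f g r t k0 i y).
  rewrite (gauss_intD hgamma); [|exact: tameR|exact: tame_sum].
  by rewrite (gauss_int_sum hgamma)// big1 ?addr0// => i _; exact: (ball_term_int hgamma hg gM k0 r0 t0).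
apply: (gauss_int_le hgamma); [exact: (tameL t0)|apply: (tameD _ (tameR t0)) => //; apply: tame_sum => //|].
move=> y; rewrite /ballL /ballR /ball_term /ball_ind.
have [Qy|_] := boolP (dotv y y <= t ^+ 2); last first.
  by rewrite big1 => [|i _]; rewrite ?mul0r ?addr0// mul0r.
under eq_bigr do rewrite !mul1r.
rewrite !mul1r -mulr_suml -mulrDl ler_wpM2r ?expR_ge0//.
have /andP[q0 q1] := QX 4 t0 Qy.
have /andP[q30 q31] := QX 3 t0 Qy.
set s := r / t; have s0 : 0 < s by exact: divr_gt0.
have v : c <= \sum_(i < n) excess i (s *: y).
  apply: hc; rewrite dotvZl dotvZr mulrA -expr2 /s exprMn exprVn mulrAC ler_pdivrMr ?exprn_gt0//.
  by rewrite ler_wpM2l// exprn_ge0// ltW.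
have -> : \sum_(i < n) ((t ^+ 8 - dotv y y ^+ 4) * (s * excess i (s *: y)) -
      8 * dotv y y ^+ 3 * y ord0 i * (bary i (s *: y) - k0 ord0 i)) =
    (t ^+ 8 - dotv y y ^+ 4) * (s * \sum_(i < n) excess i (s *: y)) -
    8 * dotv y y ^+ 3 * \sum_(i < n) y ord0 i * (bary i (s *: y) - k0 ord0 i).
  rewrite sumrB !mulr_sumr; congr (_ - _); apply: eq_bigr => i _; by rewrite mulrA.
have H1 := bary_support (s *: y) y.
have H2 : (t ^+ 8 - dotv y y ^+ 4) * (s * c) <= (t ^+ 8 - dotv y y ^+ 4) * (s * \sum_(i < n) excess i (s *: y)).
  by rewrite ler_wpM2l ?subr_ge0// ler_wpM2l// ltW.
have q8 : 0 <= 8 * dotv y y ^+ 3 by rewrite mulr_ge0.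
have := ler_wpM2l q8 H1; move: H2; set a1 := _ * (s * c); set a2 := _ * (s * _); set a3 := _ * h y; set a4 := _ * bigop.body _ _ _; lra.
Qed.

Let PA (p : R * V) : R := radial_profile (dotv p.2 p.2) p.1 * (r * c * wt p.2).
Let PB (p : R * V) : R := ball_ind (expR p.1) p.2 * (radial_weight p.1 * (8 * dotv p.2 p.2 ^+ 3 * h p.2 * wt p.2)).

Let PAE u y : PA (u, y) = radial_weight u * ballL (expR u) y.
Proof.
rewrite /PA /ballL /radial_profile /ball_ind /=; case: ifP => _; last by rewrite !mul0r mulr0.
by rewrite mul1r expRN; ring.
Qed.

Let PBE u y : PB (u, y) = radial_weight u * ballR (expR u) y.
Proof. by rewrite /PB /ballR; ring. Qed.

Let PA0 p : 0 <= PA p.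
Proof. by rewrite /PA mulr_ge0 ?radial_profile_ge0 ?dotvv_ge0// mulr_ge0 ?expR_ge0// mulr_ge0// ltW. Qed.

Let PB0 p : 0 <= PB p.
Proof.
rewrite /PB mulr_ge0 ?ler0n// mulr_ge0 ?radial_weight_ge0// mulr_ge0 ?expR_ge0//.
by rewrite mulr_ge0// mulr_ge0// exprn_ge0// dotvv_ge0.
Qed.

Let mind : measurable_fun setT (fun p : R * V => dotv p.2 p.2 <= expR p.1 ^+ 2).
Proof.
apply: measurable_fun_ler; first exact: (measurableT_comp (mQ 1) measurable_snd).
apply: measurable_funX; apply: measurableT_comp; first exact: measurable_expR.
exact: measurable_fst.
Qed.

Let mweight : measurable_fun setT (fun p : R * V => radial_weight p.1).
Proof.
have mw := @continuous_measurable_fun _ _ (@radial_weight_continuous R).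
exact: (measurableT_comp mw measurable_fst).
Qed.

Let mA : measurable_fun setT PA.
Proof.
apply: measurable_funM; last by apply: measurable_funM => //; exact: (measurableT_comp measurable_wt measurable_snd).
apply: measurable_fun_ifT => //.
have me (a : R -> R) : continuous a -> measurable_fun setT (fun p : R * V => a p.1).
  move=> ca; exact: (measurableT_comp (continuous_measurable_fun ca) measurable_fst).
apply: measurable_funM.
  apply: measurable_funM => //; apply: (me (fun u => expR (- u))).
  by move=> u; apply: continuous_comp; [exact: continuousN|exact: continuous_expR].
apply: measurable_funB; last exact: (measurableT_comp (mQ 4) measurable_snd).
by apply: measurable_funX; apply: (me expR); exact: continuous_expR.
Qed.

Let mB : measurable_fun setT PB.
Proof.
apply: measurable_funM.
  rewrite (_ : (fun p : R * V => ball_ind (expR p.1) p.2) = fun p => if dotv p.2 p.2 <= expR p.1 ^+ 2 then 1 else 0).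
    exact: measurable_fun_ifT.
  by apply/funext => p; rewrite /ball_ind; case: ifP.
apply: measurable_funM => //; have [mh _] := th.
apply: measurable_funM; last exact: (measurableT_comp measurable_wt measurable_snd).
apply: measurable_funM; last exact: (measurableT_comp mh measurable_snd).
by apply: measurable_funM => //; exact: (measurableT_comp (mQ 3) measurable_snd).
Qed.

(** Here b^2 = n + 2 is the Gaussian mean of |y|^2 + 2. The bound is affine in |y|^2 and tangent at
    that mean, so integrating it over y returns the value 1 / sqrt(n + 2) of the convex function
    itself. *)
Let innerA y : ((r * c * (7 / 8) * ((3 * (n.+2)%:R - 2 - dotv y y) / (2 * Num.sqrt (n.+2%:R) ^+ 3)))%:E
   <= \int[mu]_u (PA (u, y))%:E)%E.
Proof.
pose b := Num.sqrt (n.+2%:R : R).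
have b0 : 0 < b by rewrite sqrtr_gt0.
have b2 : b ^+ 2 = n.+2%:R by rewrite sqr_sqrtr.
have w0 : 0 <= r * c * wt y by rewrite mulr_ge0 ?expR_ge0// mulr_ge0// ltW.
have := radial_lower (dotvv_ge0 y) b0; rewrite b2 => H.
have -> : (\int[mu]_u (PA (u, y))%:E = (r * c * wt y)%:E * \int[mu]_u (radial_profile (dotv y y) u)%:E)%E.
  rewrite -ge0_integralZl//.
  - by apply: eq_integral => u _; rewrite /PA /= -EFinM mulrC.
  - by apply/measurable_EFinP; exact: measurable_radial_profile.
  - by move=> u _; rewrite lee_fin radial_profile_ge0// dotvv_ge0.
apply: le_trans (lee_wpmul2l _ H); last by rewrite lee_fin.
rewrite -EFinM lee_fin -/b.
have e : wt y * expR (- (dotv y y / 2)) = 1 by rewrite /wt -expRD subrr expR0.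
set X := _ / (2 * b ^+ 3).
rewrite (_ : r * c * wt y * _ = r * c * (7 / 8) * X * (wt y * expR (- (dotv y y / 2)))); last by ring.
by rewrite e mulr1.
Qed.

(** The radial weight is made for this: its mass on the radii t >= |y| is e^(-|y|^2/2) / (8 |y|^6),
    the reciprocal of the factors that multiply h in the ball inequality. *)
Let innerB y : (\int[mu]_u (PB (u, y))%:E <= (h y)%:E)%E.
Proof.
(* At the origin there is no lower end ln |y|, but the integrand vanishes there. *)
have [Q0|Q0] := eqVneq (dotv y y) 0.
  rewrite integral0_eq ?lee_fin// => u _.
  by rewrite /PB /= Q0 expr0n/= mulr0 !mul0r !mulr0.
have Qp : 0 < dotv y y by rewrite lt_neqAle eq_sym Q0 dotvv_ge0.
pose l := ln (dotv y y) / 2.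
have el : expR l ^+ 2 = dotv y y by rewrite -expRM_natl /l mulrC divfK// lnK.
pose K := 8 * dotv y y ^+ 3 * h y * wt y.
have K0 : 0 <= K by rewrite mulr_ge0 ?expR_ge0// mulr_ge0// mulr_ge0// exprn_ge0// ltW.
have mw : measurable_fun setT (EFin \o @radial_weight R).
  by apply/measurable_EFinP; apply: continuous_measurable_fun; exact: radial_weight_continuous.
have -> : (\int[mu]_u (PB (u, y))%:E = K%:E * \int[mu]_(u in `[l, +oo[) (radial_weight u)%:E)%E.
  rewrite [in RHS]integral_mkcond -ge0_integralZl//.
  - apply: eq_integral => u _; rewrite patchE /PB /= /ball_ind -el.
    rewrite (_ : (u \in _) = (expR l ^+ 2 <= expR u ^+ 2)); last first.
      rewrite ler_pXn2r ?nnegrE ?expR_ge0// ler_expR; apply/idP/idP; rewrite inE /= in_itv /= andbT//.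
    case: ifP => _; last by rewrite mul0r mule0.
    by rewrite mul1r -EFinM el mulrC.
  - by apply/(measurable_restrictT _ _).1 => //; apply: measurable_funTS.
  - by move=> u _; rewrite patchE; case: ifP => // _; rewrite lee_fin radial_weight_ge0.
rewrite radial_weight_tail -EFinM lee_fin /K.
have e1 : wt y * egauss l = 1 by rewrite /wt /egauss el -expRD subrr expR0.
have e2 : dotv y y ^+ 3 * expR (- l) ^+ 6 = 1.
  by rewrite -el -exprM -exprMn -expRD subrr expR0 expr1n.
rewrite (_ : _ * (8^-1 * _) = (dotv y y ^+ 3 * expR (- l) ^+ 6) * (wt y * egauss l) * h y); last by field.
by rewrite e1 e2 !mul1r.
Qed.

Lemma average_ineq : r * c * (7 / 8) / Num.sqrt (n.+2%:R) <= \int[gamma]_y h y.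
Proof.
have fin (F : V -> R) : tameV F -> (\int[gamma]_y (F y)%:E = (\int[gamma]_y F y)%:E)%E.
  by move=> tF; rewrite fineK//; apply: integrable_fin_num => //; exact: gauss_integrable.
pose b := Num.sqrt (n.+2%:R : R); rewrite -/b.
have b0 : 0 < b by rewrite sqrtr_gt0.
have b2 : b ^+ 2 = n.+2%:R by rewrite sqr_sqrtr.
pose K := r * c * (7 / 8) / (2 * b ^+ 3).
pose X (y : V) := K * (3 * n.+2%:R - 2 - dotv y y).
have tQ : tameV (fun y : V => dotv y y) by apply: tame_dotv => i; exact: tame_coord.
have tX : tameV X by apply: tame_cstM; apply: tameB => //; exact: tame_cst.
have -> : r * c * (7 / 8) / b = \int[gamma]_y X y.
  rewrite (gauss_intZl hgamma); last by apply: tameB => //; exact: tame_cst.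
  rewrite (gauss_intB hgamma)//; last exact: tame_cst.
  rewrite gauss_cst (gauss_sqnorm hgamma) (_ : 3 * n.+2%:R - 2 - n%:R = 2 * b ^+ 2).
    by rewrite /K; field; rewrite gt_eqF.
  by rewrite b2 -[n.+2]addn2 natrD; ring.
rewrite -lee_fin -(fin _ th).
(* The bound X is negative for large y, while the integrals below are compared as integrals of
   nonnegative functions. *)
pose X0 y := Num.max (X y) 0.
have tX0 : tameV X0.
  apply: (tame_bound _ tX) => [|y].
    by apply: measurable_maxr => //; case: tX.
  by rewrite /X0; case: (leP (X y) 0) => // _; rewrite normr0.
have ft (P : R * V -> R) : measurable_fun setT P -> (forall p, 0 <= P p) ->
    (\int[mu]_u \int[gamma]_y (P (u, y))%:E = \int[gamma]_y \int[mu]_u (P (u, y))%:E)%E.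
  move=> mP P0; apply: (@fubini_tonelli _ _ (measurableTypeR R) V R mu gamma (EFin \o P)).
    by apply/measurable_EFinP.
  by move=> p; rewrite lee_fin.
have msnd (P : R * V -> R) : measurable_fun setT P -> (forall p, 0 <= P p) ->
    measurable_fun setT (fun u : measurableTypeR R => \int[gamma]_y (P (u, y))%:E)%E.
  move=> mP P0; apply: (@measurable_integral_snd _ _ (measurableTypeR R) V R gamma (EFin \o P)).
    by apply/measurable_EFinP.
  by move=> p; rewrite lee_fin.
have mfst (P : R * V -> R) : measurable_fun setT P -> (forall p, 0 <= P p) ->
    measurable_fun setT (fun y : V => \int[mu]_u (P (u, y))%:E)%E.
  move=> mP P0; apply: (@measurable_integral_fst _ _ (measurableTypeR R) V R mu (EFin \o P)).
    by apply/measurable_EFinP.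
  by move=> p; rewrite lee_fin.
apply: (@le_trans _ _ (\int[gamma]_y (X0 y)%:E)%E).
  rewrite (fin _ tX0) lee_fin; apply: (gauss_int_le hgamma) => // y.
  by rewrite /X0 le_max lexx.
have X00 y : 0 <= X0 y by rewrite /X0 le_max lexx orbT.
apply: (@le_trans _ _ (\int[gamma]_y \int[mu]_u (PA (u, y))%:E)%E).
  apply: ge0_le_integral => //.
  - by move=> y _; rewrite lee_fin.
  - by apply/measurable_EFinP; case: tX0.
  - exact: mfst.
  - move=> y _; rewrite /X0; case: (leP (X y) 0) => _.
      by apply: integral_ge0 => u _; rewrite lee_fin.
    apply: le_trans (innerA y); rewrite lee_fin -/b /X /K.
    by rewrite le_eqVlt; apply/orP; left; apply/eqP; field; rewrite gt_eqF.
rewrite -ft//; apply: (@le_trans _ _ (\int[gamma]_y \int[mu]_u (PB (u, y))%:E)%E); last first.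
  apply: ge0_le_integral => //.
  - by move=> y _; apply: integral_ge0 => u _; rewrite lee_fin.
  - exact: mfst.
  - by apply/measurable_EFinP; case: th.
rewrite -ft//; apply: ge0_le_integral => //.
- by move=> u _; apply: integral_ge0 => y _; rewrite lee_fin.
- exact: msnd.
- exact: msnd.
move=> u _; have u0 : 0 < expR u by exact: expR_gt0.
under eq_integral => y _ do rewrite PAE.
under [leRHS]eq_integral => y _ do rewrite PBE.
rewrite (fin (fun y => radial_weight u * ballL (expR u) y)); last by apply: tame_cstM; exact: tameL.
rewrite (fin (fun y => radial_weight u * ballR (expR u) y)); last by apply: tame_cstM; exact: tameR.
rewrite lee_fin (gauss_intZl hgamma) ?(gauss_intZl hgamma)//; [|exact: tameR|exact: tameL].
by rewrite ler_wpM2l ?radial_weight_ge0// ball_ineq.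
Qed.

End average.

(** * The support function of the gradients *)

Section width.
Context {R : realType} {n : nat}.
Local Notation V := 'rV[R]_n.
Local Notation N01 := (normal_prob (0:R) 1).
Local Notation tameV := (tame (fun y : V => `|y|)).
Local Notation tame1 := (tame (fun z : R => `|z|)).
Variable gamma : probability V R.
Hypothesis hgamma : std_gaussian gamma.

Lemma gauss1_fourth : \int[N01]_z (z ^+ 4) = 3.
Proof.
have tX k : tame1 (fun z => z ^+ k) by apply: tameX => //; exact: tame1_id.
have t3 : tame1 (fun z => 3 * z ^+ 2) by exact: tame1_cstM.
have d (z : R) : is_derive z 1 (fun z => z ^+ 3) (3 * z ^+ 2).
  by apply: (is_derive_ext (is_deriveXr 3 (is_derive_id z 1))) => //; rewrite mulr1.
have c : continuous (fun z : R => 3 * z ^+ 2).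
  exact: is_derive_continuous (fun z => is_deriveCr 3 (is_deriveXr 2 (is_derive_id z 1))).
have := gauss1_ibp d c (tX 3) t3.
under eq_Rintegral do rewrite -exprS.
rewrite gauss1_intB// gauss1_intZl// gauss1_var mulr1 => /eqP.
by rewrite subr_eq0 => /eqP.
Qed.

(** A bounded odd substitute for the sign function. Being rational it compares with polynomials, so
    only the second and fourth Gaussian moments are needed. *)
Let psi (z : R) := 2 * z / (1 + z ^+ 2).

Let d0 (z : R) : 0 < 1 + z ^+ 2. Proof. by rewrite ltr_wpDr ?sqr_ge0. Qed.

Let psi_le z : `|psi z| <= 1.
Proof.
rewrite /psi ler_norml ler_pdivlMr// ler_pdivrMr//.
have h1 := sqr_ge0 (z - 1); have h2 := sqr_ge0 (z + 1).
by apply/andP; split; nra.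
Qed.

Let tpsi : tame1 psi.
Proof.
have t1 : tame1 (fun=> 1) by exact: tame_cst.
apply: (tame_bound _ t1) => [|z]; last by rewrite normr1 psi_le.
apply: continuous_measurable_fun => z; apply: cvgM.
  by apply: cvgM; [exact: cvg_cst|exact: cvg_id].
apply: cvgV; first by rewrite gt_eqF.
by apply: cvgD; [exact: cvg_cst|exact: exprn_continuous].
Qed.

(* 2 / (1 + w) lies above its tangent (7 - w) / 8 at w = 3; here w = z^2. *)
Let psi_gap : 1 / 2 <= \int[N01]_z (z * psi z).
Proof.
have tX k : tame1 (fun z => z ^+ k) by apply: tameX => //; exact: tame1_id.
have t2 : tame1 (fun z => 7 / 8 * z ^+ 2) by exact: tame1_cstM.
have t4 : tame1 (fun z => 1 / 8 * z ^+ 4) by exact: tame1_cstM.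
have -> : 1 / 2 = \int[N01]_z (7 / 8 * z ^+ 2 - 1 / 8 * z ^+ 4).
  by rewrite gauss1_intB// !gauss1_intZl// gauss1_var gauss1_fourth; field.
apply: gauss1_int_le; [exact: tameB|apply: tameM => //; exact: tame1_id|].
move=> z; rewrite /psi mulrA ler_pdivlMr//.
rewrite -subr_ge0.
have -> : z * (2 * z) - (7 / 8 * z ^+ 2 - 1 / 8 * z ^+ 4) * (1 + z ^+ 2) = z ^+ 2 * (z ^+ 2 - 3) ^+ 2 / 8 by field.
by rewrite divr_ge0// mulr_ge0 ?sqr_ge0.
Qed.

Let tpsiV i : tameV (fun y => psi (y ord0 i)).
Proof.
have t1 : tameV (fun=> 1) by exact: tame_cst.
apply: (tame_bound _ t1) => [|z]; last by rewrite normr1 psi_le.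
by case: tpsi => mp _; exact: (measurableT_comp mp (measurable_coord i)).
Qed.

Let psi_corr (a : V) i : \int[gamma]_y (dotv a y * psi (y ord0 i)) = a ord0 i * \int[N01]_z (z * psi z).
Proof.
have tj j : tameV (fun y => y ord0 j * psi (y ord0 i)) by apply: tameM => //; exact: tame_coord.
transitivity (\int[gamma]_y (\sum_(j < n) a ord0 j * (y ord0 j * psi (y ord0 i)))).
  by apply: eq_Rintegral => y _; rewrite mulr_suml; apply: eq_bigr => j _; rewrite mulrA.
rewrite (gauss_int_sum hgamma); last by move=> j; exact: tame_cstM.
rewrite (bigD1 i)//= big1 ?addr0 => [|j ji]; rewrite (gauss_intZl hgamma)//.
  congr (_ * _); rewrite -(tame_gauss_upd hgamma i (tj i)).
  under eq_Rintegral => y _ do under eq_Rintegral => z _ do rewrite mxE eqxx.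
  by rewrite gauss_cst.
rewrite -(tame_gauss_upd hgamma j (tj j)).
under eq_Rintegral => y _.
  under eq_Rintegral => z _ do rewrite !mxE eqxx eq_sym (negbTE ji) mulrC.
  rewrite gauss1_intZl; last exact: tame1_id.
  rewrite gauss1_mean mulr0.
  over.
by rewrite gauss_cst mulr0.
Qed.

(** For a number q with |q| <= 1, max(0, s) >= s (1 + q) / 2. With q the sign of the i-th coordinate
    of a times psi of that of y, the linear part has mean zero and the correlation is at least |a_i|
    / 2. Thus a finite mean width bounds the differences of gradients. *)
Lemma gauss_pos_part (a : V) i : `|a ord0 i| / 4 <= \int[gamma]_y Num.max 0 (dotv a y).
Proof.
have ta : tameV (fun y => dotv a y) by exact: tame_dotvl.
have tm : tameV (fun y => Num.max 0 (dotv a y)).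
  apply: (tame_bound _ ta) => [|y].
    by apply: measurable_maxr => //; case: ta.
  by case: (leP 0 (dotv a y)) => // _; rewrite normr0.
pose th := Num.sg (a ord0 i).
have th1 : `|th| <= 1 by rewrite /th normr_sg; case: (_ != 0).
have tp : tameV (fun y => dotv a y * psi (y ord0 i)) by exact: tameM.
have tc : tameV (fun y => th * (dotv a y * psi (y ord0 i))) by exact: tame_cstM.
apply: (@le_trans _ _ (\int[gamma]_y (2^-1 * (dotv a y + th * (dotv a y * psi (y ord0 i)))))).
  rewrite (gauss_intZl hgamma); last exact: tameD.
  rewrite (gauss_intD hgamma)// (gauss_mean_dotv hgamma) add0r (gauss_intZl hgamma)// psi_corr.
  rewrite (mulrA th) -(normrEsg (a ord0 i)).
  have := ler_wpM2l (normr_ge0 (a ord0 i)) psi_gap; lra.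
apply: (gauss_int_le hgamma) => //; first by apply: tame_cstM; exact: tameD.
move=> y; set s := dotv a y; set q := psi _.
have hq : `|th * q| <= 1 by rewrite normrM mulr_ile1// psi_le.
move: hq; rewrite ler_norml => /andP[q1 q2].
rewrite (_ : 2^-1 * _ = s * (2^-1 * (1 + th * q))); last by ring.
by case: (leP 0 s) => s0; nra.
Qed.

Variable g : V -> V.
Hypothesis cg : continuous g.

Definition support (y : V) : \bar R := ereal_sup [set (dotv (g x) y)%:E | x in [set: V]].

Lemma support_ge x y : ((dotv (g x) y)%:E <= support y)%E.
Proof. by apply: ereal_sup_ubound; exists x. Qed.

(** As g is continuous, a level exceeded by the supremum is exceeded at a point of one of the
    countable grids, so the superlevel sets are countable unions of half-spaces. *)
Lemma measurable_support : measurable_fun setT support.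
Proof.
move=> mT; apply: (measurability _ (ErealGenOInfty.measurableE R)) => // _ [_ [c ->] <-].
rewrite setTI.
pose grid N (z : 'rV[int]_n) : V := \row_i ((z ord0 i)%:~R / N.+1%:R).
have -> : support @^-1` `]c%:E, +oo[ = \bigcup_N \bigcup_(z in [set: 'rV[int]_n])
    (dotv (g (grid N z)) @^-1` `]c, +oo[).
  apply/seteqP; split => y /=; rewrite in_itv /= andbT.
    move=> /ereal_sup_gtP[_ [x _ <-]]; rewrite lte_fin => cx.
    have [z zx] := grid_approx x.
    have cd : continuous (fun x => dotv (g x) y).
      move=> w; apply: (cvg_comp g (fun v => dotv v y)); first exact: cg.
      exact: (@continuous_dotvl R n y (g w)).
    have h := cvg_comp (fun N => grid N (z N)) (fun x => dotv (g x) y) zx (cd x).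
    have [N _ /(_ N (leqnn N)) HN] := cvgr_gt _ h _ cx.
    by exists N => //; exists (z N) => //=; rewrite in_itv /= andbT.
  move=> [N _ [z _ /=]]; rewrite in_itv /= andbT => h.
  by apply: lt_le_trans (support_ge (grid N z) y); rewrite lte_fin.
apply: bigcup_measurable => N _; apply: countable_bigcupT_measurable; first exact: countableP.
move=> z; rewrite -[X in measurable X]setTI.
have md : measurable_fun setT (dotv (g (grid N z))) by case: (tame_dotvl (g (grid N z))).
exact: md.
Qed.

Lemma support_potential : (\int[gamma]_y support y < +oo)%E -> exists h : V -> R,
  [/\ tameV h, forall y, 0 <= h y, forall x y, dotv y (g x - g 0) <= h y,
      (\int[gamma]_y support y = (\int[gamma]_y h y)%:E)%E &
      forall x i, `|(g x - g 0) ord0 i| / 4 <= \int[gamma]_y h y].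
Proof.
move=> Doo; pose k y := dotv (g 0) y.
have tk : tameV k by exact: tame_dotvl.
have ik := gauss_integrable hgamma tk.
have mk : measurable_fun setT (EFin \o k) by apply/measurable_EFinP; case: tk.
(* The hypothesis concerns a difference of two integrals. The negative part is at most |<g 0, y>|,
   hence of finite integral, and the positive part follows. *)
have neg : (\int[gamma]_y support^\- y < +oo)%E.
  have /integrableP[_] := ik; apply: le_lt_trans.
  apply: ge0_le_integral => //.
  - exact: measurable_funeneg measurable_support.
  - exact: measurableT_comp.
  move=> y _; rewrite funenegE ge_max abse_ge0 andbT.
  have := support_ge 0 y; rewrite -leeN2 => /le_trans; apply.
  by rewrite -EFinN abse_EFin lee_fin -normrN ler_norm.
have neg0 : (0 <= \int[gamma]_y support^\- y)%E by apply: integral_ge0.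
have pos : (\int[gamma]_y support^\+ y < +oo)%E.
  rewrite ltey; apply/eqP => e; move: Doo; rewrite integralE e.
  by case: (\int[gamma]_y support^\- y)%E neg neg0.
have iS : gamma.-integrable setT support.
  apply/integrableP; split; first exact: measurable_support.
  rewrite (_ : (fun y => `|support y|%E) = (support^\+ \+ support^\-)%E); last by rewrite -fune_abse.
  rewrite ge0_integralD//; first by rewrite lte_add_pinfty.
  - exact: measurable_funepos measurable_support.
  - exact: measurable_funeneg measurable_support.
pose H y := (support y - (k y)%:E)%E.
have H0 y : (0 <= H y)%E by rewrite /H sube_ge0 ?support_ge.
have mH : measurable_fun setT H by apply: emeasurable_funB => //; exact: measurable_support.
have DH : (\int[gamma]_y support y = \int[gamma]_y H y)%E.
  rewrite /H (integralB _ iS ik)// (_ : (\int[gamma]_y (k y)%:E = 0)%E) ?sube0//.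
  rewrite -(fineK (integrable_fin_num _ ik))//.
  by rewrite -/(Rintegral gamma setT k) (gauss_mean_dotv hgamma).
have Dfin := integrable_fin_num measurableT iS.
set D := fine (\int[gamma]_y support y)%E.
have DE : (\int[gamma]_y H y = D%:E)%E by rewrite -DH fineK.
(* H is at least 0 and at least <g x - g 0, y>, so its mean is at least that of the positive part of
   the latter. *)
have gap x i : `|(g x - g 0) ord0 i| / 4 <= D.
  rewrite -lee_fin -DE.
  pose a := g x - g 0; rewrite -/a.
  have tm : tameV (fun y => Num.max 0 (dotv a y)).
    have ta := tame_dotvl a.
    apply: (tame_bound _ ta) => [|y].
      by apply: measurable_maxr => //; case: ta.
    by case: (leP 0 (dotv a y)) => // _; rewrite normr0.
  apply: (@le_trans _ _ (\int[gamma]_y (Num.max 0 (dotv a y)))%:E); first by rewrite lee_fin gauss_pos_part.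
  rewrite /Rintegral fineK; last by apply: integrable_fin_num => //; exact: (gauss_integrable hgamma tm).
  apply: ge0_le_integral => //.
  - by move=> y _; rewrite lee_fin le_max lexx.
  - by apply/measurable_EFinP; case: tm.
  move=> y _; case: (leP 0 (dotv a y)) => // _.
  rewrite /H /a dotvDl dotvNl EFinB; apply: leeB; [exact: support_ge|exact: lexx].
(* H is extended-valued a priori; the bound on g x - g 0 makes it finite everywhere and of linear
   growth. *)
have Hle y : (H y <= (n%:R * ((4 * D) * `|y|))%:E)%E.
  rewrite /H leeBlDr//; apply/ereal_supP => _ [x _ <-]; rewrite -EFinD lee_fin.
  rewrite -lerBlDr -dotvNl -dotvDl.
  apply: le_trans (ler_norm _) _; apply: le_trans (normv_sum _ _) _.
  apply: ler_wpM2l => //; apply: ler_wpM2r => //.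
  have D0 : 0 <= D by rewrite -lee_fin -DE; apply: integral_ge0.
  by apply/normv_leP => [|i]; [exact: mulr_ge0|have := gap x i; lra].
have Hfin y : H y \is a fin_num.
  by rewrite ge0_fin_numE//; apply: le_lt_trans (Hle y) _; rewrite ltry.
pose h y := fine (H y).
have hE y : (h y)%:E = H y by rewrite /h fineK.
have th : tameV h.
  have tb : tameV (fun y : V => n%:R * ((4 * D) * `|y|)).
    by apply: tame_cstM; apply: tame_cstM; exact: tame_normV.
  apply: (tame_bound _ tb) => [|y]; first by apply: measurableT_comp mH; exact: fine_measurable.
  rewrite ger0_norm; last by rewrite -lee_fin hE.
  by apply: le_trans (ler_norm _); rewrite -lee_fin hE.
have Dh : \int[gamma]_y h y = D.
  by rewrite /Rintegral; under eq_integral do rewrite hE; rewrite DE.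
exists h; split => //.
- by move=> y; rewrite -lee_fin hE.
- move=> x y; rewrite -lee_fin hE /H dotvC dotvDl dotvNl EFinB; apply: leeB; [exact: support_ge|exact: lexx].
- by rewrite Dh DH DE.
- by move=> x i; rewrite Dh.
Qed.

End width.

(** * Choice of the tilt *)

Section selection.
Context {R : realType} {n : nat}.
Local Notation V := 'rV[R]_n.
Local Notation tameV := (tame (fun y : V => `|y|)).
Variable gamma : probability V R.
Hypothesis hgamma : std_gaussian gamma.
Variables (f : V -> R) (g : V -> V) (M : R).
Hypothesis hg : has_gradient f g.
Hypothesis gM : forall y, `|g y| <= M.

(** If g is constant then so is [bary i], and [excess i] is its derivative by [bary_derive]. This
    settles the case of zero mean width. *)
Lemma excess_cst_gradient k : (forall y, g y = k) -> forall i, excess gamma f i 0 = 0.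
Proof.
move=> gk i; have t1 : tameV (fun=> 1) by exact: tame_cst.
have bk x : bary gamma f g i x = k ord0 i.
  rewrite /bary (_ : (fun y => g y ord0 i) = fun y => k ord0 i * 1); last by apply/funext => y; rewrite gk mulr1.
  rewrite /lap; under eq_Rintegral do rewrite -mulrA.
  rewrite (gauss_intZl hgamma) ?mulfK//; last exact: (tame_lapF hg gM x t1).
  by rewrite gt_eqF// (lap_gt0 hgamma hg gM).
have d := bary_derive hgamma hg gM 0 i 0.
have d' : is_derive (0 : R) 1 (fun z => bary gamma f g i (upd 0 i z)) 0.
  by apply: (is_derive_ext (is_derive_cst (k ord0 i) (0:R) 1)).
have -> : (0 : V) = upd 0 i 0 by apply/rowP => j; rewrite !mxE if_same.
by rewrite -(@derive_val _ _ _ _ _ _ _ d) (@derive_val _ _ _ _ _ _ _ d').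
Qed.

Lemma exists_small_excess (r : R) (k0 : V) (h : V -> R) : 0 < r ->
  tameV h -> (forall y, 0 <= h y) -> (forall x y, dotv y (g x - k0) <= h y) ->
  (forall x i, `|(g x - k0) ord0 i| / 4 <= \int[gamma]_y h y) ->
  exists x, dotv x x <= r ^+ 2 /\
    \sum_(i < n) excess gamma f i x <= 2 * Num.sqrt n%:R / r * \int[gamma]_y h y.
Proof.
move=> r0 th h0 hle gap; set m := \int[gamma]_y h y.
have m0 : 0 <= m by apply: Rintegral_ge0 => y _.
have zero_ok : \sum_(i < n) excess gamma f i 0 <= 2 * Num.sqrt n%:R / r * m -> exists x, dotv x x <= r ^+ 2 /\
    \sum_(i < n) excess gamma f i x <= 2 * Num.sqrt n%:R / r * m.
  by move=> e; exists 0; rewrite dotv0l sqr_ge0.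
have [n0|n0] := posnP n.
  apply: zero_ok; rewrite big1 => [|[i hi] _]; last by exfalso; rewrite n0 in hi.
  by rewrite mulr_ge0// divr_ge0 ?(ltW r0)// mulr_ge0// sqrtr_ge0.
(* Zero mean width forces a constant gradient through [gap]. The contradiction below divides by m,
   so this case is settled directly, at the origin. *)
have [m00|mn] := eqVneq m 0.
  apply: zero_ok; rewrite m00 mulr0 big1// => i _; apply: (excess_cst_gradient (k := k0)) => y.
  apply/eqP; rewrite -subr_eq0; apply/eqP/rowP => j; rewrite [RHS]mxE.
  by apply/eqP; rewrite -normr_le0; have := gap y j; rewrite -/m m00; lra.
have mp : 0 < m by rewrite lt_neqAle eq_sym mn.
pose c := 2 * Num.sqrt n%:R / r * m.
have c0 : 0 <= c by rewrite mulr_ge0// divr_ge0 ?(ltW r0)// mulr_ge0// sqrtr_ge0.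
apply: contrapT => hN.
have hc x : dotv x x <= r ^+ 2 -> c <= \sum_(i < n) excess gamma f i x.
  move=> xr; rewrite leNgt; apply/negP => lt; apply: hN; exists x; split => //; exact: ltW.
have := average_ineq hgamma hg gM r0 c0 th h0 hle hc; rewrite -/m.
set b := Num.sqrt n.+2%:R; set a := Num.sqrt n%:R in c c0 hc *.
have b0 : 0 < b by rewrite sqrtr_gt0.
have a0 : 0 <= a by exact: sqrtr_ge0.
have b2 : b ^+ 2 = n%:R + 2 by rewrite sqr_sqrtr// -[n.+2]addn2 natrD.
have a2 : a ^+ 2 = n%:R by rewrite sqr_sqrtr.
rewrite ler_pdivrMr// (_ : r * c * (7 / 8) = m * (7 / 4 * a)); last first.
  by rewrite /c; field; rewrite gt_eqF.
rewrite ler_pM2l// => h1.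
have n1 : 1 <= n%:R :> R by rewrite ler1n.
(* This reads 49/16 n <= n + 2, which fails for n >= 1 because 33/16 > 2. *)
have : (7 / 4 * a) ^+ 2 <= b ^+ 2.
  by apply: lerXn2r; rewrite ?nnegrE ?(ltW b0)// mulr_ge0.
rewrite exprMn a2 b2; lra.
Qed.

End selection.

(** * The transport bound for a tilt *)

Section coupling.
Context {R : realType} {n : nat}.
Local Notation V := 'rV[R]_n.
Local Notation tameV := (tame (fun y : V => `|y|)).
Variable gamma : probability V R.
Hypothesis hgamma : std_gaussian gamma.

Lemma pushforward_probability d (T : measurableType d) d' (U : measurableType d') (P : probability T R)
    (phi : T -> U) : measurable_fun setT phi ->
  exists Q : probability U R, forall A, Q A = P (phi @^-1` A).
Proof.
move=> mphi; pose X : {mfun T >-> U} := HB.pack phi (isMeasurableFun.Build _ _ _ _ phi mphi).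
by exists (distribution P X).
Qed.

Variables (f : V -> R) (g : V -> V) (M L : R).
Hypothesis hg : has_gradient f g.
Hypothesis gM : forall y, `|g y| <= M.
Hypothesis heat : forall x (s : R), 0 <= s -> f x - L / 2 * s ^+ 2 <= \int[gamma]_y f (x + s *: y).
Variable nu : {measure set V -> \bar R}.
Hypothesis hnu : forall A, measurable A -> nu A = (\int[gamma]_(y in A) (expR (f y))%:E)%E.
Variable x : V.

Let F := tiltf f x.
Let Z := lap gamma f (fun=> 1) x.
(** The logarithm of the density of the tilted probability with respect to [gamma]. It differs from
    f by an affine function, whose Gaussian averages about a point equal its value there, so the
    heat bound carries over with the same L. *)
Let F1 y := F y - ln Z.
Let g1 y := g y + x.

Let Z0 : 0 < Z := lap_gt0 hgamma hg gM x.
Let hF : has_gradient F g1 := tilt_gradient hg x.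
Let hgM : forall y, `|g1 y| <= M + `|x| := tilt_gradient_le gM x.

Let expF1 y : expR (F1 y) = expR (F y) / Z.
Proof. by rewrite /F1 expRD expRN lnK. Qed.

Let hF1 : has_gradient F1 g1.
Proof.
have [cg dg] := hF; split => // y v t.
have d := is_deriveDr (dg y v t) (is_derive_cst (- ln Z) t 1).
by apply: (is_derive_ext d) => //; rewrite addr0.
Qed.

Let tE1 : tameV (fun y => expR (F1 y)) := tame_exp_potential hF1 hgM.

Let lapE P : tameV P -> \int[gamma]_y (expR (F1 y) * P y) = lap gamma f P x / Z.
Proof.
move=> tP; rewrite /lap -/F -(gauss_intZr hgamma); last exact: (tame_lapF hg gM x tP).
by apply: eq_Rintegral => y _; rewrite expF1; ring.
Qed.

Let E1 : \int[gamma]_y expR (F1 y) = 1.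
Proof.
transitivity (\int[gamma]_y (expR (F1 y) * 1)); first by apply: eq_Rintegral => y _; rewrite mulr1.
rewrite lapE; last exact: tame_cst.
by rewrite divff// gt_eqF.
Qed.

Let heat1 : forall w (s : R), 0 <= s -> F1 w - L / 2 * s ^+ 2 <= \int[gamma]_y F1 (w + s *: y).
Proof.
move=> w s s0.
have tf : tameV (fun y => f (w + s *: y)) by exact: (tame_section_aff s w (tame_potential hg gM)).
have td := tame_dotvl x.
have tsd : tameV (fun y => s * dotv x y) by exact: tame_cstM.
have tc (c : R) : tameV (fun=> c) by exact: tame_cst.
have tc2 : tameV (fun y => s * dotv x y + (dotv x w - ln Z)) by exact: tameD.
have -> : \int[gamma]_y F1 (w + s *: y) = \int[gamma]_y (f (w + s *: y) + (s * dotv x y + (dotv x w - ln Z))).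
  by apply: eq_Rintegral => y _; rewrite /F1 /F /tiltf !dotvE; ring.
rewrite (gauss_intD hgamma)// (gauss_intD hgamma)// (gauss_intZl hgamma)// (gauss_mean_dotv hgamma) gauss_cst.
have := heat w s0; rewrite /F1 /F /tiltf; lra.
Qed.

Let u : V := \row_i \int[gamma]_y (expR (F1 y) * y ord0 i).

Let knothe1 (y : V) : V := \row_k transport (cond gamma F1 k y) (y ord0 k).
Let knothe1E y k : knothe1 y ord0 k = transport (cond gamma F1 k y) (y ord0 k).
Proof. by rewrite mxE. Qed.

Lemma tilt_probability : exists P : probability V R, (P : set V -> \bar R) = tilt nu x /\
  forall A, measurable A -> P A = (\int[gamma]_(y in A) (expR (F1 y))%:E)%E.
Proof.
have me : measurable_fun setT (fun y => expR (dotv x y)).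
  by apply: measurableT_comp => //; case: (tame_dotvl x).
have mf : measurable_fun setT (fun y => expR (f y)) by case: (tame_exp_potential hg gM).
have [nu0 nu0E] := exists_density nu me (fun y => expR_ge0 _).
have dens A : measurable A -> nu0 A = (Z%:E * \int[gamma]_(y in A) (expR (F1 y))%:E)%E.
  move=> mA; rewrite nu0E integral_mkcond.
  rewrite (ge0_integral_density mf (fun y => expR_ge0 _) hnu); last 2 first.
  - by apply/(measurable_restrictT _ _).1 => //; apply: measurable_funTS; exact/measurable_EFinP.
  - by move=> y; rewrite patchE; case: ifP => // _; rewrite lee_fin expR_ge0.
  rewrite -ge0_integralZl//; last 2 first.
  - by apply: measurable_funTS; apply/measurable_EFinP; case: tE1.
  - by rewrite lee_fin ltW.
  rewrite [RHS]integral_mkcond; apply: eq_integral => y _; rewrite !patchE.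
  case: ifP => _; last by rewrite mul0e.
  by rewrite -!EFinM expF1 /F /tiltf expRD; congr EFin; field; rewrite gt_eqF.
have nuT : nu0 setT = Z%:E.
  by rewrite dens// -[X in (_ * X)%E](@fineK _)//; [rewrite -/(Rintegral gamma setT _) E1 mule1|
    apply: integrable_fin_num => //; exact: gauss_integrable].
(* [mnormalize] falls back on [gamma] when the mass is zero or infinite; by [nuT] the mass is the
   positive real Z. *)
pose P : probability V R := mnormalize nu0 gamma.
have PE A : P A = (nu0 A * (Z^-1)%:E)%E by rewrite /P /= /mnormalize nuT /= eqe gt_eqF.
exists P; split.
  by apply/funext => A; rewrite PE /tilt -!nu0E nuT inver gt_eqF.
by move=> A mA; rewrite PE dens// muleC muleA -EFinM mulVf ?mul1e// gt_eqF.
Qed.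

Lemma tilt_centroid : centroid (tilt nu x) = u.
Proof.
have [P [<- PE]] := tilt_probability.
have m1 : measurable_fun setT (fun y => expR (F1 y)) by case: tE1.
apply/rowP => i; rewrite !mxE /Rintegral; congr fine.
have mi : measurable_fun setT (fun y : V => (y ord0 i)%:E) by apply/measurable_EFinP; exact: measurable_coord.
rewrite (integral_density m1 (fun y => expR_ge0 _) PE mi).
by apply: eq_integral => y _; rewrite -EFinM mulrC.
Qed.

(** By [lap_ibp] the mean of [g1] under the tilt is the centroid u, so centring subtracts |u|^2 from
    the gradient energy just as it does from the second moment. The energy inequality for [F1] then
    compares the centred quantities, and the variance minus n is the sum of the excesses. *)
Lemma tilt_energy : \int[gamma]_y (expR (F1 y) * dotv (g1 y - u) (g1 y - u)) <= L + \sum_(i < n) excess gamma f i x.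
Proof.
have tg i : tameV (fun y => g1 y ord0 i) := tame_gradient_coord hF1 hgM i.
have tc i := @tame_coord R n i.
have t1 c : tameV (fun=> c) by exact: tame_cst.
have mulE (P : V -> R) : tameV P -> tameV (fun y => expR (F1 y) * P y) by move=> tP; exact: tameM.
have tgg : tameV (fun y => dotv (g1 y) (g1 y)) by exact: tame_dotv.
have tyy : tameV (fun y : V => dotv y y) by exact: tame_dotv.
have tug : tameV (fun y => dotv u (g1 y)) by apply: tame_dotv => // i; exact: t1.
have Eg i : \int[gamma]_y (expR (F1 y) * g1 y ord0 i) = u ord0 i.
  rewrite mxE !lapE// /lap.
  congr (_ / _); rewrite -/(lap gamma f (fun y => y ord0 i) x) (lap_ibp hgamma hg gM).
  have tgi := tame_gradient_coord hg gM i.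
  rewrite /lap -(gauss_intZl hgamma); last exact: (tame_lapF hg gM x (t1 1)).
  rewrite -(gauss_intD hgamma); last 2 first.
  - exact: (tame_lapF hg gM x tgi).
  - by apply: tame_cstM; exact: (tame_lapF hg gM x (t1 1)).
  by apply: eq_Rintegral => y _; rewrite /g1 mxE; ring.
have Eug : \int[gamma]_y (expR (F1 y) * dotv u (g1 y)) = dotv u u.
  transitivity (\int[gamma]_y (\sum_(i < n) u ord0 i * (expR (F1 y) * g1 y ord0 i))).
    by apply: eq_Rintegral => y _; rewrite mulr_sumr; apply: eq_bigr => i _; ring.
  rewrite (gauss_int_sum hgamma); last by move=> i; apply: tame_cstM; exact: mulE.
  by apply: eq_bigr => i _; rewrite (gauss_intZl hgamma) ?Eg//; exact: mulE.
have sq (v w : V) : dotv (v - w) (v - w) = dotv v v - 2 * dotv w v + dotv w w.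
  by rewrite dotvDl !dotvDr !dotvNl !dotvNr (dotvC v w); ring.
have expand : \int[gamma]_y (expR (F1 y) * dotv (g1 y - u) (g1 y - u)) =
    \int[gamma]_y (expR (F1 y) * dotv (g1 y) (g1 y)) - dotv u u.
  transitivity (\int[gamma]_y (expR (F1 y) * dotv (g1 y) (g1 y) - 2 * (expR (F1 y) * dotv u (g1 y)) + dotv u u * expR (F1 y))).
    by apply: eq_Rintegral => y _; rewrite sq; ring.
  have te := mulE _ tgg; have te2 := tame_cstM 2 (mulE _ tug); have te3 := tame_cstM (dotv u u) tE1.
  rewrite (gauss_intD hgamma)//; last exact: tameB.
  rewrite (gauss_intB hgamma)// !(gauss_intZl hgamma)//; last exact: mulE.
  by rewrite Eug E1; ring.
have exc : \sum_(i < n) excess gamma f i x = \int[gamma]_y (expR (F1 y) * dotv y y) - dotv u u - n%:R.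
  transitivity (\sum_(i < n) (\int[gamma]_y (expR (F1 y) * (y ord0 i * y ord0 i)) - u ord0 i * u ord0 i - 1)).
    apply: eq_bigr => i _; rewrite /excess lapE; last exact: tameM.
    by rewrite !mxE lapE; [rewrite expr2|exact: tc].
  rewrite !sumrB sumr_const card_ord; congr (_ - _ - _).
  rewrite -(gauss_int_sum hgamma); last by move=> i; apply: mulE; exact: tameM.
  by apply: eq_Rintegral => y _; rewrite /dotv mulr_sumr.
have := energy_le hgamma hF1 hgM heat1.
have split (P : V -> R) c : tameV P -> \int[gamma]_y (expR (F1 y) * (P y - c)) = \int[gamma]_y (expR (F1 y) * P y) - c.
  move=> tP; transitivity (\int[gamma]_y (expR (F1 y) * P y - c * expR (F1 y))).
    by apply: eq_Rintegral => y _; ring.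
  rewrite (gauss_intB hgamma); [|exact: mulE|exact: tame_cstM].
  by rewrite (gauss_intZl hgamma)// E1 mulr1.
rewrite (split (fun y => dotv (g1 y) (g1 y)))// (split (fun y => dotv y y))// expand exc; lra.
Qed.

Lemma tilt_transport : (W2sq (tilt nu x) (gauss_at gamma (centroid (tilt nu x))) <=
  (L + \sum_(i < n) excess gamma f i x)%:E)%E.
Proof.
rewrite tilt_centroid; have [P [PT PE]] := tilt_probability.
have mK : measurable_fun setT knothe1 := measurable_knothe hgamma hF1 hgM knothe1E.
have m1 : measurable_fun setT (fun y => expR (F1 y)) by case: tE1.
have mS : measurable_fun setT (fun y => u + knothe1 y).
  apply/measurable_rowP => i; under eq_fun do rewrite mxE.
  by apply: measurable_funD => //; exact: (measurableT_comp (measurable_coord i) mK).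
(* The coupling is the law of (y, u + knothe1 y) under the tilt: the Knothe map produces the centred
   Gaussian, and u moves it to the required centroid. *)
have mphi : measurable_fun setT (fun y => (y, u + knothe1 y)) by apply: measurable_fun_pair => //; exact: measurable_id.
have [Q QE] := pushforward_probability P mphi.
have mcost : measurable_fun setT (fun z : V * V => (enorm (z.1 - z.2) ^+ 2)%:E).
  rewrite (_ : (fun z => _) = fun z : V * V => (dotv (z.1 - z.2) (z.1 - z.2))%:E); last first.
    by apply/funext => z; rewrite /enorm sqr_sqrtr// dotvv_ge0.
  have mB : measurable_fun setT (fun z : V * V => z.1 - z.2).
    apply/measurable_rowP => i; under eq_fun do rewrite !mxE.
    apply: measurable_funB.
      exact: (measurableT_comp (measurable_coord i) measurable_fst).
    exact: (measurableT_comp (measurable_coord i) measurable_snd).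
  by apply/measurable_EFinP; exact: measurable_dotv.
apply: (@le_trans _ _ (\int[Q]_z (enorm (z.1 - z.2) ^+ 2)%:E)%E).
  apply: ereal_inf_lbound; exists Q; split => // A mA; split.
    by rewrite QE -PT; congr (P _); apply/seteqP; split => y /=; [case|].
  rewrite QE /gauss_at.
  have mB : measurable [set y : V | A (y + u)].
    have mD : measurable_fun setT (fun y : V => y + u).
      apply/measurable_rowP => i; under eq_fun do rewrite mxE.
      by apply: measurable_funD => //; exact: measurable_coord.
    by have := mD measurableT A mA; rewrite setTI.
  have mC : measurable [set y : V | A (u + knothe1 y)].
    by have := mS measurableT A mA; rewrite setTI.
  rewrite -(knothe_law hgamma hF1 hgM E1 knothe1E mB).
  rewrite (_ : _ @^-1` _ = [set y : V | A (u + knothe1 y)]); last by apply/seteqP; split => y /=; [case|].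
  rewrite PE// integral_mkcond; apply: eq_integral => y _.
  rewrite patchE indicE (_ : (y \in _) = (knothe1 y \in [set y | A (y + u)])); last first.
    by apply/idP/idP; rewrite !inE /= addrC.
  by case: ifP; rewrite ?mul1r ?mul0r.
have law : (\int[Q]_z (enorm (z.1 - z.2) ^+ 2)%:E = \int[P]_y (enorm (y - (u + knothe1 y)) ^+ 2)%:E)%E.
  exact: (esym (integral_law mphi (fun A _ => esym (QE A)) mcost)).
rewrite law (ge0_integral_density m1 (fun y => expR_ge0 _) PE); last 2 first.
- exact: (measurableT_comp mcost mphi).
- by move=> y; rewrite lee_fin sqr_ge0.
have cost := knothe_cost hgamma hF1 hgM knothe1E u.
apply: (@le_trans _ _ (\int[gamma]_y (expR (F1 y) * dotv (g1 y - u) (g1 y - u)))%:E); last first.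
  by rewrite lee_fin; exact: tilt_energy.
have tc : tameV (fun y => expR (F1 y) * dotv (g1 y - u) (g1 y - u)).
  apply: tameM => //; have tg i : tameV (fun y => (g1 y - u) ord0 i).
    rewrite (_ : (fun y => (g1 y - u) ord0 i) = fun y => g1 y ord0 i - u ord0 i); last by apply/funext => y; rewrite !mxE.
    by apply: tameB => //; [exact: (tame_gradient_coord hF1 hgM)|exact: tame_cst].
  exact: tame_dotv.
rewrite /Rintegral fineK; last by apply: integrable_fin_num => //; exact: gauss_integrable tc.
apply: le_trans cost; rewrite le_eqVlt; apply/orP; left; apply/eqP.
apply: eq_integral => y _; rewrite -EFinM; congr (_ * _)%:E.
by rewrite /enorm sqr_sqrtr ?dotvv_ge0// opprD addrA.
Qed.

End coupling.

(** * Conclusion, with the degenerate cases *)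

Theorem theorem2p1 (R : realType) (n : nat)
    (gamma : probability 'rV[R]_n R) (hgamma : std_gaussian gamma)
    (f : 'rV[R]_n -> R) (hf : twice_differentiable f)
    (nu : {measure set 'rV[R]_n -> \bar R})
    (hnu : forall A : set 'rV[R]_n, measurable A ->
       nu A = (\int[gamma]_(y in A) (expR (f y))%:E)%E)
    (r : R) (hr : 0 < r) :
  exists x0 : 'rV[R]_n, enorm x0 <= r /\
    (W2sq (tilt nu x0) (gauss_at gamma (centroid (tilt nu x0))) <=
     (2 * Num.sqrt (n%:R) / r)%:E * Dcal gamma f
       - ereal_inf [set (laplacian f y)%:E | y in [set: 'rV[R]_n]])%E.
Proof.
have hg := twice_differentiable_gradient hf.
have DE : Dcal gamma f = (\int[gamma]_y support (grad f) y)%E.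
  rewrite /Dcal /GW /support; apply: eq_integral => y _; congr ereal_sup.
  by rewrite image_comp.
set D := Dcal gamma f in DE *; set inf := ereal_inf _.
have inf_le y : (inf <= (laplacian f y)%:E)%E by apply: ereal_inf_lbound; exists y.
have infoo : (inf < +oo)%E by apply: le_lt_trans (inf_le 0) _; rewrite ltry.
pose k := 2 * Num.sqrt (n%:R) / r.
have x00 : enorm (0 : 'rV[R]_n) <= r by rewrite /enorm dotv0l sqrtr0 ltW.
(* With infinite width any tilt will do: the coefficient of D is positive because n = 0 would give D
   = 0, and the infimum is below + oo, so the right-hand side is + oo. *)
have [Doo|Dfin] := eqVneq D +oo%E.
  have n0 : (0 < n)%N.
    rewrite lt0n; apply/eqP => n0; move: Doo; rewrite DE.
    rewrite (eq_integral (fun=> 0%E)) ?integral0// => y _.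
    rewrite /support (_ : [set _ | _ in _] = [set 0%E]) ?ereal_sup1//.
    have d0 x : dotv (grad f x) y = 0.
      by rewrite /dotv big1// => -[i hi] _; exfalso; rewrite n0 in hi.
    by apply/seteqP; split => [_ [x _ <-]|_ ->] /=; [rewrite d0|exists 0; rewrite ?d0].
  exists 0; split => //; rewrite -/k Doo gt0_muley; last first.
    by rewrite lte_fin /k divr_gt0// mulr_gt0// sqrtr_gt0 ltr0n.
  by case: inf inf_le infoo => [l||]// _ _; rewrite /= leey.
have Dlt : (\int[gamma]_y support (grad f) y < +oo)%E by rewrite -DE ltey.
have [h [th h0 hle Dh gap]] := support_potential hgamma hg.1 Dlt.
rewrite DE Dh.
(* Finite width makes the gradient bounded in the coordinate norm, which supplies the constant M
   required by the preceding results. *)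
have gM y : `|grad f y| <= `|grad f 0| + 4 * \int[gamma]_y h y.
  have m0 : 0 <= \int[gamma]_y h y by apply: Rintegral_ge0 => z _.
  rewrite -[grad f y](subrK (grad f 0)) addrC; apply: le_trans (ler_normD _ _) _.
  rewrite lerD2l; apply/normv_leP => [|i]; first exact: mulr_ge0.
  by have := gap y i; lra.
have [x [xr vx]] := exists_small_excess hgamma hg gM hr th h0 hle gap.
have xr' : enorm x <= r.
  by rewrite -(ler_pXn2r (n := 2)) ?nnegrE ?sqrtr_ge0 ?(ltW hr)// sqr_sqrtr// dotvv_ge0.
exists x; split => //; rewrite -EFinM.
(* For a finite infimum l the heat bound holds with L = - l; for an infimum of - oo the right-hand
   side is + oo. *)
case: inf inf_le infoo => [l||] inf_le // _; last by rewrite /= leey.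
have fL y : - (- l) <= laplacian f y by rewrite opprK -lee_fin.
have heat := heat_lower hgamma hf gM fL.
have := tilt_transport hgamma hg gM heat hnu x.
by move/le_trans; apply; rewrite -EFinB lee_fin addrC lerD2r.
Qed.
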